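(* Let $d=2$ (with $b=0$), or $d=3$ with $L_2+L_3=0$, and let $T>0$. Assume that the exact solution $Q_e$ is sufficiently smooth on $\overline\Omega\times[0,T]$, that $$\kappa\ge\max\Big\{a+c\big(\eta^{(d)}\big)^2,\ \max_{\xi\in[0,\eta^{(d)}]}|\overline f'(\xi)|\Big\},\qquad \tau\le\Big(\frac{\kappa G^*}{2}+\frac{2^{d-1}L}{h^2}\Big)^{-1}.$$ Let $p\in\{1,2\}$ and let $(Q_h^n,s^n)$ be generated by the MBP-sESAV$p$ scheme. With $e_Q^{ij,n}=Q_h^{ij,n}-Q_e^{ij}(t_n)$ and $e_s^n=s^n-s_e(t_n)$, where $t_n=n\tau$, it holds that $$\|e_Q^n\|_h+\|\nabla_he_Q^n\|_h+|e_s^n|\le C(\tau^p+h^2),\qquad 0\le n\le\lfloor T/\tau\rfloor,$$ where the constant $C$ depends on $C_*,|\Omega|,G_*,G^*,Q_e,T$ and $\|f\|_{C^1\{Q:|Q|_F\le\eta^{(d)}\}}$ (and is independent of $n,\tau,h$).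
   Context: Parameters: $a\in\mathbb R$, $b\ge0$, $c>0$, with $b=0$ if $d=2$; $L_1,L_2,L_3$ are the elastic constants and $L=L_1+\frac{L_2+L_3}{2}>0$ (so $L=L_1$ in the case $d=3$, $L_2+L_3=0$). The model parameters and $\kappa$ are fixed, and constants may depend on them. Domain $\Omega=[0,L_d]^d$, mesh size $h=L_d/M$ with $M$ a positive integer, uniform grid with nodes $\{0,\dots,M\}^d$, time step $\tau>0$. Exact solution. $Q_e$ is the solution, with values in symmetric trace-free $d\times d$ matrices, of $$\partial_tQ^{ij}=L\Delta Q^{ij}+f(Q^{ij}),\quad f(Q^{ij})=-aQ^{ij}+b\big((Q^2)^{ij}-\tfrac1d\operatorname{tr}(Q^2)\delta^{ij}\big)-c\operatorname{tr}(Q^2)Q^{ij},$$ with $Q|_{\partial\Omega}=0$ and $Q(\cdot,0)=Q^0$ (the $Q$-tensor flow in the cases considered). With $\mathcal F_{\rm bulk}(Q)=\frac a2\operatorname{tr}(Q^2)-\frac b3\operatorname{tr}(Q^3)+\frac c4\operatorname{tr}^2(Q^2)$, $s_e(t)=\mathcal E_1[Q_e(t)]=\int_\Omega\mathcal F_{\rm bulk}(Q_e(x,t))\,dx$. $Q_e(t_n)$ is also understood as its restriction to the grid. Grid functions. $\mathbf E_h^0$ is the set of real functions on the grid vanishing at all boundary nodes. $\mathbf S_h^{(d)}$ is the set of symmetric trace-free $d\times d$ arrays with entries in $\mathbf E_h^0$. $\Delta_h$ is the standard $(2d+1)$-point discrete Laplacian, $\langle U,V\rangle_h=h^d\sum UV$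 (sum over grid nodes), $\|Q_h\|_h^2=\sum_{i,j}\langle Q_h^{ij},Q_h^{ij}\rangle_h$, and $\|\nabla_hQ_h\|_h^2=-\sum_{i,j}\langle\Delta_hQ_h^{ij},Q_h^{ij}\rangle_h$. Initial data. $Q_h^0$ is the restriction of $Q^0$ to the grid and $s^0=\mathcal E_{1h}[Q_h^0]$, where $\mathcal E_{1h}[Q_h]=\langle\mathcal F_{\rm bulk}(Q_h),1\rangle_h$. $\|Q^0\|_{L^\infty(\Omega)}=\sup_{x\in\Omega}|Q^0(x)|_F$ with $|\cdot|_F$ the Frobenius norm. Bounds. With $a_-=\max\{0,-a\}$, $$\eta^{(2)}=\max\Big\{\|Q^0\|_{L^\infty(\Omega)},\sqrt{a_-/c}\Big\},$$ $$\eta^{(3)}=\max\Big\{\|Q^0\|_{L^\infty(\Omega)},\frac{|b|+\sqrt{b^2-24ac}}{2\sqrt6\,c}\Big\}\ \text{if } a\le\frac{b^2}{24c},\qquad \eta^{(3)}=\|Q^0\|_{L^\infty(\Omega)}\ \text{otherwise.}$$ $\overline f(\xi)=-a\xi+\frac b{\sqrt6}\xi^2-c\xi^3$. $g(Q_h,s)=\exp\{s\}/\exp\{\mathcal E_{1h}[Q_h]\}$. $C_*>0$ is a fixed constant with $|\Omega|\mathcal F_{\rm bulk}(A)\ge-C_*$ for all symmetric trace-free $A\in\mathbb R^{d\times d}$. $E_{el}[Q_h]=\frac L2\|\nabla_hQ_h\|_h^2$, $E_h[Q_h,s]=E_{el}[Q_h]+s$, and $G^*=\exp\{E_h[Q_h^0,\mathcal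 E_{1h}[Q_h^0]]+C_*\}$. $G_*>0$ denotes a lower bound such that $G_*\le g\le G^*$ along the values $(Q_h^n,s^n)$ and $(Q_{*,h}^{n+1/2},s_*^{n+1/2})$ produced by the scheme. MBP-sESAV1. $(P_h^+,\sigma^+)=\text{MBP-sESAV1}(P_h,\sigma,\theta)\in\mathbf S_h^{(d)}\times\mathbb R$ is defined by, for $1\le i,j\le d$ at interior nodes, $$\frac{P_h^{+,ij}-P_h^{ij}}{\theta}=L\Delta_hP_h^{+,ij}+g(P_h,\sigma)\big(f(P_h^{ij})-\kappa(P_h^{+,ij}-P_h^{ij})\big),$$ $$\tilde\sigma^+=\sigma-g(P_h,\sigma)\sum_{i,j=1}^d\langle f(P_h^{ij}),P_h^{+,ij}-P_h^{ij}\rangle_h,\qquad\sigma^+=\max\{\tilde\sigma^+,-C_*-E_{el}[P_h^+]\};$$ the MBP-sESAV1 scheme is $(Q_h^{n+1},s^{n+1})=\text{MBP-sESAV1}(Q_h^n,s^n,\tau)$. MBP-sESAV2. Given $(Q_h^n,s^n)$, set $(Q_{*,h}^{n+1/2},s_*^{n+1/2})=\text{MBP-sESAV1}(Q_h^n,s^n,\tau/2)$, $g_*=g(Q_{*,h}^{n+1/2},s_*^{n+1/2})$ and $Q_h^{n+1/2}=(Q_h^{n+1}+Q_h^n)/2$. Then $(Q_h^{n+1},s^{n+1})\in\mathbf S_h^{(d)}\times\mathbb R$ is defined by, for $1\le i,j\le d$ at interior nodes, $$\Big(\big(\tfrac2\tau+\kappa g_*\big)I-L\Delta_h\Big)Q_h^{ij,n+1}=\Big(\big(\tfrac2\tau-\kappa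 g_*\big)I+L\Delta_h\Big)Q_h^{ij,n}+2g_*\big(\kappa Q_{*,h}^{ij,n+1/2}+f(Q_{*,h}^{ij,n+1/2})\big),$$ $$\tilde s^{n+1}=s^n-g_*\sum_{i,j=1}^d\langle f(Q_{*,h}^{ij,n+1/2}),Q_h^{ij,n+1}-Q_h^{ij,n}\rangle_h+\kappa g_*\sum_{i,j=1}^d\langle Q_h^{ij,n+1/2}-Q_{*,h}^{ij,n+1/2},Q_h^{ij,n+1}-Q_h^{ij,n}\rangle_h,$$ $$s^{n+1}=\max\{\tilde s^{n+1},-C_*-E_{el}[Q_h^{n+1}]\}.$$ *)

(* Defs.v *)
From HB Require Import structures.
From mathcomp Require Import all_boot all_order all_algebra.
From mathcomp Require Import all_classical all_reals all_analysis.
Set Implicit Arguments.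
Unset Strict Implicit.
Unset Printing Implicit Defensive.
Import Order.TTheory GRing.Theory Num.Theory.
Import numFieldNormedType.Exports.
Local Open Scope classical_set_scope.
Local Open Scope ring_scope.

(* [ca], [cb], [cc] are the bulk coefficients a, b, c; [el_L1], ... the elastic
   constants. *)
Record model (R : realType) := Model {
  ca : R; cb : R; cc : R;
  el_L1 : R; el_L2 : R; el_L3 : R }.

Section Tensors.
Variables (R : realType) (m : model R).

Definition elL : R := el_L1 m + (el_L2 m + el_L3 m) / 2.

(* The two cases in which the elastic part of the Q-tensor flow is [L Delta]. *)
Definition admissible_case (d : nat) : Prop :=
  (d = 2%N /\ cb m = 0) \/ (d = 3%N /\ el_L2 m + el_L3 m = 0).

Definition sym_tracefree d (A : 'M[R]_d) : Prop := A^T = A /\ \tr A = 0.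

Definition frob d (A : 'M[R]_d) : R := Num.sqrt (\sum_i \sum_j A i j ^+ 2).

Definition f_bulk d (A : 'M[R]_d) : 'M[R]_d :=
  - ca m *: A + cb m *: (A *m A - (d%:R^-1 * \tr (A *m A))%:M)
  - (cc m * \tr (A *m A)) *: A.

Definition F_bulk d (A : 'M[R]_d) : R :=
  ca m / 2 * \tr (A *m A) - cb m / 3 * \tr (A *m A *m A)
  + cc m / 4 * \tr (A *m A) ^+ 2.

Definition fbar (xi : R) : R :=
  - ca m * xi + cb m / Num.sqrt 6 * xi ^+ 2 - cc m * xi ^+ 3.

(* The radii eta_bound^(2) and eta_bound^(3); [N0] stands for the sup norm of the initial
   datum. *)
Definition eta2 (N0 : R) : R :=
  Num.max N0 (Num.sqrt (Num.max 0 (- ca m) / cc m)).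

Definition eta3 (N0 : R) : R :=
  if ca m <= cb m ^+ 2 / (24 * cc m) then
    Num.max N0 ((`|cb m| + Num.sqrt (cb m ^+ 2 - 24 * ca m * cc m))
                / (2 * Num.sqrt 6 * cc m))
  else N0.

Definition eta_bound (d : nat) (N0 : R) : R :=
  if d == 2%N then eta2 N0 else eta3 N0.

Definition kappa_min (e : R) : R :=
  Num.max (ca m + cc m * e ^+ 2)
          (sup [set `|derive1 fbar xi| | xi in `[0, e]]).

End Tensors.

Section ExactSolution.
Variables (R : realType) (d : nat) (m : model R) (len T : R).

Definition Omega_box : set 'rV[R]_d := [set x | forall i, 0 <= x 0 i <= len].

Definition box_boundary : set 'rV[R]_d :=
  [set x | Omega_box x /\ exists i, x 0 i = 0 \/ x 0 i = len].

Definition Omega_T : set ('rV[R]_d * R) :=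
  [set p | Omega_box p.1 /\ 0 <= p.2 <= T].

Definition supnorm (Q0 : 'rV[R]_d -> 'M[R]_d) : R :=
  sup [set frob (Q0 x) | x in Omega_box].

(* [None] is the time direction, [Some i] the i-th space direction. *)
Definition st_dir (e : option 'I_d) : 'rV[R]_d * R :=
  if e is Some i then (delta_mx 0 i, 0) else (0, 1).

(* u is C^r on the closed set D: the partial derivatives of order at most r
   exist in the interior of D and extend continuously to D. *)
Fixpoint C_upto (r : nat) (D : set ('rV[R]_d * R)) (u : 'rV[R]_d * R -> R)
    : Prop :=
  {within D, continuous u} /\
  if r is r'.+1 then
    forall e, exists v, C_upto r' D v /\
      forall p, D° p -> is_derive p (st_dir e) u (v p)
  else True.

Definition smooth_solution (r : nat) (Qe : 'rV[R]_d * R -> 'M[R]_d) : Prop :=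
  forall i j, C_upto r Omega_T (fun p => Qe p i j).

Definition Laplacian (u : 'rV[R]_d * R -> R) (p : 'rV[R]_d * R) : R :=
  \sum_(k < d) 'D_(st_dir (Some k)) ('D_(st_dir (Some k)) u) p.

Definition Qtensor_flow (Q0 : 'rV[R]_d -> 'M[R]_d)
    (Qe : 'rV[R]_d * R -> 'M[R]_d) : Prop :=
  [/\ forall p, Omega_T p -> sym_tracefree (Qe p),
      forall p, Omega_T° p -> forall i j,
        'D_(st_dir None) (fun q => Qe q i j) p =
        elL m * Laplacian (fun q => Qe q i j) p + f_bulk m (Qe p) i j,
      forall x t, box_boundary x -> 0 <= t <= T -> Qe (x, t) = 0
    & forall x, Omega_box x -> Qe (x, 0) = Q0 x].

End ExactSolution.

(* The integral over [0, len]^n, as an iterated one-dimensional Lebesgue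
   integral: the library has no Lebesgue measure on row vectors. *)
Fixpoint box_integral (R : realType) (len : R) (n : nat) : ('rV[R]_n -> R) -> R :=
  match n with
  | 0%N => fun F => F 0
  | n'.+1 => fun F =>
      \int[lebesgue_measure]_(y in `[0, len])
        box_integral len (fun v : 'rV[R]_n' => F (row_mx (y%:M : 'rV[R]_1) v))
  end.

Definition s_exact (R : realType) (d : nat) (m : model R) (len : R)
    (Qe : 'rV[R]_d * R -> 'M[R]_d) (t : R) : R :=
  box_integral len (fun x => F_bulk m (Qe (x, t))).

Section Scheme.
Variables (R : realType) (d : nat) (m : model R) (len kappa Cstar : R).
Variable M : nat.

Definition mesh_h : R := len / M%:R.

Definition grid_node := {ffun 'I_d -> 'I_M.+1}.

Definition gtensor := grid_node -> 'M[R]_d.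

Definition grid_point (k : grid_node) : 'rV[R]_d := \row_i ((k i)%:R * mesh_h).

Definition interior_node (k : grid_node) : bool := [forall i, (0 < k i < M)%N].

(* Only used at interior nodes, where [inord] does not overflow. *)
Definition node_up (k : grid_node) (i : 'I_d) : grid_node :=
  [ffun j => if j == i then inord (k j).+1 else k j].
Definition node_down (k : grid_node) (i : 'I_d) : grid_node :=
  [ffun j => if j == i then inord (k j).-1 else k j].

(* The value 0 at boundary nodes is a convention: the discrete Laplacian is
   only evaluated at interior nodes or paired with grid functions vanishing on
   the boundary. *)
Definition lap_h (U : grid_node -> R) (k : grid_node) : R :=
  if interior_node k then
    (\sum_i (U (node_up k i) - 2 * U k + U (node_down k i))) / mesh_h ^+ 2
  else 0.

Definition ip_h (U V : grid_node -> R) : R := mesh_h ^+ d * \sum_k U k * V k.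

Definition entry_h (Q : gtensor) (i j : 'I_d) : grid_node -> R := fun k => Q k i j.

Definition tip_h (P Q : gtensor) : R :=
  \sum_i \sum_j ip_h (entry_h P i j) (entry_h Q i j).

Definition norm_h (Q : gtensor) : R := Num.sqrt (tip_h Q Q).

Definition sqgrad_h (Q : gtensor) : R :=
  - \sum_i \sum_j ip_h (lap_h (entry_h Q i j)) (entry_h Q i j).

Definition gradnorm_h (Q : gtensor) : R := Num.sqrt (sqgrad_h Q).

Definition in_S_h (Q : gtensor) : Prop :=
  (forall k, sym_tracefree (Q k)) /\ (forall k, ~~ interior_node k -> Q k = 0).

Definition E1_h (Q : gtensor) : R := ip_h (fun k => F_bulk m (Q k)) (fun=> 1).

Definition E_el (Q : gtensor) : R := elL m / 2 * sqgrad_h Q.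

Definition E_h (Q : gtensor) (s : R) : R := E_el Q + s.

Definition g_h (Q : gtensor) (s : R) : R := expR s / expR (E1_h Q).

Definition Gstar (Q0h : gtensor) : R := expR (E_h Q0h (E1_h Q0h) + Cstar).

Definition f_h (Q : gtensor) : gtensor := fun k => f_bulk m (Q k).

(* (P', sigma') = MBP-sESAV1(P, sigma, theta) *)
Definition sESAV1 (P : gtensor) (sigma theta : R) (P' : gtensor) (sigma' : R)
    : Prop :=
  let g := g_h P sigma in
  [/\ in_S_h P',
      forall k, interior_node k -> forall i j,
        (P' k i j - P k i j) / theta =
        elL m * lap_h (entry_h P' i j) k
        + g * (f_h P k i j - kappa * (P' k i j - P k i j))
    & sigma' = Num.max (sigma - g * tip_h (f_h P) (fun k => P' k - P k))
                       (- Cstar - E_el P')].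

(* Corrector of MBP-sESAV2, with (Qs, ss) the predicted half-step values. *)
Definition sESAV2_corrector (Q : gtensor) (s tau : R) (Qs : gtensor) (ss : R)
    (Q' : gtensor) (s' : R) : Prop :=
  let g := g_h Qs ss in
  [/\ in_S_h Q',
      forall k, interior_node k -> forall i j,
        (2 / tau + kappa * g) * Q' k i j - elL m * lap_h (entry_h Q' i j) k =
        (2 / tau - kappa * g) * Q k i j + elL m * lap_h (entry_h Q i j) k
        + 2 * g * (kappa * Qs k i j + f_h Qs k i j)
    & s' = Num.max
        (s - g * tip_h (f_h Qs) (fun k => Q' k - Q k)
         + kappa * g * tip_h (fun k => 2^-1 *: (Q' k + Q k) - Qs k)
                             (fun k => Q' k - Q k))
        (- Cstar - E_el Q')].

Definition sESAV2 (Q : gtensor) (s tau : R) (Q' : gtensor) (s' : R) : Prop :=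
  exists Qs ss, sESAV1 Q s (tau / 2) Qs ss /\
                sESAV2_corrector Q s tau Qs ss Q' s'.

Definition sESAV_step (p : nat) (Q : gtensor) (s tau : R) (Q' : gtensor) (s' : R)
    : Prop :=
  match p with
  | 1%N => sESAV1 Q s tau Q' s'
  | 2%N => sESAV2 Q s tau Q' s'
  | _ => False
  end.

Definition restrict_h (U : 'rV[R]_d -> 'M[R]_d) : gtensor := fun k => U (grid_point k).

Definition sESAV_generated (p : nat) (Q0 : 'rV[R]_d -> 'M[R]_d) (tau : R)
    (Q : nat -> gtensor) (s : nat -> R) : Prop :=
  [/\ Q 0%N = restrict_h Q0, s 0%N = E1_h (restrict_h Q0)
    & forall n, sESAV_step p (Q n) (s n) tau (Q n.+1) (s n.+1)].

(* [Glow] bounds g from below at all (Q^n, s^n), n <= N, and, for the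
   second-order scheme, at all predicted values used to reach step N. *)
Definition g_lower_bound (p : nat) (tau : R) (N : nat)
    (Q : nat -> gtensor) (s : nat -> R) (Glow : R) : Prop :=
  (forall n, (n <= N)%N -> Glow <= g_h (Q n) (s n)) /\
  (p = 2%N -> forall n Qs ss, (n < N)%N ->
    sESAV1 (Q n) (s n) (tau / 2) Qs ss -> Glow <= g_h Qs ss).

End Scheme.

(* Main.v *)
Require Import Defs.
From HB Require Import structures.
From mathcomp Require Import all_boot all_order all_algebra.
From mathcomp Require Import all_classical all_reals all_analysis.
From mathcomp Require Import ring lra.
Set Implicit Arguments.
Unset Strict Implicit.
Unset Printing Implicit Defensive.
Import Order.TTheory GRing.Theory Num.Theory.
Import numFieldNormedType.Exports.
Local Open Scope ring_scope.

(** The scheme is stable for two reasons. Testing it with the increment of Q, the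
    update of the auxiliary variable s cancels the reaction, so that the discrete
    energy E_el + s never exceeds its initial value ([sESAV1_energy],
    [corrector_energy]); as E_el is nonnegative and the discrete bulk energy is
    bounded below, the factor g stays below G^*. The stabilization makes the implicit
    operator obey a maximum principle ([discrete_max_principle]), and kappa is large
    enough for the stabilized reaction to map the ball of radius eta into the ball of
    radius kappa eta ([f_bulk_maxbound]); hence |Q^n| <= eta ([scheme_invariants]).
    On this ball the reaction and the potential are Lipschitz.

    The exact solution satisfies the scheme up to tau^p + h^2
    ([exact_consistent]). Taylor expansion gives this inside the space-time cylinder,
    where the derivatives exist, and contraction towards the centre carries it to the
    closed cylinder, where the values are continuous ([closed_stencil]).

    For the error, let e be the error of Q and z the distance of s to the discrete
    bulk energy of the exact solution. Since g would be 1 on the exact pair,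
    |g - 1| is at most a multiple of |e| + z ([g_error]). Testing the error equation
    with w = e^{n+1} - e^n gives
      |w|^2 / tau + L/2 (|grad e^{n+1}|^2 - |grad e^n|^2) <= C (|e| + z + eps) |w|,
    while z grows by at most C (|w| + tau (|e| + z + eps)) ([sESAV1_error],
    [corrector_error]): the cut-off in s only brings s closer to any value above the
    lower bound of the energy ([cutoff_dist]), and the increments of the bulk
    energy are second, or for the midpoint third, order accurate. In the
    second-order scheme the predictor contributes its own errors, which by the same
    estimates are those of the beginning of the step plus a term gaining one
    power of tau ([predictor_residual]). With a large enough weight mu the quantity
      |e|^2 + z^2 + mu L |grad e|^2
    therefore grows by a factor 1 + O(tau) per step, up to tau eps^2
    ([energy_growth], [step_growth]), and the discrete Gronwall inequality bounds it
    by C eps^2.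

    It remains to compare the discrete bulk energy of the exact solution with the
    integral s_e. The potential vanishes on the boundary and has second differences
    of order h^2, so the sum over the nodes is a composite trapezoidal rule with
    error O(h^2), one dimension at a time ([trapezoid_rule], [box_quadrature]). *)

(** * Frobenius geometry of matrices *)

(** Cauchy-Schwarz and the triangle inequality are needed for three different
    bilinear forms: on matrices, on grid tensors and on scalar grid functions. *)
Section SemiInnerProduct.
Variables (R : realType) (V : lmodType R) (b : V -> V -> R).
Hypotheses (bDl : forall x y z, b (x + y) z = b x z + b y z)
  (bZl : forall a x y, b (a *: x) y = a * b x y)
  (bC : forall x y, b x y = b y x)
  (b_ge0 : forall x, 0 <= b x x).

Let nrm x := Num.sqrt (b x x).

Lemma sip_sqr x : nrm x ^+ 2 = b x x.
Proof. by rewrite /nrm sqr_sqrtr. Qed.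

Lemma sip_CS x y : `|b x y| <= nrm x * nrm y.
Proof.
rewrite -ler_sqr ?nnegrE ?mulr_ge0 ?sqrtr_ge0// exprMn !sip_sqr (real_normK (num_real _)).
have E t : b (x + t *: y) (x + t *: y) = b x x + 2 * t * b x y + t ^+ 2 * b y y.
  have Dr z u v : b z (u + v) = b z u + b z v by rewrite bC bDl ![b _ z]bC.
  have Zr a u v : b u (a *: v) = a * b u v by rewrite bC bZl bC.
  by rewrite bDl !Dr !bZl !Zr (bC y x); ring.
have H t : 0 <= b x x + 2 * t * b x y + t ^+ 2 * b y y by rewrite -E.
have [y0|y0] := eqVneq (b y y) 0.
  rewrite y0 mulr0 le_eqVlt; apply/orP; left; rewrite sqrf_eq0.
  apply/negPn/negP => nz.
  have := H (- (b x x + 1) / (2 * b x y)).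
  rewrite y0 mulr0 addr0 [2 * _]mulrC.
  rewrite -(mulrA _ 2) divfK ?mulf_neq0 ?pnatr_eq0//; lra.
have yp : 0 < b y y by rewrite lt_def y0 b_ge0.
have := H (- b x y / b y y).
have -> : b x x + 2 * (- b x y / b y y) * b x y + (- b x y / b y y) ^+ 2 * b y y
  = (b x x * b y y - b x y ^+ 2) / b y y by field.
by rewrite pmulr_lge0 ?invr_gt0// subr_ge0.
Qed.

Lemma sip_nrmD x y : nrm (x + y) <= nrm x + nrm y.
Proof.
rewrite -ler_sqr ?nnegrE ?addr_ge0 ?sqrtr_ge0//.
have := sip_CS x y; have := ler_norm (b x y).
have e : b (x + y) (x + y) = b x x + 2 * b x y + b y y.
  by rewrite bDl ![b _ (x + y)]bC !bDl (bC y x); ring.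
by rewrite sqrrD !sip_sqr e mulr2n; lra.
Qed.

Lemma sip_nrmZ a x : nrm (a *: x) = `|a| * nrm x.
Proof.
have e : b (a *: x) (a *: x) = a ^+ 2 * b x x by rewrite bZl bC bZl; ring.
by rewrite /nrm e sqrtrM ?sqr_ge0// sqrtr_sqr.
Qed.
End SemiInnerProduct.

Section Frobenius.
Variables (R : realType) (d : nat).
Implicit Types A B u v w : 'M[R]_d.

Definition mdot A B : R := \sum_i \sum_j A i j * B i j.

Lemma mdotDl A B w : mdot (A + B) w = mdot A w + mdot B w.
Proof.
rewrite /mdot -big_split; apply: eq_bigr => i _; rewrite -big_split.
by apply: eq_bigr => j _; rewrite mxE mulrDl.
Qed.

Lemma mdotZl a A B : mdot (a *: A) B = a * mdot A B.
Proof.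
rewrite /mdot mulr_sumr; apply: eq_bigr => i _; rewrite mulr_sumr.
by apply: eq_bigr => j _; rewrite mxE mulrA.
Qed.

Lemma mdotC A B : mdot A B = mdot B A.
Proof. by do 2![apply: eq_bigr => ? _]; rewrite mulrC. Qed.

Lemma mdot_ge0 A : 0 <= mdot A A.
Proof. by do 2![apply: sumr_ge0 => ? _]; rewrite -expr2 sqr_ge0. Qed.

Lemma mdotNl A B : mdot (- A) B = - mdot A B.
Proof. by rewrite -scaleN1r mdotZl mulN1r. Qed.

Lemma mdotBl A B w : mdot (A - B) w = mdot A w - mdot B w.
Proof. by rewrite mdotDl mdotNl. Qed.

Lemma mdotBr A B w : mdot w (A - B) = mdot w A - mdot w B.
Proof. by rewrite mdotC mdotBl ![mdot _ w]mdotC. Qed.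

Lemma mdotZr a A B : mdot A (a *: B) = a * mdot A B.
Proof. by rewrite mdotC mdotZl mdotC. Qed.

Lemma frobE A : frob A = Num.sqrt (mdot A A).
Proof. by []. Qed.

Lemma frob_ge0 A : 0 <= frob A. Proof. exact: sqrtr_ge0. Qed.

Lemma frob_sqr A : frob A ^+ 2 = mdot A A.
Proof. by rewrite frobE sqr_sqrtr// mdot_ge0. Qed.

Lemma mdot_CS A B : `|mdot A B| <= frob A * frob B.
Proof. exact: (sip_CS mdotDl mdotZl mdotC mdot_ge0). Qed.

Lemma mdot_le A B : mdot A B <= frob A * frob B.
Proof. exact: le_trans (ler_norm _) (mdot_CS A B). Qed.

Lemma frobD A B : frob (A + B) <= frob A + frob B.
Proof. exact: (sip_nrmD mdotDl mdotZl mdotC mdot_ge0). Qed.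

Lemma frobZ a A : frob (a *: A) = `|a| * frob A.
Proof. exact: (sip_nrmZ mdotZl mdotC). Qed.

Lemma frobN A : frob (- A) = frob A.
Proof. by rewrite -scaleN1r frobZ normrN1 mul1r. Qed.

Lemma frobB A B : frob (A - B) <= frob A + frob B.
Proof. by rewrite -(frobN B); exact: frobD. Qed.

Lemma frob0 : frob (0 : 'M[R]_d) = 0.
Proof. by rewrite -(scale0r 0) frobZ normr0 mul0r. Qed.

Lemma frob_sum (I : finType) (F : I -> 'M[R]_d) : frob (\sum_i F i) <= \sum_i frob (F i).
Proof.
elim/big_ind2: _ => [|A a B b Aa Bb|//]; first by rewrite frob0.
by apply: le_trans (frobD _ _) _; exact: lerD.
Qed.

Lemma frob_entry A i j : `|A i j| <= frob A.
Proof.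
rewrite -ler_sqr ?nnegrE ?frob_ge0// frob_sqr (real_normK (num_real _)).
rewrite /mdot (bigD1 i)//= (bigD1 j)//= -expr2 -addrA lerDl addr_ge0//.
  by apply: sumr_ge0 => ? _; rewrite -expr2 sqr_ge0.
by do 2![apply: sumr_ge0 => ? _]; rewrite -expr2 sqr_ge0.
Qed.

(** Bounding a tensor entry by entry is how scalar Taylor estimates are turned
    into Frobenius ones. *)
Lemma frob_le_entries A K : (forall i j, `|A i j| <= K) -> frob A <= d%:R * K.
Proof.
move=> H; have [d0|dp] := posnP d.
  rewrite frobE /mdot big1 ?sqrtr0 ?d0 ?mul0r// => i _.
  by have := ltn_ord i; rewrite {2}d0.
have K0 : 0 <= K := le_trans (normr_ge0 _) (H (Ordinal dp) (Ordinal dp)).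
rewrite -ler_sqr ?nnegrE ?frob_ge0 ?mulr_ge0// frob_sqr.
apply: (@le_trans _ _ (\sum_(i < d) \sum_(j < d) K ^+ 2)).
  by do 2![apply: ler_sum => ? _]; rewrite -expr2 -(real_normK (num_real _)) ler_sqr ?nnegrE.
by rewrite !big_const_ord !iter_addr_0 -mulrnA -[_ *+ _]mulr_natl natrM exprMn expr2.
Qed.

Lemma mdot_tr A B : mdot A B = \tr (A *m B^T).
Proof.
rewrite /mdot /mxtrace; apply: eq_bigr => i _; rewrite mxE.
by apply: eq_bigr => j _; rewrite mxE.
Qed.

Lemma frob_tr A : frob A^T = frob A.
Proof.
rewrite !frobE; congr Num.sqrt; rewrite /mdot exchange_big.
by do 2![apply: eq_bigr => ? _]; rewrite !mxE.
Qed.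

Lemma tr_CS A B : `|\tr (A *m B)| <= frob A * frob B.
Proof. by rewrite -(frob_tr B) -[in X in `|X|](trmxK B) -mdot_tr mdot_CS. Qed.

(** Submultiplicativity of the Frobenius norm: Cauchy-Schwarz in each entry of
    the product. *)
Lemma frobM A B : frob (A *m B) <= frob A * frob B.
Proof.
rewrite -ler_sqr ?nnegrE ?mulr_ge0 ?frob_ge0// exprMn !frob_sqr.
rewrite /mdot big_distrlr /=; apply: ler_sum => i _.
rewrite -mulr_sumr (exchange_big _ _ _ _ _ (fun k l => B k l * B k l)) mulr_sumr.
apply: ler_sum => j _ /=.
(* A sum over k is a Frobenius product of matrices supported on one column. *)
pose X (x : 'I_d -> R) : 'M[R]_d := \matrix_(k, l) (if l == i then x k else 0).
have dotX x y : mdot (X x) (X y) = \sum_k x k * y k.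
  rewrite /mdot; apply: eq_bigr => k _.
  rewrite (bigD1 i)//= big1 ?addr0 ?mxE ?eqxx// => l /negPf li.
  by rewrite !mxE li mulr0.
rewrite mxE -!dotX -expr2 -!frob_sqr -exprMn -(real_normK (num_real _)).
by rewrite ler_sqr ?nnegrE ?mulr_ge0 ?frob_ge0// mdot_CS.
Qed.

Lemma sym_tracefreeD A B :
  sym_tracefree A -> sym_tracefree B -> sym_tracefree (A + B).
Proof. by move=> [a1 a2] [b1 b2]; split; rewrite linearD /= ?a1 ?b1 ?a2 ?b2 ?addr0. Qed.

Lemma sym_tracefreeZ a A : sym_tracefree A -> sym_tracefree (a *: A).
Proof. by move=> [a1 a2]; split; rewrite linearZ /= ?a1 ?a2 ?mulr0. Qed.

Lemma sym_tracefreeB A B :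
  sym_tracefree A -> sym_tracefree B -> sym_tracefree (A - B).
Proof.
by move=> sA sB; rewrite -scaleN1r; apply: sym_tracefreeD; last exact: sym_tracefreeZ.
Qed.

Lemma sym_tracefree0 : sym_tracefree (0 : 'M[R]_d).
Proof. by split; rewrite ?trmx0 ?mxtrace0. Qed.

End Frobenius.

(** * The bulk potential and the reaction term *)
Section LocallyLipschitz.
Variables (R : realType) (d : nat) (B : R).
Implicit Types (phi psi : 'M[R]_d -> R) (A : 'M[R]_d).

(** Closed under sums and products, hence satisfied by every polynomial in the
    entries; this yields all the Lipschitz constants of the bulk terms. *)
Definition lip_on phi := exists2 C, 0 <= C & forall A A', frob A <= B ->
  frob A' <= B -> `|phi A| <= C /\ `|phi A - phi A'| <= C * frob (A - A').

Lemma lip_cst c : lip_on (fun=> c).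
Proof.
by exists `|c| => // A A' _ _; split=> //; rewrite subrr normr0 mulr_ge0 ?frob_ge0.
Qed.

Lemma lip_entry i j : 0 <= B -> lip_on (fun A => A i j).
Proof.
move=> B0; exists (B + 1); first by rewrite addr_ge0.
move=> A A' HA HA'; split.
  by apply: le_trans (frob_entry A i j) _; rewrite (le_trans HA)// lerDl.
have -> : A i j - A' i j = (A - A') i j by rewrite !mxE.
apply: le_trans (frob_entry _ i j) _.
by rewrite ler_peMl ?frob_ge0// lerDr.
Qed.

Lemma lip_add phi psi : lip_on phi -> lip_on psi -> lip_on (fun A => phi A + psi A).
Proof.
move=> [C C0 H] [C' C'0 H']; exists (C + C'); first exact: addr_ge0.
move=> A A' HA HA'; have [h1 h2] := H _ _ HA HA'; have [h3 h4] := H' _ _ HA HA'.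
split; first by apply: le_trans (ler_normD _ _) (lerD _ _).
rewrite opprD addrACA mulrDl.
by apply: le_trans (ler_normD _ _) (lerD _ _).
Qed.

Lemma lip_mul phi psi : lip_on phi -> lip_on psi -> lip_on (fun A => phi A * psi A).
Proof.
move=> [C C0 H] [C' C'0 H']; exists (C * C' + C' * C); first by rewrite addr_ge0 ?mulr_ge0.
move=> A A' HA HA'; have [h1 h2] := H _ _ HA HA'; have [h3 h4] := H' _ _ HA HA'.
have [h5 _] := H _ _ HA' HA; split.
  rewrite normrM; apply: (@le_trans _ _ (C * C')); first exact: ler_pM.
  by rewrite lerDl mulr_ge0.
have -> : phi A * psi A - phi A' * psi A' =
  (phi A - phi A') * psi A + phi A' * (psi A - psi A') by ring.
apply: le_trans (ler_normD _ _) _; rewrite !normrM mulrDl addrC.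
apply: lerD; last by rewrite mulrC -mulrA ler_pM.
by rewrite [C * C']mulrC -mulrA mulrCA ler_pM.
Qed.

Lemma lip_sum (I : finType) (F : I -> 'M[R]_d -> R) :
  (forall i, lip_on (F i)) -> lip_on (fun A => \sum_i F i A).
Proof.
move=> H; rewrite /index_enum; elim: (Finite.enum _) => [|i s IH].
  have [C C0 HC] := lip_cst 0; exists C => // A A' HA HA'.
  by rewrite !big_nil; exact: HC.
have [C C0 HC] := lip_add (H i) IH; exists C => // A A' HA HA'.
by rewrite !big_cons; exact: HC.
Qed.

End LocallyLipschitz.

Section BulkPotential.
Variables (R : realType) (d : nat) (m : model R).
Implicit Types A u v w : 'M[R]_d.

Lemma lip_trAA B : 0 <= B -> lip_on B (fun A => \tr (A *m A)).
Proof.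
move=> B0; apply: lip_sum => i.
have [C C0 HC] : lip_on B (fun A : 'M[R]_d => \sum_k A i k * A k i).
  by apply: lip_sum => k; apply: lip_mul; exact: lip_entry.
by exists C => // A A' HA HA'; rewrite !mxE; exact: HC.
Qed.

Lemma lip_F_bulk B : 0 <= B -> lip_on B (@F_bulk R m d).
Proof.
move=> B0.
have lip3 : lip_on B (fun A : 'M[R]_d => \tr (A *m A *m A)).
  have [C C0 HC] : lip_on B (fun A : 'M[R]_d =>
    \sum_i \sum_k (\sum_l A i l * A l k) * A k i).
    apply: lip_sum => i; apply: lip_sum => k; apply: lip_mul; last exact: lip_entry.
    by apply: lip_sum => l; apply: lip_mul; exact: lip_entry.
  have E A : \tr (A *m A *m A) = \sum_i \sum_k (\sum_l A i l * A l k) * A k i.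
    by apply: eq_bigr => i _; rewrite mxE; apply: eq_bigr => k _; rewrite mxE.
  by exists C => // A A' HA HA'; rewrite !E; exact: HC.
have [C C0 HC] : lip_on B (fun A : 'M[R]_d => ca m / 2 * \tr (A *m A) +
    - (cb m / 3) * \tr (A *m A *m A) +
    cc m / 4 * (\tr (A *m A) * \tr (A *m A))).
  by do 2?[apply: lip_add]; apply: lip_mul; try exact: lip_cst;
    try exact: lip_trAA; try exact: lip3; apply: lip_mul; exact: lip_trAA.
exists C => // A A' HA HA'; have := HC _ _ HA HA'.
by rewrite /F_bulk !mulNr -!expr2.
Qed.

Lemma f_bulkE A i j : f_bulk m A i j =
  - ca m * A i j + cb m * ((A *m A) i j + - d%:R^-1 * \tr (A *m A) * (i == j)%:R)
  + - cc m * \tr (A *m A) * A i j.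
Proof. by rewrite /f_bulk !mxE; case: (i == j); rewrite ?mulr1n ?mulr0n; ring. Qed.

Lemma lip_f_bulk B : 0 <= B -> forall i j, lip_on B (fun A => f_bulk m A i j).
Proof.
move=> B0 i j.
have [C C0 HC] : lip_on B (fun A : 'M[R]_d =>
  - ca m * A i j + cb m * (\sum_k A i k * A k j + - d%:R^-1 * \tr (A *m A) * (i == j)%:R)
  + - cc m * \tr (A *m A) * A i j).
  apply: lip_add; first apply: lip_add.
  - by apply: lip_mul; [exact: lip_cst|exact: lip_entry].
  - apply: lip_mul; [exact: lip_cst|apply: lip_add].
      by apply: lip_sum => k; apply: lip_mul; exact: lip_entry.
    by apply: lip_mul; [apply: lip_mul; [exact: lip_cst|exact: lip_trAA]|exact: lip_cst].
  - by apply: lip_mul; [apply: lip_mul; [exact: lip_cst|exact: lip_trAA]|exact: lip_entry].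
exists C => // A A' HA HA'; have := HC _ _ HA HA'.
by rewrite !f_bulkE ![(_ *m _) i j]mxE.
Qed.

Lemma f_bulk_lip B : 0 <= B -> exists2 C, 0 <= C & forall A A',
  frob A <= B -> frob A' <= B ->
  frob (f_bulk m A) <= C /\ frob (f_bulk m A - f_bulk m A') <= C * frob (A - A').
Proof.
move=> B0.
have /choice[C HC] : forall ij : 'I_d * 'I_d, exists C, 0 <= C /\ forall A A',
   frob A <= B -> frob A' <= B -> `|f_bulk m A ij.1 ij.2| <= C /\
   `|f_bulk m A ij.1 ij.2 - f_bulk m A' ij.1 ij.2| <= C * frob (A - A').
  by move=> [i j]; have [C C0 HC] := lip_f_bulk B0 i j; exists C.
have CS i j : C (i, j) <= \sum_ij C ij.
  rewrite (bigD1 (i, j))//= lerDl; apply: sumr_ge0 => ij _.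
  exact: (HC ij).1.
exists (d%:R * \sum_ij C ij).
  by rewrite mulr_ge0// sumr_ge0// => ij _; exact: (HC ij).1.
move=> A A' HA HA'; split.
  apply: frob_le_entries => i j; apply: le_trans (CS i j).
  exact: ((HC (i, j)).2 _ _ HA HA').1.
rewrite -mulrA; apply: frob_le_entries => i j.
have -> : (f_bulk m A - f_bulk m A') i j = f_bulk m A i j - f_bulk m A' i j.
  by rewrite !mxE.
apply: le_trans ((HC (i, j)).2 _ _ HA HA').2 _.
by rewrite ler_wpM2r ?frob_ge0.
Qed.

Lemma F_bulk0 : F_bulk m (0 : 'M[R]_d) = 0.
Proof. by rewrite /F_bulk !mulmx0 mxtrace0 !mulr0 subr0 expr0n/= mulr0 addr0. Qed.

(** With d2F and d3F, the homogeneous terms of degree 1, 2 and 3 of the expansion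
    of the quartic potential around A. *)
Definition dF A w := ca m * \tr (A *m w) - cb m * \tr (A *m A *m w)
  + cc m * \tr (A *m A) * \tr (A *m w).

Definition d2F A u := ca m / 2 * \tr (u *m u) - cb m * \tr (A *m u *m u)
  + cc m * (\tr (A *m u) ^+ 2 + \tr (A *m A) * \tr (u *m u) / 2).

Definition d3F A u := - (cb m / 3) * \tr (u *m u *m u)
  + cc m * \tr (A *m u) * \tr (u *m u).

(** On trace-free symmetric directions the reaction term is minus the gradient
    of the potential: its trace correction is orthogonal to them. *)
Lemma mdot_f_bulk A w : sym_tracefree w -> mdot (f_bulk m A) w = - dF A w.
Proof.
move=> [ws w0]; rewrite mdot_tr ws /f_bulk !(mulmxDl, mulNmx) -!scalemxAl.
rewrite !(mulmxDl, mulNmx) mul_scalar_mx !mxtraceD !raddfN /= !mxtraceZ.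
by rewrite !mxtraceD raddfN /= !mxtraceZ w0 /dF; ring.
Qed.

Lemma F_bulkD A u : F_bulk m (A + u) = F_bulk m A + dF A u + d2F A u + d3F A u
  + cc m / 4 * \tr (u *m u) ^+ 2.
Proof.
have e2 : \tr ((A + u) *m (A + u)) = \tr (A *m A) + 2 * \tr (A *m u) + \tr (u *m u).
  by rewrite mulmxDl !mulmxDr !mxtraceD (mxtrace_mulC u A); ring.
have e3 : \tr ((A + u) *m (A + u) *m (A + u)) = \tr (A *m A *m A)
  + 3 * \tr (A *m A *m u) + 3 * \tr (A *m u *m u) + \tr (u *m u *m u).
  rewrite !mulmxDl !mulmxDr !mulmxDl !mxtraceD.
  have -> : \tr (A *m u *m A) = \tr (A *m A *m u) by rewrite mxtrace_mulC mulmxA.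
  have -> : \tr (u *m A *m A) = \tr (A *m A *m u) by rewrite -mulmxA mxtrace_mulC.
  have -> : \tr (u *m A *m u) = \tr (A *m u *m u) by rewrite -mulmxA mxtrace_mulC.
  have -> : \tr (u *m u *m A) = \tr (A *m u *m u) by rewrite mxtrace_mulC mulmxA.
  by ring.
by rewrite /F_bulk e2 e3 /dF /d2F /d3F; field.
Qed.

Lemma dFD A u v : dF A (u + v) = dF A u + dF A v.
Proof. by rewrite /dF !mulmxDr !mxtraceD; ring. Qed.

Lemma dFN A u : dF A (- u) = - dF A u.
Proof. by rewrite /dF !mulmxN !raddfN /=; ring. Qed.

(** Second-order terms of a symmetric difference cancel up to the product of
    the sum and the difference of the two increments. *)
Lemma d2F_sub A u v : d2F A u - d2F A v =
  ca m / 2 * \tr ((u - v) *m (u + v))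
  - cb m / 2 * (\tr (A *m (u - v) *m (u + v)) + \tr (A *m (u + v) *m (u - v)))
  + cc m * (\tr (A *m (u - v)) * \tr (A *m (u + v))
            + \tr (A *m A) * \tr ((u - v) *m (u + v)) / 2).
Proof.
rewrite /d2F !(mulmxDr, mulmxDl, mulmxN, mulNmx, mxtraceD) !raddfN /=.
by rewrite (mxtrace_mulC v u); field.
Qed.

(** With u = v the increment across a midpoint is reproduced by the reaction at
    the midpoint up to third order; with v = 0 this is the first-order expansion.
    The term in u - v measures the deviation from the exact midpoint. *)
Lemma F_bulk_increment B : 0 <= B -> exists2 C, 0 <= C & forall A u v,
  sym_tracefree u -> sym_tracefree v ->
  frob A <= B -> frob u <= B -> frob v <= B ->
  `|F_bulk m (A + u) - F_bulk m (A - v) + mdot (f_bulk m A) (u + v)|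
   <= C * (frob (u - v) * frob (u + v) + frob u ^+ 3 + frob v ^+ 3).
Proof.
move=> B0.
set a := `|ca m|; set b := `|cb m|; set c := `|cc m|.
have [a0 b0 c0] : [/\ 0 <= a, 0 <= b & 0 <= c] by rewrite !normr_ge0.
pose C1 := a / 2 + b * B + c * (3 / 2 * B ^+ 2).
pose C2 := b / 3 + c * B + c / 4 * B.
have C10 : 0 <= C1 by rewrite /C1 !addr_ge0 ?mulr_ge0 ?sqr_ge0.
have C20 : 0 <= C2 by rewrite /C2 !addr_ge0 ?mulr_ge0.
exists (C1 + C2); first exact: addr_ge0.
move=> A u v su sv HA Hu Hv.
rewrite mdot_f_bulk; last exact: sym_tracefreeD.
have d3N : d3F A (- v) = - d3F A v.
  by rewrite /d3F !(mulmxN, mulNmx, opprK) !raddfN /=; ring.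
have d2N : d2F A (- v) = d2F A v.
  by rewrite /d2F !(mulmxN, mulNmx, opprK) !raddfN /=; ring.
rewrite !F_bulkD dFN d3N d2N !(mulmxN, mulNmx, opprK) dFD.
have -> : F_bulk m A + dF A u + d2F A u + d3F A u + cc m / 4 * \tr (u *m u) ^+ 2 -
  (F_bulk m A - dF A v + d2F A v - d3F A v + cc m / 4 * \tr (v *m v) ^+ 2) -
  (dF A u + dF A v) = (d2F A u - d2F A v)
  + (d3F A u + cc m / 4 * \tr (u *m u) ^+ 2) + (d3F A v - cc m / 4 * \tr (v *m v) ^+ 2).
  by ring.
have tr3 (X Y Z : 'M[R]_d) : `|\tr (X *m Y *m Z)| <= frob X * frob Y * frob Z.
  apply: le_trans (tr_CS _ _) _.
  by rewrite ler_wpM2r ?frob_ge0// frobM.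
have cubic w s : `|s| = 1 -> frob w <= B ->
    `|d3F A w + s * (cc m / 4 * \tr (w *m w) ^+ 2)| <= C2 * frob w ^+ 3.
  move=> s1 Hw; have w0 := frob_ge0 w; rewrite /d3F.
  have t2 := tr_CS w w; have t3 := tr3 w w w; have tA := tr_CS A w.
  have tA' : `|\tr (A *m w)| <= B * frob w by rewrite (le_trans tA)// ler_wpM2r.
  apply: le_trans (ler_normD _ _) _; rewrite normrM s1 mul1r.
  apply: le_trans (lerD (ler_normD _ _) (lexx _)) _.
  rewrite !normrM normrN normrM -/b -/c !(@gtr0_norm _ _^-1) ?invr_gt0//.
  rewrite /C2 2!mulrDl; apply: lerD; first apply: lerD.
  - by rewrite ler_wpM2l ?mulr_ge0// exprS expr2 mulrA.
  - have -> : c * B * frob w ^+ 3 = c * (B * frob w) * (frob w * frob w) by ring.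
    by rewrite ler_pM ?mulr_ge0// ler_wpM2l.
  - rewrite -[leRHS]mulrA ler_wpM2l ?mulr_ge0//.
    apply: (@le_trans _ _ ((frob w * frob w) ^+ 2)).
      by rewrite expr2 ler_pM.
    have -> : (frob w * frob w) ^+ 2 = frob w * frob w ^+ 3 by ring.
    by rewrite ler_wpM2r// exprn_ge0.
have quad : `|d2F A u - d2F A v| <= C1 * (frob (u - v) * frob (u + v)).
  rewrite d2F_sub; set p := u - v; set q := u + v; set P := _ * frob q.
  have p0 := frob_ge0 p; have q0 := frob_ge0 q.
  have P0 : 0 <= P by rewrite mulr_ge0.
  have A0 := frob_ge0 A.
  have t1 : `|\tr (p *m q)| <= P := tr_CS p q.
  have t2 : `|\tr (A *m p *m q)| <= B * P.
    by rewrite (le_trans (tr3 _ _ _))// /P mulrA !ler_wpM2r.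
  have t3 : `|\tr (A *m q *m p)| <= B * P.
    by rewrite (le_trans (tr3 _ _ _))// /P mulrAC mulrA !ler_wpM2r.
  have t4 : `|\tr (A *m p) * \tr (A *m q)| <= B ^+ 2 * P.
    rewrite normrM.
    have -> : B ^+ 2 * P = (B * frob p) * (B * frob q) by rewrite /P; ring.
    by apply: ler_pM => //; rewrite (le_trans (tr_CS _ _))// ler_wpM2r.
  have t5 : `|\tr (A *m A) * \tr (p *m q)| <= B ^+ 2 * P.
    rewrite normrM ler_pM// (le_trans (tr_CS _ _))// expr2 ler_pM//.
  have n2 : `|2^-1 : R| = 2^-1 by rewrite gtr0_norm ?invr_gt0.
  apply: le_trans (ler_normD _ _) _; rewrite /C1 2!mulrDl.
  apply: lerD; first (apply: le_trans (ler_normB _ _) _; apply: lerD).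
  - by rewrite !normrM n2 ler_wpM2l ?mulr_ge0.
  - rewrite 2!normrM n2 -/b -[leLHS]mulrA -[leRHS]mulrA ler_wpM2l//.
    have := ler_normD (\tr (A *m p *m q)) (\tr (A *m q *m p)); lra.
  - rewrite normrM -/c -[leRHS]mulrA ler_wpM2l//; apply: le_trans (ler_normD _ _) _.
    rewrite [X in _ + X]normrM n2; lra.
set S := _ + frob u ^+ 3 + _.
have n3 (w : 'M[R]_d) : 0 <= frob w ^+ 3 by rewrite exprn_ge0 ?frob_ge0.
have U := cubic u 1 (normr1 _) Hu; rewrite mul1r in U.
have V := cubic v (-1) (normrN1 _) Hv; rewrite mulN1r in V.
apply: le_trans (ler_normD _ _) _.
apply: le_trans (lerD (ler_normD _ _) (lexx _)) _.
apply: (@le_trans _ _ (C1 * S + C2 * S)); last by rewrite -mulrDl.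
have pq0 : 0 <= frob (u - v) * frob (u + v) by rewrite mulr_ge0 ?frob_ge0.
rewrite -addrA; apply: lerD.
  apply: le_trans quad _; rewrite ler_wpM2l// /S -addrA lerDl.
  by rewrite addr_ge0.
apply: le_trans (lerD U V) _; rewrite -mulrDr ler_wpM2l// /S -addrA.
by rewrite lerDr.
Qed.

End BulkPotential.

(** * Pointwise bound on the stabilized reaction *)
Section ReactionBound.
Variables (R : realType) (m : model R).

Lemma is_derive_fbar (x : R) : is_derive x 1 (fbar m)
  (- ca m + cb m / Num.sqrt 6 * (2 * x) - cc m * (3 * x ^+ 2)).
Proof.
rewrite /fbar; apply: is_derive_eq.
by rewrite !scaler1 /GRing.scale /= ; ring.
Qed.

Lemma kappa_ge_fbar' (kappa e x : R) : 0 <= x <= e -> kappa_min m e <= kappa ->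
  `|(fbar m)^`()%classic x| <= kappa.
Proof.
move=> /andP[x0 xe]; rewrite /kappa_min ge_max => /andP[_]; apply: le_trans.
apply: ub_le_sup; last first.
  by exists x => //=; rewrite in_itv /= x0.
exists (`|ca m| + `|cb m / Num.sqrt 6| * (2 * e) + `|cc m| * (3 * e ^+ 2)).
move=> _ [y /= + <-]; rewrite in_itv /= => /andP[y0 ye].
have e0 := le_trans y0 ye.
have d := is_derive_fbar y; rewrite derive1E (@derive_val _ _ _ _ _ _ _ d).
apply: le_trans (ler_normB _ _) _.
apply: le_trans (lerD (ler_normD _ _) (lexx _)) _.
rewrite normrN !(normrM (cc m)) !(normrM (cb m / _)) !lerD//.
  by rewrite ler_wpM2l// ger0_norm ?mulr_ge0// ler_pM2l.
rewrite ler_wpM2l// ger0_norm ?mulr_ge0 ?sqr_ge0//.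
by rewrite ler_pM2l// ler_sqr ?nnegrE.
Qed.

(** Since kappa dominates the slope of fbar, xi |-> kappa xi + fbar xi is
    nondecreasing on the range allowed by the maximum bound. *)
Lemma kappa_fbar_mono (kappa e x : R) : 0 <= x <= e -> kappa_min m e <= kappa ->
  kappa * x + fbar m x <= kappa * e + fbar m e.
Proof.
move=> /andP[x0 xe] He.
have [| |c] := @MVT_segment R (fbar m) (fbar m)^`()%classic x e xe.
- move=> y _; have d := is_derive_fbar y.
  by apply: DeriveDef; [exact: ex_derive|rewrite derive1E].
- apply: derivable_within_continuous => y _; have d := is_derive_fbar y.
  exact: ex_derive.
rewrite in_itv /= => /andP[xc ce] E.
have := kappa_ge_fbar' (introT andP (conj (le_trans x0 xc) ce)) He.
rewrite ler_norml => /andP[h _].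
have : - kappa * (e - x) <= fbar m e - fbar m x by rewrite E ler_wpM2r ?subr_ge0.
lra.
Qed.

Lemma kappa_min_ge0 (kappa e : R) : 0 <= e -> kappa_min m e <= kappa -> 0 <= kappa.
Proof.
move=> e0 He; have z : 0 <= (0 : R) <= e by rewrite lexx.
exact: le_trans (normr_ge0 _) (kappa_ge_fbar' z He).
Qed.

Lemma eta_bound_ge d N0 : N0 <= eta_bound m d N0.
Proof.
rewrite /eta_bound /eta2 /eta3; case: ifP => _; first by rewrite le_max lexx.
by case: ifP => // _; rewrite le_max lexx.
Qed.

(** The maximum bound is at or beyond the largest zero of fbar, a cubic with
    negative leading coefficient. *)
Lemma fbar_eta_le0 d N0 : 0 <= N0 -> 0 <= cb m -> 0 < cc m -> admissible_case m d ->
  fbar m (eta_bound m d N0) <= 0.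
Proof.
move=> N00 b0 c0 Hd; have e0 := le_trans N00 (eta_bound_ge d N0).
set e := eta_bound m d N0 in e0 *.
suff H : 0 <= ca m - cb m / Num.sqrt 6 * e + cc m * e ^+ 2.
  have -> : fbar m e = - (e * (ca m - cb m / Num.sqrt 6 * e + cc m * e ^+ 2)).
    by rewrite /fbar; ring.
  by rewrite oppr_le0 mulr_ge0.
have s60 : 0 < Num.sqrt 6 :> R by rewrite sqrtr_gt0.
have s6 : Num.sqrt 6 ^+ 2 = 6 :> R by rewrite sqr_sqrtr.
case: Hd => -[dE bE].
  rewrite bE mul0r mul0r subr0.
  have : Num.sqrt (Num.max 0 (- ca m) / cc m) <= e.
    by rewrite /e dE /eta_bound eqxx /eta2 le_max lexx orbT.
  have h0 : 0 <= Num.max 0 (- ca m) / cc m by rewrite divr_ge0 ?le_max ?lexx// ltW.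
  rewrite -ler_sqr ?nnegrE ?sqrtr_ge0// sqr_sqrtr// ler_pdivrMr//.
  rewrite ge_max => /andP[_]; rewrite mulrC; lra.
pose D := cb m ^+ 2 - 24 * ca m * cc m.
(* Completing the square: 4 c q(e) = (2 c e - b/sqrt 6)^2 - D/6. *)
pose y := 2 * cc m * e - cb m / Num.sqrt 6.
have b6 : (cb m / Num.sqrt 6) ^+ 2 = cb m ^+ 2 / 6 by rewrite exprMn exprVn s6.
rewrite -(pmulr_rge0 _ (_ : 0 < 4 * cc m)) ?mulr_gt0//.
have -> : 4 * cc m * (ca m - cb m / Num.sqrt 6 * e + cc m * e ^+ 2) = y ^+ 2 - D / 6.
  have -> : y ^+ 2 = 4 * cc m ^+ 2 * e ^+ 2 - 4 * cc m * e * (cb m / Num.sqrt 6)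
     + (cb m / Num.sqrt 6) ^+ 2 by rewrite /y; ring.
  by rewrite b6 /D; field.
case: (lerP (ca m) (cb m ^+ 2 / (24 * cc m))) => [h|h]; last first.
  have : D < 0.
    move: h; rewrite ltr_pdivrMr ?mulr_gt0// /D; lra.
  have := sqr_ge0 y; lra.
have D0 : 0 <= D by move: h; rewrite ler_pdivlMr ?mulr_gt0// /D; lra.
have : (cb m + Num.sqrt D) / (2 * Num.sqrt 6 * cc m) <= e.
  rewrite /e /eta_bound dE /= /eta3 h le_max ger0_norm//.
  by apply/orP; right.
rewrite ler_pdivrMr ?mulr_gt0// => h1.
have h2 : Num.sqrt D <= y * Num.sqrt 6.
  rewrite /y mulrBl divfK ?gt_eqF//; lra.
rewrite subr_ge0 ler_pdivrMr// -s6 -exprMn -(sqr_sqrtr D0).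
by rewrite ler_sqr ?nnegrE ?sqrtr_ge0// (le_trans (sqrtr_ge0 D)).
Qed.

(** By Cayley-Hamilton, the trace-free part of the square of a trace-free
    symmetric 3x3 matrix A has norm |A|^2 / sqrt 6: the extremal constant of the
    quadratic term, which is why fbar controls the whole reaction. *)
Lemma frob_dev_sqr (A : 'M[R]_3) : sym_tracefree A ->
  frob (A *m A - (3%:R^-1 * \tr (A *m A))%:M) = frob A ^+ 2 / Num.sqrt 6.
Proof.
move=> [As A0].
have sE i j : A j i = A i j by rewrite -{1}As mxE.
pose i0 : 'I_3 := ord0; pose i1 : 'I_3 := lift ord0 ord0.
pose i2 : 'I_3 := lift ord0 (lift ord0 ord0).
have tE : A i2 i2 = - A i0 i0 - A i1 i1.
  move: A0; rewrite /mxtrace !big_ord_recl big_ord0 -/i0 -/i1 -/i2 => A0.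
  by have := A0; lra.
have dE : mdot A A = 2 * (A i0 i0 ^+ 2 + A i1 i1 ^+ 2 + A i0 i0 * A i1 i1
     + A i0 i1 ^+ 2 + A i0 i2 ^+ 2 + A i1 i2 ^+ 2).
  rewrite /mdot !big_ord_recl !big_ord0 -/i0 -/i1 -/i2.
  by rewrite (sE i0 i1) (sE i0 i2) (sE i1 i2) tE; ring.
have trE : \tr (A *m A) = mdot A A by rewrite mdot_tr As.
apply/eqP; rewrite -(@eqrXn2 _ 2)// ?frob_ge0 ?divr_ge0 ?sqr_ge0 ?sqrtr_ge0//.
apply/eqP; rewrite !frob_sqr exprMn exprVn sqr_sqrtr// trE.
set t := 3%:R^-1 * _.
rewrite [in RHS]dE.
rewrite /mdot !big_ord_recl !big_ord0 -/i0 -/i1 -/i2 !mxE.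
rewrite !big_ord_recl !big_ord0 -/i0 -/i1 -/i2 /=.
rewrite (sE i0 i1) (sE i0 i2) (sE i1 i2) tE !mulr1n !mulr0n /t dE; by field.
Qed.

(** In terms of x = |A|, the first lower bound on kappa makes the coefficient of
    A nonnegative, so the norm is at most kappa x + fbar x; by monotonicity this
    is largest at the maximum bound, where fbar is nonpositive. *)
Lemma f_bulk_maxbound d kappa N0 (A : 'M[R]_d) : 0 <= N0 -> 0 <= cb m -> 0 < cc m ->
  admissible_case m d -> kappa_min m (eta_bound m d N0) <= kappa ->
  sym_tracefree A -> frob A <= eta_bound m d N0 ->
  frob (f_bulk m A + kappa *: A) <= kappa * eta_bound m d N0.
Proof.
move=> N00 b0 c0 Hd Hk sA HA.
have f0 := fbar_eta_le0 N00 b0 c0 Hd.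
have e0 := le_trans N00 (eta_bound_ge d N0).
set e := eta_bound m d N0 in Hk HA f0 e0 *; set x := frob A in HA *.
have x0 : 0 <= x := frob_ge0 A.
apply: (@le_trans _ _ (kappa * x + fbar m x)); last first.
  apply: le_trans (kappa_fbar_mono _ Hk) _; first by rewrite x0.
  by rewrite gerDl.
have trE : \tr (A *m A) = x ^+ 2 by rewrite /x frob_sqr mdot_tr sA.1.
have k1 : 0 <= kappa - ca m - cc m * x ^+ 2.
  move: Hk; rewrite /kappa_min ge_max => /andP[h _].
  have : x ^+ 2 <= e ^+ 2 by rewrite ler_sqr ?nnegrE.
  rewrite -(ler_pM2l c0); lra.
have -> : f_bulk m A + kappa *: A = (kappa - ca m - cc m * x ^+ 2) *: A
   + cb m *: (A *m A - (d%:R^-1 * \tr (A *m A))%:M).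
  rewrite /f_bulk trE; set X := A *m A - _.
  by apply/matrixP => i j; rewrite !mxE; ring.
apply: le_trans (frobD _ _) _; rewrite !frobZ ger0_norm// -/x.
case: Hd => -[dE hE].
  by rewrite hE normr0 mul0r addr0 /fbar hE; lra.
suff -> : frob (A *m A - (d%:R^-1 * \tr (A *m A))%:M) = x ^+ 2 / Num.sqrt 6.
  by rewrite ger0_norm// /fbar; lra.
by rewrite /x; move: A sA {HA trE k1} @x x0; rewrite dE => A sA _ _; exact: frob_dev_sqr.
Qed.

End ReactionBound.

(** * Grid tensors and the discrete Laplacian *)
Section Grid.
Variables (R : realType) (d : nat) (len : R) (M : nat).
Hypotheses (len_gt0 : 0 < len) (M_gt0 : (0 < M)%N).
Implicit Types (X Y Z : gtensor R d M) (U V : grid_node d M -> R) (k : grid_node d M).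

Local Notation h := (mesh_h len M).
Local Notation tip := (tip_h len).
Local Notation nrm := (norm_h len).

Lemma mesh_h_gt0 : 0 < h.
Proof. by rewrite divr_gt0// ltr0n. Qed.
Let h_gt0 := mesh_h_gt0.
Let hd_ge0 : 0 <= h ^+ d. Proof. by rewrite exprn_ge0// ltW. Qed.

Lemma tipE X Y : tip X Y = h ^+ d * \sum_k mdot (X k) (Y k).
Proof.
rewrite mulr_sumr /tip_h.
transitivity (\sum_i \sum_j \sum_k h ^+ d * (X k i j * Y k i j)).
  apply: eq_bigr => i _; apply: eq_bigr => j _.
  by rewrite /ip_h mulr_sumr.
rewrite [RHS](eq_bigr (fun k => \sum_i \sum_j h ^+ d * (X k i j * Y k i j))).
  rewrite [RHS]exchange_big /=; apply: eq_bigr => i _; exact: exchange_big.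
move=> k _; rewrite /mdot mulr_sumr; apply: eq_bigr => i _; exact: mulr_sumr.
Qed.

Lemma tipDl X Y Z : tip (X + Y) Z = tip X Z + tip Y Z.
Proof.
rewrite !tipE -mulrDr -big_split; congr (_ * _); apply: eq_bigr => k _.
exact: mdotDl.
Qed.

Lemma tipZl a X Y : tip (a *: X) Y = a * tip X Y.
Proof.
rewrite !tipE mulrCA [a * _]mulr_sumr; congr (_ * _); apply: eq_bigr => k _.
exact: mdotZl.
Qed.

Lemma tipC X Y : tip X Y = tip Y X.
Proof. by rewrite !tipE; congr (_ * _); apply: eq_bigr => k _; rewrite mdotC. Qed.

Lemma tip_ge0 X : 0 <= tip X X.
Proof. by rewrite tipE mulr_ge0// sumr_ge0// => k _; exact: mdot_ge0. Qed.

Lemma tipNl X Y : tip (- X) Y = - tip X Y.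
Proof. by rewrite -scaleN1r tipZl mulN1r. Qed.

Lemma tipBl X Y Z : tip (X - Y) Z = tip X Z - tip Y Z.
Proof. by rewrite tipDl tipNl. Qed.

Lemma tipDr X Y Z : tip Z (X + Y) = tip Z X + tip Z Y.
Proof. by rewrite tipC tipDl ![tip _ Z]tipC. Qed.

Lemma tipBr X Y Z : tip Z (X - Y) = tip Z X - tip Z Y.
Proof. by rewrite tipC tipBl ![tip _ Z]tipC. Qed.

Lemma nrm_sqr X : nrm X ^+ 2 = tip X X.
Proof. by rewrite /norm_h sqr_sqrtr ?tip_ge0. Qed.

Lemma nrm_ge0 X : 0 <= nrm X. Proof. exact: sqrtr_ge0. Qed.

Lemma tip_CS X Y : `|tip X Y| <= nrm X * nrm Y.
Proof. exact: (sip_CS tipDl tipZl tipC tip_ge0). Qed.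

Lemma tip_le X Y : tip X Y <= nrm X * nrm Y.
Proof. exact: le_trans (ler_norm _) (tip_CS X Y). Qed.

Lemma nrmD X Y : nrm (X + Y) <= nrm X + nrm Y.
Proof. exact: (sip_nrmD tipDl tipZl tipC tip_ge0). Qed.

Lemma nrmZ a X : nrm (a *: X) = `|a| * nrm X.
Proof. exact: (sip_nrmZ tipZl tipC). Qed.

Lemma nrmN X : nrm (- X) = nrm X.
Proof. by rewrite -scaleN1r nrmZ normrN1 mul1r. Qed.

Lemma nrmB X Y : nrm (X - Y) <= nrm X + nrm Y.
Proof. by rewrite -(nrmN Y); exact: nrmD. Qed.

Lemma nrm_le_pointwise C X Y : 0 <= C ->
  (forall k, frob (X k) <= C * frob (Y k)) -> nrm X <= C * nrm Y.
Proof.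
move=> C0 H; rewrite -ler_sqr ?nnegrE ?mulr_ge0 ?nrm_ge0// exprMn !nrm_sqr.
rewrite !tipE mulrCA ler_wpM2l// mulr_sumr; apply: ler_sum => k _.
rewrite -!frob_sqr -exprMn ler_sqr ?nnegrE ?frob_ge0 ?mulr_ge0 ?frob_ge0//.
Qed.

(** The (M + 1)^d nodes, each of mass h^d, have total mass above the volume of
    the box; (2 len)^d bounds it for every mesh. *)
Definition vol_root := Num.sqrt ((2 * len) ^+ d).

Lemma vol_root_ge0 : 0 <= vol_root. Proof. exact: sqrtr_ge0. Qed.

Lemma grid_mass : h ^+ d * #|{: grid_node d M}|%:R <= vol_root ^+ 2.
Proof.
rewrite card_ffun !card_ord sqr_sqrtr ?exprn_ge0 ?mulr_ge0 ?(ltW len_gt0) ?(ltW h_gt0)//.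
rewrite natrX -exprMn lerXn2r ?nnegrE ?mulr_ge0 ?(ltW len_gt0) ?(ltW h_gt0)//.
rewrite /mesh_h mulrAC ler_pdivrMr ?ltr0n// [2 * _]mulrC -mulrA ler_pM2l//.
by rewrite -natrM ler_nat mul2n -addnn -addn1 leq_add2l.
Qed.

Lemma nrm_le_sup K X : 0 <= K -> (forall k, frob (X k) <= K) -> nrm X <= vol_root * K.
Proof.
move=> K0 H; rewrite -ler_sqr ?nnegrE ?mulr_ge0 ?nrm_ge0 ?vol_root_ge0//.
rewrite exprMn nrm_sqr tipE; apply: le_trans (ler_wpM2r (sqr_ge0 K) grid_mass).
rewrite -mulrA ler_wpM2l// mulr_natl -sumr_const.
by apply: ler_sum => k _; rewrite -frob_sqr ler_sqr ?nnegrE ?frob_ge0.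
Qed.

Lemma l1_le_nrm X : h ^+ d * \sum_k frob (X k) <= vol_root * nrm X.
Proof.
pose b (x y : grid_node d M -> R^o) : R := \sum_k x k * y k.
have bD x y z : b (x + y) z = b x z + b y z.
  by rewrite /b -big_split; apply: eq_bigr => k _; exact: mulrDl.
have bZ a x y : b (a *: x) y = a * b x y.
  by rewrite /b mulr_sumr; apply: eq_bigr => k _; rewrite mulrA.
have bC x y : b x y = b y x by apply: eq_bigr => k _; exact: mulrC.
have b0 x : 0 <= b x x by apply: sumr_ge0 => k _; rewrite -expr2 sqr_ge0.
have := le_trans (ler_norm _) (sip_CS bD bZ bC b0 (fun=> 1) (fun k => frob (X k))).
set S := b _ _; set T := Num.sqrt _ => ST.
have SE : S = \sum_k frob (X k) by apply: eq_bigr => k _; rewrite mul1r.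
have S0 : 0 <= S by rewrite SE sumr_ge0// => k _; exact: frob_ge0.
rewrite -SE -ler_sqr ?nnegrE ?mulr_ge0 ?nrm_ge0 ?vol_root_ge0//.
have : S ^+ 2 <= #|{: grid_node d M}|%:R * \sum_k mdot (X k) (X k).
  apply: (@le_trans _ _ ((T * Num.sqrt (b (fun k => frob (X k)) (fun k => frob (X k)))) ^+ 2)).
    by rewrite ler_sqr ?nnegrE// mulr_ge0 ?sqrtr_ge0.
  rewrite exprMn /T !sqr_sqrtr ?b0//.
  have -> : b (fun=> 1) (fun=> 1) = #|{: grid_node d M}|%:R.
    by rewrite /b -sumr_const; apply: eq_bigr => k _; rewrite mulr1.
  apply: ler_wpM2l => //; apply: ler_sum => k _.
  by rewrite -frob_sqr.
move=> H; rewrite (exprMn _ _ S) (exprMn _ vol_root) nrm_sqr tipE.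
apply: (@le_trans _ _ ((h ^+ d) ^+ 2 * (#|{: grid_node d M}|%:R * \sum_k mdot (X k) (X k)))).
  by rewrite ler_wpM2l ?sqr_ge0.
have -> : (h ^+ d) ^+ 2 * (#|{: grid_node d M}|%:R * \sum_k mdot (X k) (X k)) =
  h ^+ d * #|{: grid_node d M}|%:R * (h ^+ d * \sum_k mdot (X k) (X k)) by ring.
rewrite ler_wpM2r ?grid_mass// mulr_ge0// sumr_ge0// => k _; exact: mdot_ge0.
Qed.

(** ** Summation by parts and the discrete maximum principle *)

Definition zero_bdry X := forall k, ~~ interior_node k -> X k = 0.

Definition tlap X : gtensor R d M :=
  fun k => \matrix_(i, j) lap_h len (entry_h X i j) k.

Lemma tlapE X k : tlap X k = if interior_node k then
  h ^- 2 *: \sum_i (X (node_up k i) - 2 *: X k + X (node_down k i)) else 0.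
Proof.
apply/matrixP => i j; rewrite mxE /lap_h; case: ifP => _; last by rewrite mxE.
rewrite mxE mulrC; congr (_ * _); rewrite summxE; apply: eq_bigr => l _.
by rewrite !mxE.
Qed.

Lemma tlapD X Y : tlap (X + Y) = tlap X + tlap Y.
Proof.
apply/funext => k; transitivity (tlap X k + tlap Y k) => //; rewrite !tlapE.
case: (interior_node k); last by rewrite addr0.
rewrite -scalerDr -big_split; congr (_ *: _); apply: eq_bigr => i _.
by rewrite !fctE scalerDr; apply/matrixP => a b; rewrite !mxE; ring.
Qed.

Lemma tlapZ a X : tlap (a *: X) = a *: tlap X.
Proof.
apply/funext => k; transitivity (a *: tlap X k) => //; rewrite !tlapE.
case: (interior_node k); last by rewrite scaler0.
rewrite [RHS]scalerA [a * _]mulrC -[RHS]scalerA; congr (_ *: _); rewrite [RHS]scaler_sumr.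
apply: eq_bigr => i _.
by rewrite !fctE; apply/matrixP => u v; rewrite !mxE; ring.
Qed.

Lemma tlapN X : tlap (- X) = - tlap X.
Proof. by rewrite -scaleN1r tlapZ scaleN1r. Qed.

Lemma tlapB X Y : tlap (X - Y) = tlap X - tlap Y.
Proof. by rewrite tlapD tlapN. Qed.

Lemma sqgradE X : sqgrad_h len X = - tip (tlap X) X.
Proof.
rewrite /sqgrad_h /tip_h; congr (- _); apply: eq_bigr => i _; apply: eq_bigr => j _.
by congr (ip_h _ _ _); apply/funext => k; rewrite /entry_h mxE.
Qed.

(** The scheme holds at interior nodes only; pairing with a tensor that vanishes
    on the boundary loses nothing. *)
Lemma tip_interior X X' Y : zero_bdry Y -> (forall k, interior_node k -> X k = X' k) ->
  tip X Y = tip X' Y.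
Proof.
move=> Y0 XX'; rewrite !tipE; congr (_ * _); apply: eq_bigr => k _.
case: (boolP (interior_node k)) => [/XX' -> //|/Y0 ->].
by rewrite -(scale0r 0) !mdotZr !mul0r.
Qed.

Lemma node_up_lt k i : (k i < M)%N -> node_up k i i = (k i).+1 :> nat.
Proof. by move=> kM; rewrite ffunE eqxx inordK. Qed.

Lemma node_downE k i : node_down k i i = (k i).-1 :> nat.
Proof. by rewrite ffunE eqxx inordK// (leq_ltn_trans (leq_pred _))// ltn_ord. Qed.

Lemma node_upK k i : (k i < M)%N -> node_down (node_up k i) i = k.
Proof.
move=> kM; apply/ffunP => j; apply: val_inj; rewrite /= ffunE.
case: eqP => [->|/eqP/negPf ji]; last by rewrite ffunE ji.
by rewrite node_up_lt//= inordK.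
Qed.

Lemma node_downK k i : (0 < k i)%N -> node_up (node_down k i) i = k.
Proof.
move=> k0; apply/ffunP => j; apply: val_inj; rewrite /= ffunE.
case: eqP => [->|/eqP/negPf ji]; last by rewrite ffunE ji.
by rewrite node_downE prednK// inordK.
Qed.

(** Translating by one node in direction i is a bijection between the nodes that
    have an upper neighbour and those that have a lower one. *)
Lemma sum_shift i (G : grid_node d M -> grid_node d M -> R) :
  \sum_(k : grid_node d M | (k i < M)%N) G k (node_up k i)
  = \sum_(k : grid_node d M | (0 < k i)%N) G (node_down k i) k.
Proof.
rewrite (reindex_onto (fun k => node_down k i) (fun k => node_up k i))/=; last first.
  by move=> k kM; rewrite node_upK.
have E (k : grid_node d M) :
    ((node_down k i i < M)%N && (node_up (node_down k i) i == k)) = (0 < k i)%N.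
  rewrite node_downE; have [k0|k0] := posnP (k i).
    apply/negbTE; rewrite negb_and; apply/orP; right.
    apply/eqP => /(congr1 (fun g : grid_node d M => nat_of_ord (g i))).
    by rewrite node_up_lt ?node_downE k0.
  rewrite node_downK// eqxx andbT.
  by rewrite -ltnS prednK// ltn_ord.
by rewrite (eq_bigl _ _ E); apply: eq_bigr => k k0; rewrite node_downK.
Qed.

Let vanish U := forall k, ~~ interior_node k -> U k = 0.

Lemma interior_lt k i : interior_node k -> (0 < k i < M)%N.
Proof. by move=> /forallP/(_ i). Qed.

Lemma sum_interior (P : pred (grid_node d M)) (F : grid_node d M -> R) :
  (forall k, interior_node k -> P k) ->
  (forall k, P k -> ~~ interior_node k -> F k = 0) ->
  \sum_(k | P k) F k = \sum_(k | interior_node k) F k.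
Proof.
move=> PI F0; rewrite (bigID (@interior_node d M))/= [X in _ + X]big1 ?addr0.
  by apply: eq_bigl => k; case: (boolP (interior_node k)) => [/PI ->|_]; rewrite ?andbF.
by move=> k /andP[]; exact: F0.
Qed.

Lemma sum_shift_interior i U V : vanish U -> vanish V ->
  \sum_(k | interior_node k) U (node_down k i) * V k
  = \sum_(k | interior_node k) U k * V (node_up k i).
Proof.
move=> U0 V0.
rewrite -(sum_interior (P := fun k => 0 < k i)%N); last 2 first.
- by move=> k /(interior_lt i)/andP[].
- by move=> k _ /V0 ->; rewrite mulr0.
rewrite -(sum_shift i (fun k k' => U k * V k')) (sum_interior (P := fun k => k i < M)%N)//.
- by move=> k /(interior_lt i)/andP[].
- by move=> k _ /U0 ->; rewrite mul0r.
Qed.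

(** Both one-sided shifts are written with the upper neighbour, which makes the
    symmetry of the pairing visible. *)
Lemma lap_pairing U V : vanish U -> vanish V -> \sum_k lap_h len U k * V k =
  (\sum_i (\sum_(k | interior_node k) U k * V (node_up k i)
   + \sum_(k | interior_node k) V k * U (node_up k i)
   - 2 * \sum_(k | interior_node k) U k * V k)) / h ^+ 2.
Proof.
move=> U0 V0; rewrite (sum_interior (P := xpredT))//; last first.
  by move=> k _ /negPf ki; rewrite /lap_h ki mul0r.
rewrite mulr_suml.
under eq_bigr => k ki do rewrite /lap_h ki mulrAC mulr_suml mulr_suml.
rewrite exchange_big /=; apply: eq_bigr => i _.
rewrite -mulr_suml; congr (_ / _).
rewrite -(sum_shift_interior i U0 V0) mulr_sumr -big_split -sumrB /=.
by apply: eq_bigr => k _; ring.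
Qed.

Lemma lap_sym U V : vanish U -> vanish V ->
  \sum_k lap_h len U k * V k = \sum_k lap_h len V k * U k.
Proof.
move=> U0 V0; rewrite !lap_pairing//; congr (_ / _); apply: eq_bigr => i _.
congr (_ - _ * _); first exact: addrC.
by apply: eq_bigr => k _; rewrite mulrC.
Qed.

Lemma lap_le0 U : vanish U -> \sum_k lap_h len U k * U k <= 0.
Proof.
move=> U0; rewrite lap_pairing// pmulr_lle0 ?invr_gt0 ?exprn_gt0//.
rewrite -oppr_ge0 -sumrN; apply: sumr_ge0 => i _.
rewrite oppr_ge0 subr_le0 -mulr2n -[_ *+ 2]mulr_natl ler_pM2l//.
have up2 : \sum_(k | interior_node k) U (node_up k i) ^+ 2
    <= \sum_(k | interior_node k) U k ^+ 2.
  apply: (@le_trans _ _ (\sum_(k : grid_node d M | (k i < M)%N) U (node_up k i) ^+ 2)).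
    rewrite [leRHS](bigID (@interior_node d M))/=.
    rewrite (eq_bigl (fun k : grid_node d M => interior_node k)); last first.
      by move=> k; case: (boolP (interior_node k)) => [/(interior_lt i)/andP[_ ->]|];
        rewrite ?andbF.
    by rewrite lerDl sumr_ge0// => k _; exact: sqr_ge0.
  rewrite (sum_shift i (fun _ k => U k ^+ 2)) (sum_interior (P := fun k => 0 < k i)%N)//.
    by move=> k /(interior_lt i)/andP[].
  by move=> k _ /U0 ->; rewrite expr0n.
have : \sum_(k | interior_node k) U k * U (node_up k i) <=
   \sum_(k | interior_node k) (U k ^+ 2 / 2 + U (node_up k i) ^+ 2 / 2).
  apply: ler_sum => k _; have := sqr_ge0 (U k - U (node_up k i)); rewrite sqrrB mulr2n; lra.
rewrite big_split -!mulr_suml /=.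
under [X in _ -> _ <= X]eq_bigr do rewrite -expr2.
by lra.
Qed.

Lemma vanish_entry X i j : zero_bdry X -> vanish (entry_h X i j).
Proof. by move=> X0 k /X0; rewrite /entry_h => ->; rewrite mxE. Qed.

Lemma tip_tlapE X Y : tip (tlap X) Y =
  h ^+ d * \sum_i \sum_j \sum_k lap_h len (entry_h X i j) k * entry_h Y i j k.
Proof.
rewrite /tip_h /ip_h mulr_sumr; apply: eq_bigr => i _; rewrite mulr_sumr.
apply: eq_bigr => j _; congr (_ * _); apply: eq_bigr => k _.
by rewrite {1}/entry_h mxE.
Qed.

Lemma tip_tlap_sym X Y : zero_bdry X -> zero_bdry Y -> tip (tlap X) Y = tip (tlap Y) X.
Proof.
move=> X0 Y0; rewrite !tip_tlapE; congr (_ * _).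
by apply: eq_bigr => i _; apply: eq_bigr => j _; apply: lap_sym; exact: vanish_entry.
Qed.

Lemma sqgrad_ge0 X : zero_bdry X -> 0 <= sqgrad_h len X.
Proof.
move=> X0; rewrite sqgradE oppr_ge0 tip_tlapE mulr_ge0_le0//.
rewrite -oppr_ge0 -sumrN sumr_ge0// => i _; rewrite -sumrN sumr_ge0// => j _.
by rewrite oppr_ge0 lap_le0//; exact: vanish_entry.
Qed.

Lemma zero_bdryB X Y : zero_bdry X -> zero_bdry Y -> zero_bdry (X - Y).
Proof. by move=> X0 Y0 k kb; rewrite !fctE X0// Y0// subr0. Qed.

(** Polarization: an implicit Laplacian tested with the increment. *)
Lemma tip_tlap_increment X Y : zero_bdry X -> zero_bdry Y ->
  tip (tlap X) (X - Y) =
  - (sqgrad_h len X - sqgrad_h len Y + sqgrad_h len (X - Y)) / 2.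
Proof.
move=> X0 Y0; rewrite !sqgradE tlapB !(tipBl, tipBr) (tip_tlap_sym Y0 X0); by field.
Qed.

(** For the mean of the two states the test with the increment is an exact
    difference of gradient energies. *)
Lemma tip_tlap_sum_increment X Y : zero_bdry X -> zero_bdry Y ->
  tip (tlap (X + Y)) (X - Y) = - (sqgrad_h len X - sqgrad_h len Y).
Proof.
move=> X0 Y0; rewrite !sqgradE tlapD !(tipBr, tipDl) (tip_tlap_sym Y0 X0); ring.
Qed.

Lemma tlap_at_max X k : (forall k', frob (X k') <= frob (X k)) -> interior_node k ->
  mdot (tlap X k) (X k) <= 0.
Proof.
move=> Hk ki; rewrite tlapE ki mdotZl pmulr_rle0 ?invr_gt0 ?exprn_gt0//.
have E : {morph (fun A => mdot A (X k)) : A B / A + B >-> A + B}.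
  by move=> A B; exact: mdotDl.
rewrite (big_morph (fun A => mdot A (X k)) E (id1 := 0)); last first.
  by rewrite -(scale0r 0) mdotZl mul0r.
rewrite -oppr_ge0 -sumrN; apply: sumr_ge0 => i _.
rewrite !(mdotDl, mdotNl, mdotZl) -frob_sqr.
have nb k' : mdot (X k') (X k) <= frob (X k) ^+ 2.
  by rewrite (le_trans (mdot_le _ _))// expr2 ler_wpM2r ?frob_ge0.
have := nb (node_up k i); have := nb (node_down k i); lra.
Qed.

(** Discrete maximum principle: at a node where |X| is largest, the Laplacian
    points inwards. *)
Lemma discrete_max_principle (alpha L eta : R) X Y : 0 < alpha -> 0 <= L -> 0 <= eta ->
  zero_bdry X -> (forall k, interior_node k -> alpha *: X k - L *: tlap X k = Y k) ->
  (forall k, interior_node k -> frob (Y k) <= alpha * eta) ->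
  forall k, frob (X k) <= eta.
Proof.
move=> a0 L0 e0 X0 XY HY k0.
case: (@Order.TotalTheory.arg_maxP _ _ _ k0 xpredT (fun k => frob (X k)) isT) => k _ Hk.
apply: le_trans (Hk k0 isT) _.
have [ki|/X0 ->] := boolP (interior_node k); last by rewrite frob0.
have [/eqP ->//|xp] := boolP (frob (X k) == 0).
have {xp} xp : 0 < frob (X k) by rewrite lt_def xp frob_ge0.
rewrite -(ler_pM2l a0) -(ler_pM2r xp).
have -> : alpha * frob (X k) * frob (X k) = mdot (Y k) (X k) + L * mdot (tlap X k) (X k).
  by rewrite -XY// mdotBl !mdotZl -frob_sqr; ring.
have t0 : L * mdot (tlap X k) (X k) <= 0.
  by rewrite mulr_ge0_le0// tlap_at_max// => k'; exact: Hk.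
have : mdot (Y k) (X k) <= alpha * eta * frob (X k).
  by rewrite (le_trans (mdot_le _ _))// ler_wpM2r ?frob_ge0 ?HY.
lra.
Qed.

(** Under the step restriction the explicit part is a combination of node
    values with nonnegative weights of sum alpha. *)
Lemma explicit_lap_bound (alpha L eta : R) X k : 0 <= L -> 2 * d%:R * L / h ^+ 2 <= alpha ->
  (forall k, frob (X k) <= eta) -> frob (alpha *: X k + L *: tlap X k) <= alpha * eta.
Proof.
move=> L0 Ha HX.
have n0 : 0 <= 2 * d%:R * L / h ^+ 2 by rewrite !mulr_ge0 ?invr_ge0 ?sqr_ge0.
rewrite tlapE; case: ifP => _; last first.
  rewrite scaler0 addr0 frobZ ger0_norm ?ler_wpM2l//; exact: le_trans n0 Ha.
set c := L / h ^+ 2.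
have c0 : 0 <= c by rewrite mulr_ge0// invr_ge0 sqr_ge0.
have -> : alpha *: X k + L *: (h ^- 2 *: \sum_i (X (node_up k i) - 2 *: X k
     + X (node_down k i))) = (alpha - 2 * d%:R * c) *: X k
     + c *: \sum_i (X (node_up k i) + X (node_down k i)).
  rewrite scalerA -/c.
  have -> : \sum_i (X (node_up k i) - 2 *: X k + X (node_down k i)) =
    \sum_i (X (node_up k i) + X (node_down k i)) - (2 * d%:R) *: X k.
    have -> : (2 * d%:R) *: X k = \sum_(i < d) (2 *: X k).
      by rewrite sumr_const card_ord mulrC -scalerA scaler_nat.
    by rewrite -sumrB; apply: eq_bigr => i _; rewrite addrAC.
  by rewrite scalerBr scalerBl scalerA [c * _]mulrC addrA addrAC.
apply: le_trans (frobD _ _) _; rewrite !frobZ.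
rewrite (ger0_norm c0) ger0_norm; last by rewrite subr_ge0 /c mulrA.
have nb : frob (\sum_i (X (node_up k i) + X (node_down k i))) <= (2 * d%:R) * eta.
  apply: le_trans (frob_sum _) _.
  apply: (@le_trans _ _ (\sum_(i < d) 2 * eta)).
    apply: ler_sum => i _; apply: le_trans (frobD _ _) _.
    have := HX (node_up k i); have := HX (node_down k i); lra.
  by rewrite sumr_const card_ord -mulr_natl; lra.
have H1 : (alpha - 2 * d%:R * c) * frob (X k) <= (alpha - 2 * d%:R * c) * eta.
  by rewrite ler_wpM2l ?HX// subr_ge0 /c mulrA.
have H2 := ler_wpM2l c0 nb.
lra.
Qed.

End Grid.

(** * Energy dissipation and maximum bound of the scheme *)
Section SchemeStability.
Variables (R : realType) (d : nat) (m : model R) (len kappa Cstar : R) (M : nat).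
Hypotheses (len_gt0 : 0 < len) (M_gt0 : (0 < M)%N) (L_gt0 : 0 < elL m)
  (kappa_ge0 : 0 <= kappa) (Cstar_ge0 : 0 <= Cstar)
  (F_lower : forall A : 'M[R]_d, sym_tracefree A -> - Cstar <= len ^+ d * F_bulk m A).
Implicit Types (P Q : gtensor R d M) (s sigma theta tau g : R).

Local Notation h := (mesh_h len M).
Local Notation tip := (tip_h len).
Local Notation nrm := (norm_h len).
Local Notation L := (elL m).
Let h_gt0 : 0 < h := mesh_h_gt0 len_gt0 M_gt0.

Lemma in_S_h_zero_bdry Q : in_S_h Q -> zero_bdry Q. Proof. by case. Qed.

Lemma card_interior_le : (#|[set k : grid_node d M | interior_node k]| <= M ^ d)%N.
Proof.
case: M M_gt0 => // M' _.
pose phi (k : grid_node d M'.+1) : {ffun 'I_d -> 'I_M'.+1} := [ffun i => inord (k i)].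
have inj : {in [set k | interior_node k] &, injective phi}.
  move=> k k'; rewrite !inE => /forallP ki /forallP ki' /ffunP E.
  apply/ffunP => i; apply: val_inj => /=; have := congr1 (@nat_of_ord _) (E i).
  by rewrite !ffunE !inordK ?(andP (ki i)).2 ?(andP (ki' i)).2.
rewrite -(card_in_imset inj); apply: leq_trans (max_card _) _.
by rewrite card_ffun !card_ord.
Qed.

(** The potential vanishes at the boundary nodes of Q, and the interior nodes have
    total mass at most len^d: the pointwise lower bound on the potential thus
    survives summation. *)
Lemma E1_h_ge Q : in_S_h Q -> - Cstar <= E1_h m len Q.
Proof.
move=> [sQ Q0]; rewrite /E1_h /ip_h.
have -> : \sum_k F_bulk m (Q k) * 1 = \sum_(k | interior_node k) F_bulk m (Q k).
  rewrite [RHS]big_mkcond; apply: eq_bigr => k _; rewrite mulr1.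
  by case: ifP => // /negbT /Q0 ->; rewrite F_bulk0.
have ld : 0 < len ^+ d by rewrite exprn_gt0.
have lb : - (#|[set k : grid_node d M | interior_node k]|%:R * (Cstar / len ^+ d))
    <= \sum_(k | interior_node k) F_bulk m (Q k).
  apply: (@le_trans _ _ (\sum_(k : grid_node d M | interior_node k) - (Cstar / len ^+ d))).
    by rewrite sumrN sumr_const cardsE mulr_natl.
  apply: ler_sum => k _; rewrite -mulNr ler_pdivrMr// mulrC; exact: F_lower.
have hd : 0 < h ^+ d by rewrite exprn_gt0.
apply: le_trans (ler_wpM2l (ltW hd) lb); rewrite mulrN lerN2.
have -> : h ^+ d * (#|[set k : grid_node d M | interior_node k]|%:R * (Cstar / len ^+ d)) =
  Cstar * (#|[set k : grid_node d M | interior_node k]|%:R / (M%:R ^+ d)).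
  have Md : M%:R ^+ d != 0 :> R by rewrite expf_neq0// pnatr_eq0 -lt0n.
  rewrite /mesh_h exprMn exprVn; move: (M%:R ^+ d) (len ^+ d) Md (lt0r_neq0 ld).
  by move=> X Y X0 Y0; field; rewrite X0 Y0.
rewrite ler_piMr// ler_pdivrMr ?exprn_gt0 ?ltr0n// mul1r -natrX ler_nat.
exact: card_interior_le.
Qed.

Lemma E1_h_lip C P Q : 0 <= C ->
  (forall k, `|F_bulk m (P k) - F_bulk m (Q k)| <= C * frob (P k - Q k)) ->
  `|E1_h m len P - E1_h m len Q| <= C * (vol_root d len * nrm (P - Q)).
Proof.
move=> C0 H; rewrite /E1_h /ip_h -mulrBr -sumrB normrM ger0_norm ?exprn_ge0 ?(ltW h_gt0)//.
apply: le_trans (ler_wpM2l C0 (l1_le_nrm len_gt0 M_gt0 (P - Q))).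
rewrite mulrCA ler_wpM2l ?exprn_ge0 ?(ltW h_gt0)// mulr_sumr.
apply: le_trans (ler_norm_sum _ _ _) _; apply: ler_sum => k _.
by rewrite !mulr1 H.
Qed.

Lemma g_h_gt0 Q s : 0 < g_h m len Q s.
Proof. by rewrite divr_gt0 ?expR_gt0. Qed.

Lemma g_hE Q s : g_h m len Q s = expR (s - E1_h m len Q).
Proof. by rewrite expRB. Qed.

Lemma E_el_ge0 Q : zero_bdry Q -> 0 <= E_el m len Q.
Proof.
by move=> Q0; rewrite /E_el mulr_ge0 ?divr_ge0 ?(ltW L_gt0)// (sqgrad_ge0 len_gt0 M_gt0).
Qed.

(** The total energy controls the exponent s - E1_h of g, because the elastic
    part is nonnegative and E1_h is bounded below. *)
Lemma g_h_le Q s E0 : in_S_h Q -> E_h m len Q s <= E0 ->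
  g_h m len Q s <= expR (E0 + Cstar).
Proof.
move=> SQ HE; rewrite g_hE ler_expR.
have := E_el_ge0 (in_S_h_zero_bdry SQ); have := E1_h_ge SQ.
by move: HE; rewrite /E_h; lra.
Qed.

Lemma sESAV1_eq P sigma theta P' sigma' :
  sESAV1 m len kappa Cstar P sigma theta P' sigma' ->
  forall k, interior_node k -> theta^-1 *: (P' k - P k) = L *: tlap len P' k
   + g_h m len P sigma *: (f_bulk m (P k) - kappa *: (P' k - P k)).
Proof.
move=> [_ H _] k ki; apply/matrixP => i j.
by have := H k ki i j; rewrite /f_h !mxE; lra.
Qed.

Lemma corrector_eq Q s tau Qs ss Q' s' :
  sESAV2_corrector m len kappa Cstar Q s tau Qs ss Q' s' ->
  forall k, interior_node k -> tau^-1 *: (Q' k - Q k) = (L / 2) *: tlap len (Q' + Q) k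
   + g_h m len Qs ss *: (f_bulk m (Qs k) - kappa *: (2^-1 *: (Q' k + Q k) - Qs k)).
Proof.
move=> [_ H _] k ki; apply/matrixP => i j.
have -> : tlap len (Q' + Q) k = tlap len Q' k + tlap len Q k by rewrite tlapD.
move: (H k ki i j); rewrite /f_h; move: (f_bulk m (Qs k)) (g_h _ _ _ _) => fq g.
rewrite !mxE; lra.
Qed.

(** Tested with the increment, the reaction term is cancelled by the change of the
    auxiliary variable and all other terms dissipate energy; the cut-off does
    no more than lift the energy to its lower bound. *)
Lemma sESAV1_energy P sigma theta P' sigma' : 0 < theta -> zero_bdry P ->
  sESAV1 m len kappa Cstar P sigma theta P' sigma' ->
  E_h m len P' sigma' <= Num.max (E_h m len P sigma) (- Cstar).
Proof.
move=> t0 P0 H; have E := sESAV1_eq H; case: H => SP' _ ->.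
have P'0 := in_S_h_zero_bdry SP'.
set g := g_h _ _ _ _ in E *; rewrite /E_h; set D := (fun k => P' k - P k).
have D0 : zero_bdry D by exact: zero_bdryB.
have g0 : 0 < g by exact: g_h_gt0.
have T : theta^-1 * tip D D =
  L * tip (tlap len P') D + g * (tip (f_h m P) D - kappa * tip D D).
  rewrite -!tipZl -tipBl -tipZl -tipDl; exact: tip_interior.
have inc := tip_tlap_increment len M_gt0 P'0 P0.
rewrite -[P' - P]/D in inc; rewrite inc in T.
have D2 : 0 <= tip D D by exact: tip_ge0 len_gt0 M_gt0 D.
have Dg : 0 <= sqgrad_h len D by exact: sqgrad_ge0.
have h1 : E_el m len P' + (sigma - g * tip (f_h m P) D) <= E_el m len P + sigma.
  have h2 : 0 <= theta^-1 * tip D D by rewrite mulr_ge0// invr_ge0 ltW.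
  have h3 : 0 <= g * (kappa * tip D D) by rewrite !mulr_ge0// ltW.
  have h4 : 0 <= L * sqgrad_h len D by rewrite mulr_ge0// ltW.
  rewrite /E_el; lra.
rewrite le_max; have [_|_] := leP (sigma - g * tip (f_h m P) D) (- Cstar - E_el m len P').
  by apply/orP; right; rewrite addrC subrK.
by rewrite h1.
Qed.

(** Here the stabilization term has no sign, but the second correction of the
    auxiliary variable cancels it. *)
Lemma corrector_energy Q s tau Qs ss Q' s' : 0 < tau -> zero_bdry Q ->
  sESAV2_corrector m len kappa Cstar Q s tau Qs ss Q' s' ->
  E_h m len Q' s' <= Num.max (E_h m len Q s) (- Cstar).
Proof.
move=> t0 Q0 H; have E := corrector_eq H; case: H => SQ' _ ->.
have Q'0 := in_S_h_zero_bdry SQ'.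
set g := g_h _ _ _ _ in E *; rewrite /E_h; set D := (fun k => Q' k - Q k).
set W := (fun k => 2^-1 *: (Q' k + Q k) - Qs k).
have D0 : zero_bdry D by exact: zero_bdryB.
have T : tau^-1 * tip D D =
  L / 2 * tip (tlap len (Q' + Q)) D + g * (tip (f_h m Qs) D - kappa * tip W D).
  rewrite -!tipZl -tipBl -tipZl -tipDl; exact: tip_interior.
have inc := tip_tlap_sum_increment len M_gt0 Q'0 Q0.
rewrite -[Q' - Q]/D in inc; rewrite inc in T.
have D2 : 0 <= tip D D by exact: tip_ge0 len_gt0 M_gt0 D.
have h1 : E_el m len Q' + (s - g * tip (f_h m Qs) D + kappa * g * tip W D)
    <= E_el m len Q + s.
  have h2 : 0 <= tau^-1 * tip D D by rewrite mulr_ge0// invr_ge0 ltW.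
  rewrite /E_el; lra.
rewrite le_max; have [_|_] := leP (s - g * tip (f_h m Qs) D + kappa * g * tip W D)
   (- Cstar - E_el m len Q').
  by apply/orP; right; rewrite addrC subrK.
by rewrite h1.
Qed.

(** ** Maximum bound *)

(** The implicit operator obeys the maximum principle, and its right-hand side is
    bounded by its zeroth-order coefficient times eta. *)
Lemma sESAV1_max_bound P sigma theta P' sigma' eta : 0 < theta -> 0 <= eta ->
  (forall k, frob (P k) <= eta) ->
  (forall k, frob (f_bulk m (P k) + kappa *: P k) <= kappa * eta) ->
  sESAV1 m len kappa Cstar P sigma theta P' sigma' -> forall k, frob (P' k) <= eta.
Proof.
move=> t0 e0 HP Hf H; have E := sESAV1_eq H; case: H => SP' _ _.
set g := g_h _ _ _ _ in E; have g0 : 0 < g by exact: g_h_gt0.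
have a0 : 0 < theta^-1 + g * kappa by rewrite ltr_pwDl ?invr_gt0// mulr_ge0// ltW.
apply: (discrete_max_principle len_gt0 M_gt0 a0 (ltW L_gt0) e0
  (Y := fun k => theta^-1 *: P k + g *: (f_bulk m (P k) + kappa *: P k))) => [|k ki|k ki].
- exact: in_S_h_zero_bdry.
- have /matrixP E' := E k ki; apply/matrixP => i j; have := E' i j; rewrite !mxE; lra.
apply: le_trans (frobD _ _) _; rewrite !frobZ !ger0_norm ?invr_ge0 ?(ltW t0) ?(ltW g0)//.
by rewrite mulrDl -mulrA lerD// ler_wpM2l ?invr_ge0 ?(ltW t0) ?(ltW g0).
Qed.

Lemma corrector_max_bound Q s tau Qs ss Q' s' eta : 0 < tau -> 0 <= eta ->
  2 * d%:R * L / h ^+ 2 <= 2 / tau - kappa * g_h m len Qs ss ->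
  (forall k, frob (Q k) <= eta) -> (forall k, frob (Qs k) <= eta) ->
  (forall k, frob (f_bulk m (Qs k) + kappa *: Qs k) <= kappa * eta) ->
  sESAV2_corrector m len kappa Cstar Q s tau Qs ss Q' s' -> forall k, frob (Q' k) <= eta.
Proof.
move=> t0 e0 Ht HQ HQs Hf [SQ' E _]; move: Ht E.
set g := g_h _ _ _ _ => Ht E; have g0 : 0 < g by exact: g_h_gt0.
have a0 : 0 < 2 / tau + kappa * g by rewrite ltr_pwDl ?divr_gt0// mulr_ge0// ltW.
apply: (discrete_max_principle len_gt0 M_gt0 a0 (ltW L_gt0) e0
  (Y := fun k => ((2 / tau - kappa * g) *: Q k + L *: tlap len Q k)
     + (2 * g) *: (f_bulk m (Qs k) + kappa *: Qs k))) => [|k ki|k ki].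
- exact: in_S_h_zero_bdry.
- apply/matrixP => i j; have := E k ki i j; rewrite /f_h !mxE; lra.
have := explicit_lap_bound k (ltW L_gt0) Ht HQ.
have : (2 * g) * frob (f_bulk m (Qs k) + kappa *: Qs k) <= 2 * g * (kappa * eta).
  by rewrite ler_wpM2l ?mulr_ge0// ltW.
have := frobD ((2 / tau - kappa * g) *: Q k + L *: tlap len Q k)
     ((2 * g) *: (f_bulk m (Qs k) + kappa *: Qs k)).
rewrite (frobZ (2 * g)) (@ger0_norm _ (2 * g)) ?mulr_ge0 ?(ltW g0)//.
lra.
Qed.

(** ** Invariants of the iteration *)

Definition scheme_inv E0 eta Q s := [/\ in_S_h Q, forall k, frob (Q k) <= eta,
  - Cstar <= E_h m len Q s & E_h m len Q s <= E0].

Lemma sESAV1_E_ge P sigma theta P' sigma' :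
  sESAV1 m len kappa Cstar P sigma theta P' sigma' -> - Cstar <= E_h m len P' sigma'.
Proof.
case=> _ _ ->; rewrite /E_h -lerBlDl le_max; apply/orP; right.
exact: lexx.
Qed.

Lemma corrector_E_ge Q s tau Qs ss Q' s' :
  sESAV2_corrector m len kappa Cstar Q s tau Qs ss Q' s' -> - Cstar <= E_h m len Q' s'.
Proof.
case=> _ _ ->; rewrite /E_h -lerBlDl le_max; apply/orP; right.
exact: lexx.
Qed.

Lemma sESAV1_inv E0 eta P sigma theta P' sigma' : 0 < theta -> 0 <= eta ->
  (forall A : 'M[R]_d, sym_tracefree A -> frob A <= eta ->
     frob (f_bulk m A + kappa *: A) <= kappa * eta) ->
  scheme_inv E0 eta P sigma ->
  sESAV1 m len kappa Cstar P sigma theta P' sigma' -> scheme_inv E0 eta P' sigma'.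
Proof.
move=> t0 e0 Hf [SP HP lo up] H; split; first by case: H.
- by apply: (sESAV1_max_bound t0 e0 HP _ H) => k; apply: Hf => //; exact: SP.1.
- exact: sESAV1_E_ge H.
- apply: le_trans (sESAV1_energy t0 (in_S_h_zero_bdry SP) H) _.
  by rewrite max_l.
Qed.

Lemma sESAV2_inv E0 eta Q s tau Qs ss Q' s' : 0 < tau -> 0 <= eta ->
  (forall A : 'M[R]_d, sym_tracefree A -> frob A <= eta ->
     frob (f_bulk m A + kappa *: A) <= kappa * eta) ->
  2 * d%:R * L / h ^+ 2 <= 2 / tau - kappa * expR (E0 + Cstar) ->
  scheme_inv E0 eta Q s -> scheme_inv E0 eta Qs ss ->
  sESAV2_corrector m len kappa Cstar Q s tau Qs ss Q' s' -> scheme_inv E0 eta Q' s'.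
Proof.
move=> t0 e0 Hf Ht [SQ HQ lo up] [SQs HQs _ ups] H; split; first by case: H.
- apply: (corrector_max_bound t0 e0 _ HQ HQs _ H) => [|k]; last by apply: Hf => //; exact: SQs.1.
  by apply: le_trans Ht _; rewrite lerD2l lerN2 ler_wpM2l// g_h_le.
- exact: corrector_E_ge H.
- apply: le_trans (corrector_energy t0 (in_S_h_zero_bdry SQ) H) _.
  by rewrite max_l.
Qed.

End SchemeStability.

Local Open Scope classical_set_scope.

(** * Taylor expansions along segments *)

(** Regularity is only known through chains of directional derivatives in an open
    set O, so the expansions are taken along segments of O in one direction e. *)
Section DirectionalTaylor.
Variables (R : realType) (V : normedModType R) (O : set V) (e : V).
Hypothesis O_seg : forall p s l, 0 <= s <= l -> O p -> O (p + l *: e) -> O (p + s *: e).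
Implicit Types (u v w : V -> R) (p : V) (s l K : R).

Definition dir_derive u v := forall p, O p -> is_derive p e u (v p).

Lemma is_derive_line u p s dv : is_derive (p + s *: e) e u dv ->
  is_derive s 1 (fun x : R => u (p + x *: e)) dv.
Proof.
move=> [H1 H2].
have E : (fun h : R => h^-1 *: (((fun x : R => u (p + x *: e)) \o shift s) (h *: (1 : R))
      - u (p + s *: e)))
  = (fun h : R => h^-1 *: ((u \o shift (p + s *: e)) (h *: e) - u (p + s *: e))).
  apply/funext => h; congr (_ *: (_ - _)) => /=; congr u.
  by rewrite [h *: 1]mulr1 scalerDl addrCA.
by apply: DeriveDef; rewrite /derivable /derive E.
Qed.

(** Raises the order of a remainder by one; applied to the derivative in s of a
    symmetric difference, it yields the Taylor estimates one from another. *)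
Lemma mvt_power (psi dpsi : R -> R) l K k : 0 <= l -> psi 0 = 0 ->
  (forall s, 0 <= s <= l -> is_derive s 1 psi (dpsi s)) ->
  (forall s, 0 <= s <= l -> `|dpsi s| <= K * s ^+ k) ->
  `|psi l| <= K * l ^+ k.+1.
Proof.
move=> l0 p0 D B.
have [| |c] := @MVT_segment R psi dpsi 0 l l0.
- by move=> x; rewrite in_itv /= => /andP[x0 xl]; apply: D; rewrite !ltW.
- apply: derivable_within_continuous => x; rewrite in_itv /= => xl.
  by have := D x xl; case.
rewrite in_itv /= p0 !subr0 => /andP[c0 cl] ->.
have K0 : 0 <= K * c ^+ k.
  by apply: le_trans (B c _); rewrite ?c0.
rewrite normrM (ger0_norm l0) exprSr mulrA ler_wpM2r//.
apply: le_trans (B c _) _; first by rewrite c0.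
have [->|cn] := eqVneq c 0.
  case: k B K0 => [|k] B K0; first by rewrite !expr0.
  rewrite expr0n mulr0.
  have [->|ln] := eqVneq l 0; first by rewrite expr0n mulr0.
  have l1 : 0 < l by rewrite lt_def ln.
  have := B l; rewrite l0 lexx => /(_ isT); exact: le_trans.
have cp : 0 < c by rewrite lt_def cn.
rewrite ler_wpM2l ?lerXn2r ?nnegrE//.
by move: K0; rewrite pmulr_lge0 ?exprn_gt0.
Qed.

Lemma segN p s l : 0 <= s <= l -> O p -> O (p - l *: e) -> O (p - s *: e).
Proof.
move=> /andP[s0 sl] Op Opl.
have -> : p - s *: e = (p - l *: e) + (l - s) *: e.
  by rewrite scalerBl addrA subrK.
apply: (O_seg (l := l)) => //; last by rewrite subrK.
by rewrite subr_ge0 sl lerBlDr lerDl.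
Qed.

Lemma taylor1 u v K p l : dir_derive u v -> (forall p, O p -> `|v p| <= K) ->
  0 <= l -> O p -> O (p + l *: e) -> `|u (p + l *: e) - u p| <= K * l.
Proof.
move=> D B l0 Op Opl; rewrite -[l in K * l]expr1.
apply: (mvt_power (psi := fun s => u (p + s *: e) - u p)
   (dpsi := fun s => v (p + s *: e)) (k := 0)) => //.
- by rewrite scale0r addr0 subrr.
- move=> s sl; have Os := O_seg sl Op Opl.
  have := is_derive_line (D _ Os) => d1; apply: is_derive_eq.
  by rewrite subr0.
- by move=> s sl; rewrite expr0 mulr1 B//; exact: O_seg sl Op Opl.
Qed.

Lemma is_derive_opp_line u p s dv : is_derive (p - s *: e) e u dv ->
  is_derive s 1 (fun x : R => u (p - x *: e)) (- dv).
Proof.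
move=> H; have H' : is_derive (p + (- s) *: e) e u dv by rewrite scaleNr.
have d1 := is_derive_line H'.
have -> : (fun x : R => u (p - x *: e)) = (fun x => u (p + x *: e)) \o -%R.
  by apply/funext => x /=; rewrite scaleNr.
have d2 := is_deriveNid s (1 : R).
by rewrite -mulrN1; exact: is_derive1_comp d1 d2.
Qed.

Lemma taylor2 u v w K p l : dir_derive u v -> dir_derive v w ->
  (forall p, O p -> `|w p| <= K) ->
  0 <= l -> O p -> O (p + l *: e) -> O (p - l *: e) ->
  `|u (p + l *: e) - 2 * u p + u (p - l *: e)| <= 2 * K * l ^+ 2.
Proof.
move=> D D' B l0 Op Opl Oml.
apply: (mvt_power (psi := fun s => u (p + s *: e) - 2 * u p + u (p - s *: e))
   (dpsi := fun s => v (p + s *: e) - v (p - s *: e)) (k := 1)) => //.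
- by rewrite scale0r subr0 addr0; ring.
- move=> s sl; have d1 := is_derive_line (D _ (O_seg sl Op Opl)).
  have d2 := is_derive_opp_line (D _ (segN sl Op Oml)).
  by apply: is_derive_eq; rewrite subr0.
move=> s sl; rewrite expr1.
have E : p + s *: e = (p - s *: e) + (2 * s) *: e.
  by rewrite -addrA -scaleNr -scalerDl; congr (_ + _ *: _); ring.
rewrite E.
have -> : 2 * K * s = K * (2 * s) by ring.
apply: (taylor1 D' B); last by rewrite -E; exact: O_seg sl Op Opl.
  by rewrite mulr_ge0//; case/andP: sl.
exact: segN sl Op Oml.
Qed.

Lemma taylor3 u v w z K p l : dir_derive u v -> dir_derive v w -> dir_derive w z ->
  (forall p, O p -> `|z p| <= K) ->
  0 <= l -> O p -> O (p + l *: e) -> O (p - l *: e) ->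
  `|u (p + l *: e) - u (p - l *: e) - 2 * l * v p| <= 2 * K * l ^+ 3.
Proof.
move=> D D' D'' B l0 Op Opl Oml.
apply: (mvt_power (psi := fun s => u (p + s *: e) - u (p - s *: e) - 2 * s * v p)
   (dpsi := fun s => v (p + s *: e) - 2 * v p + v (p - s *: e)) (k := 2)) => //.
- by rewrite scale0r subr0 addr0; ring.
- move=> s sl; have d1 := is_derive_line (D _ (O_seg sl Op Opl)).
  have d2 := is_derive_opp_line (D _ (segN sl Op Oml)).
  apply: is_derive_eq; rewrite /GRing.scale /=; ring.
move=> s sl; apply: (taylor2 D' D'' B); first by case/andP: sl.
- exact: Op.
- exact: O_seg sl Op Opl.
- exact: segN sl Op Oml.
Qed.

Lemma taylor4 u v w z y K p l : dir_derive u v -> dir_derive v w ->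
  dir_derive w z -> dir_derive z y -> (forall p, O p -> `|y p| <= K) ->
  0 <= l -> O p -> O (p + l *: e) -> O (p - l *: e) ->
  `|u (p + l *: e) - 2 * u p + u (p - l *: e) - l ^+ 2 * w p| <= 2 * K * l ^+ 4.
Proof.
move=> D D' D'' D3 B l0 Op Opl Oml.
apply: (mvt_power
   (psi := fun s => u (p + s *: e) - 2 * u p + u (p - s *: e) - s ^+ 2 * w p)
   (dpsi := fun s => v (p + s *: e) - v (p - s *: e) - 2 * s * w p) (k := 3)) => //.
- by rewrite scale0r subr0 addr0; ring.
- move=> s sl; have d1 := is_derive_line (D _ (O_seg sl Op Opl)).
  have d2 := is_derive_opp_line (D _ (segN sl Op Oml)).
  apply: is_derive_eq; rewrite /GRing.scale /=; ring.
move=> s sl; apply: (taylor3 D' D'' D3 B); first by case/andP: sl.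
- exact: Op.
- exact: O_seg sl Op Opl.
- exact: segN sl Op Oml.
Qed.

End DirectionalTaylor.

(** * The space-time cylinder *)
Section Cylinder.
Variables (R : realType) (d : nat) (len T : R).
Hypotheses (len_gt0 : 0 < len) (T_gt0 : 0 < T).
Local Notation V := ('rV[R]_d * R)%type.
Local Notation D := (@Omega_T R d len T).
Implicit Types (p q : V) (u v : V -> R) (s l : R).

Definition open_cyl : set V := [set p : V | (forall i : 'I_d, 0 < p.1 0 i < len) /\ 0 < p.2 < T].

Lemma open_cyl_nbhs p : open_cyl p -> \forall q \near p, open_cyl q.
Proof.
move=> [H1 H2].
have c1 i : (fun q : V => q.1 0 i) @ p --> p.1 0 i.
  by apply: (@cvg_comp _ _ _ fst (fun x : 'rV[R]_d => x 0 i) _ (nbhs p.1));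
    [exact: cvg_fst|exact: coord_continuous].
have c2 : (fun q : V => q.2) @ p --> p.2 by exact: cvg_snd.
have n1 : \forall q \near p, forall i, 0 < (q : V).1 0 i < len.
  apply: (filter_forall (nbhs_filter (p : V))) => i; have /andP[a b] := H1 i.
  near=> q; apply/andP; split; near: q.
    exact: cvgr_gt _ (c1 i) _ a.
  exact: cvgr_lt _ (c1 i) _ b.
have n2 : \forall q \near p, 0 < (q : V).2 < T.
  have /andP[a b] := H2.
  near=> q; apply/andP; split; near: q.
    exact: cvgr_gt _ c2 _ a.
  exact: cvgr_lt _ c2 _ b.
near=> q; split; near: q.
  exact: n1.
exact: n2.
Unshelve. all: by end_near. Qed.

Lemma open_cyl_sub p : open_cyl p -> D p.
Proof.
move=> [H1 /andP[a b]]; split; last by rewrite !ltW.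
by move=> i; have /andP[x y] := H1 i; rewrite !ltW.
Qed.

Lemma open_cyl_interior p : open_cyl p -> D° p.
Proof.
move=> /open_cyl_nbhs Op; near=> q; apply: open_cyl_sub; near: q; exact: Op.
Unshelve. all: by end_near.
Qed.

Lemma open_cyl_seg (e p : V) s l : 0 <= s <= l -> open_cyl p -> open_cyl (p + l *: e) ->
  open_cyl (p + s *: e).
Proof.
move=> /andP[s0 sl] [p1 p2] [q1 q2].
have cvx (a x b : R) : 0 < a < b -> 0 < a + l * x < b -> 0 < a + s * x < b.
  move=> /andP[a0 ab] /andP[h1 h2].
  have [x0|x0] := leP 0 x.
    have k1 : 0 <= s * x by rewrite mulr_ge0.
    have k2 : s * x <= l * x by rewrite ler_wpM2r.
    apply/andP; split; lra.
  have k1 : s * x <= 0 by rewrite mulr_ge0_le0// ltW.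
  have k2 : l * x <= s * x by rewrite ler_wnM2r// ltW.
  apply/andP; split; lra.
split.
  by move=> i; have := p1 i; have := q1 i; rewrite /= !mxE => h1 h2; exact: cvx h2 h1.
exact: cvx p2 q2.
Qed.

Definition cyl_center : V := (const_mx (len / 2), T / 2).

(** Contracting the closed cylinder towards its centre moves it into the open one,
    and maps a stencil to a smaller stencil in the same direction. *)
Definition contract (ep : R) p : V := p + ep *: (cyl_center - p).

Lemma contract_open ep p : 0 < ep <= 1 -> D p -> open_cyl (contract ep p).
Proof.
move=> /andP[e0 e1] [p1 p2].
have cvx (a b : R) : 0 <= a <= b -> 0 < b -> 0 < a + ep * (b / 2 - a) < b.
  move=> /andP[a0 ab] b0.
  have -> : a + ep * (b / 2 - a) = (1 - ep) * a + ep * (b / 2) by ring.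
  have k1 : 0 <= (1 - ep) * a by rewrite mulr_ge0// subr_ge0.
  have k2 : (1 - ep) * a <= (1 - ep) * b by rewrite ler_wpM2l// subr_ge0.
  have k3 : 0 < ep * (b / 2) by rewrite mulr_gt0// divr_gt0.
  apply/andP; split; lra.
split; last exact: cvx p2 T_gt0.
by move=> i; rewrite /= !mxE; exact: cvx (p1 i) len_gt0.
Qed.

Lemma contractD ep p l (e : V) :
  contract ep (p + l *: e) = contract ep p + ((1 - ep) * l) *: e.
Proof.
rewrite /contract mulrBl mul1r opprD addrA scalerDr [ep *: (- _)]scalerN scalerA scalerBl.
by rewrite -!addrA; congr (p + _); rewrite addrCA; congr (_ + _); rewrite addrC addrA.
Qed.

Lemma contract_cvg u p : {within D, continuous u} -> D p ->
  (fun ep => u (contract ep p)) @ (0 : R)^'+ --> u p.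
Proof.
move=> /subspace_continuousP/(_ p) cu Dp; have {}cu := cu Dp.
have cc : (fun ep => contract ep p) @ (0 : R)^'+ --> p.
  have H : (fun ep => p + ep *: (cyl_center - p)) @ (0 : R) --> p + 0 *: (cyl_center - p).
    by apply: cvgD; [exact: cvg_cst|apply: cvgZr_tmp; exact: cvg_id].
  rewrite scale0r addr0 in H; exact: cvg_at_right_filter H.
have near1 : \forall ep \near (0 : R)^'+, D (contract ep p).
  near=> ep; apply: open_cyl_sub; apply: contract_open => //.
  by apply/andP; split; near: ep; [exact: nbhs_right_gt|exact: nbhs_right_le].
move=> U HU; have := cu _ HU; rewrite /= /within /= => HN.
have := cc _ HN; apply: filterS2 near1 => ep Dep /=.
exact.
Unshelve. all: by end_near. Qed.

End Cylinder.

Lemma lim_norm_le (R : realType) (X : R -> R) (x K : R) : X @ (0 : R)^'+ --> x ->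
  (forall ep, 0 < ep <= 1 -> `|X ep| <= K) -> `|x| <= K.
Proof.
move=> cX B; rewrite leNgt; apply/negP => Kx.
have nK : \forall ep \near (0 : R)^'+, K < `|X ep|.
  by apply: cvgr_gt Kx; exact: cvg_norm.
have n1 : \forall ep \near (0 : R)^'+, 0 < ep <= 1.
  by near=> ep; apply/andP; split; near: ep; [exact: nbhs_right_gt|exact: nbhs_right_le].
have : \forall ep \near (0 : R)^'+, K < `|X ep| /\ 0 < ep <= 1.
  by near=> ep; split; near: ep.
move=> /(@filter_ex _ _ (at_right_proper_filter (0 : R)))[ep [h1 h2]].
by move: h1; rewrite ltNge B.
Unshelve. all: by end_near. Qed.

Section ClosedCylinder.
Variables (R : realType) (d : nat) (len T : R).
Hypotheses (len_gt0 : 0 < len) (T_gt0 : 0 < T).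
Local Notation V := ('rV[R]_d * R)%type.
Local Notation D := (@Omega_T R d len T).
Local Notation O := (@open_cyl R d len T).
Implicit Types (p q e : V) (u v w : V -> R) (s l K : R).

Lemma contractB ep p l e :
  contract len T ep (p - l *: e) = contract len T ep p - ((1 - ep) * l) *: e.
Proof. by rewrite -scaleNr contractD mulrN scaleNr. Qed.

Lemma shrink_pow K ep l k : 0 <= K -> 0 < ep <= 1 -> 0 <= l ->
  K * ((1 - ep) * l) ^+ k <= K * l ^+ k.
Proof.
move=> K0 /andP[e0 e1] l0; rewrite ler_wpM2l//.
have e2 : 0 <= 1 - ep by rewrite subr_ge0.
by rewrite lerXn2r ?nnegrE ?mulr_ge0// ler_piMl// gerBl ltW.
Qed.

(** Derivatives exist in the open cylinder only, while the grid and the time steps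
    reach its boundary. An estimate between finitely many values passes to the
    closure: contract the points, apply it there, and let ep tend to 0. *)
Lemma closed_lipschitz u e K : 0 <= K -> {within D, continuous u} ->
  (forall p l, 0 <= l -> O p -> O (p + l *: e) -> `|u (p + l *: e) - u p| <= K * l) ->
  forall p l, 0 <= l -> D p -> D (p + l *: e) -> `|u (p + l *: e) - u p| <= K * l.
Proof.
move=> K0 cu H p l l0 Dp Dq.
apply: (lim_norm_le (cvgB (contract_cvg len_gt0 T_gt0 cu Dq) (contract_cvg len_gt0 T_gt0 cu Dp))).
move=> ep e1; have Oq := contract_open len_gt0 T_gt0 e1 Dq.
have Op := contract_open len_gt0 T_gt0 e1 Dp.
move: Oq; rewrite ?fctE /= contractD => Oq; apply: le_trans (H _ _ _ Op Oq) _.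
  by rewrite mulr_ge0// subr_ge0; case/andP: e1.
by have := shrink_pow 1 K0 e1 l0; rewrite !expr1.
Qed.

(** With c l^j v the expected value of the difference, this covers second
    differences, central differences and their truncation errors at once. *)
Lemma closed_stencil u v e (b g c : R) j k K : 0 <= K ->
  {within D, continuous u} -> {within D, continuous v} ->
  (forall p l, 0 <= l -> O p -> O (p + l *: e) -> O (p - l *: e) ->
    `|u (p + l *: e) + b * u p + g * u (p - l *: e) - c * l ^+ j * v p| <= K * l ^+ k) ->
  forall p l, 0 <= l -> D p -> D (p + l *: e) -> D (p - l *: e) ->
    `|u (p + l *: e) + b * u p + g * u (p - l *: e) - c * l ^+ j * v p| <= K * l ^+ k.
Proof.
move=> K0 cu cv H p l l0 Dp Dq Dr.
pose C := contract_cvg len_gt0 T_gt0.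
have cl : (fun ep : R => (1 - ep) * l) @ (0 : R)^'+ --> l.
  have h : (fun ep : R => (1 - ep) * l) @ (0 : R) --> (1 - 0) * l.
    by apply: cvgM; [apply: cvgB; [exact: cvg_cst|exact: cvg_id]|exact: cvg_cst].
  by rewrite subr0 mul1r in h; exact: cvg_at_right_filter h.
have clj : (fun ep : R => c * ((1 - ep) * l) ^+ j) @ (0 : R)^'+ --> c * l ^+ j.
  by apply: cvgM; [exact: cvg_cst|exact: (cvg_comp _ _ cl (@exprn_continuous R j l))].
pose X ep := u (contract len T ep (p + l *: e)) + b * u (contract len T ep p)
   + g * u (contract len T ep (p - l *: e))
   - c * ((1 - ep) * l) ^+ j * v (contract len T ep p).
have cX : X ep @[ep --> (0 : R)^'+] --> u (p + l *: e) + b * u p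
     + g * u (p - l *: e) - c * l ^+ j * v p.
  apply: cvgB; last by apply: cvgM => //; exact: C.
  apply: cvgD; last by apply: cvgM; [exact: cvg_cst|exact: C].
  by apply: cvgD; [exact: C|apply: cvgM; [exact: cvg_cst|exact: C]].
apply: (lim_norm_le cX) => {cX}; rewrite /X.
move=> ep e1; have Oq := contract_open len_gt0 T_gt0 e1 Dq.
have Op := contract_open len_gt0 T_gt0 e1 Dp.
have Or := contract_open len_gt0 T_gt0 e1 Dr.
move: Oq Or; rewrite ?fctE /= contractD contractB => Oq Or.
apply: le_trans (H _ _ _ Op Oq Or) _; last exact: shrink_pow.
by rewrite mulr_ge0// subr_ge0; case/andP: e1.
Qed.

Lemma Omega_T_compact : compact D.
Proof.
have -> : D = [set x : 'rV[R]_d | forall i, `[0, len] (x ord0 i)] `*` `[0, T].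
  apply/seteqP; split => [p [h1 h2]|p [h1 h2]].
    by split; [move=> i /=; rewrite in_itv /= h1|rewrite /= in_itv].
  split; last by move: h2; rewrite /= in_itv.
  by move=> i; have := h1 i; rewrite /= in_itv.
apply: compact_setX; last exact: segment_compact.
by apply: (@rV_compact R d (fun=> `[0, len])) => i; exact: segment_compact.
Qed.

Lemma C_upto_cont r u : C_upto r D u -> {within D, continuous u}.
Proof. by case: r => [|r] []. Qed.

Lemma C_upto_bounded r u : C_upto r D u ->
  exists2 K : R, 0 <= K & forall p, D p -> `|u p| <= K.
Proof.
move=> /C_upto_cont cu.
have /compact_bounded[K0 [_ HK]] := continuous_compact cu Omega_T_compact.
exists (Num.max 0 (K0 + 1)); first by rewrite le_max lexx.
move=> p Dp; apply: (HK (Num.max 0 (K0 + 1))); last by exists p.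
by rewrite lt_max ltrDl ltr01 orbT.
Qed.

Lemma C_upto_derive r u i : C_upto r.+1 D u ->
  exists v, C_upto r D v /\ dir_derive O (st_dir R i) u v.
Proof.
move=> [_ /(_ i)[v [Cv Hv]]]; exists v; split=> // p Op.
exact: Hv (open_cyl_interior Op).
Qed.

Let seg e p s l := @open_cyl_seg R d len T e p s l.

Lemma C1_lipschitz u i : C_upto 1 D u -> exists2 K : R, 0 <= K &
  forall p l, 0 <= l -> D p -> D (p + l *: st_dir R i) ->
  `|u (p + l *: st_dir R i) - u p| <= K * l.
Proof.
move=> Cu; have [v [Cv uv]] := C_upto_derive i Cu.
have [K K0 HK] := C_upto_bounded Cv; exists K => //.
apply: closed_lipschitz => //; first exact: C_upto_cont Cu.
move=> p l l0 Op Oq; apply: (taylor1 (@seg _) uv) => //.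
by move=> q Oq'; apply: HK; exact: open_cyl_sub.
Qed.

Lemma C2_second_difference u i : C_upto 2 D u -> exists2 K : R, 0 <= K &
  forall p l, 0 <= l -> D p -> D (p + l *: st_dir R i) -> D (p - l *: st_dir R i) ->
  `|u (p + l *: st_dir R i) - 2 * u p + u (p - l *: st_dir R i)| <= K * l ^+ 2.
Proof.
move=> Cu; have [v [Cv uv]] := C_upto_derive i Cu; have [w [Cw vw]] := C_upto_derive i Cv.
have [K K0 HK] := C_upto_bounded Cw; have K2 : 0 <= 2 * K by rewrite mulr_ge0.
exists (2 * K) => //.
move=> p l l0 Dp Dq Dr; have cu := C_upto_cont Cu.
have := closed_stencil (b := -2) (g := 1) (c := 0) (j := 0) (k := 2) K2 cu cu.
move=> /(_ (st_dir R i)) H; have := H _ p l l0 Dp Dq Dr.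
rewrite !mulNr mul1r !mul0r subr0; apply.
move=> {p l l0 Dp Dq Dr} p l l0 Op Oq Or; rewrite !mulNr mul1r !mul0r subr0.
apply: (taylor2 (@seg _) uv vw) => //.
by move=> q Oq'; apply: HK; exact: open_cyl_sub.
Qed.

Lemma C3_central_difference u i : C_upto 3 D u -> exists v, [/\ C_upto 2 D v,
  dir_derive O (st_dir R i) u v & exists2 K : R, 0 <= K &
  forall p l, 0 <= l -> D p -> D (p + l *: st_dir R i) -> D (p - l *: st_dir R i) ->
  `|u (p + l *: st_dir R i) - u (p - l *: st_dir R i) - 2 * l * v p| <= K * l ^+ 3].
Proof.
move=> Cu; have [v [Cv uv]] := C_upto_derive i Cu; have [w [Cw vw]] := C_upto_derive i Cv.
have [z [Cz wz]] := C_upto_derive i Cw.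
exists v; split=> //.
have [K K0 HK] := C_upto_bounded Cz; have K2 : 0 <= 2 * K by rewrite mulr_ge0.
exists (2 * K) => //.
move=> p l l0 Dp Dq Dr; have cu := C_upto_cont Cu; have cv := C_upto_cont Cv.
have := closed_stencil (b := 0) (g := -1) (c := 2) (j := 1) (k := 3) K2 cu cv.
move=> /(_ (st_dir R i)) H; have := H _ p l l0 Dp Dq Dr.
rewrite !mulN1r !mul0r addr0 expr1; apply.
move=> {p l l0 Dp Dq Dr} p l l0 Op Oq Or; rewrite !mulN1r !mul0r addr0 expr1.
apply: (taylor3 (@seg _) uv vw wz) => //.
by move=> q Oq'; apply: HK; exact: open_cyl_sub.
Qed.

Lemma C4_second_derivative u i : C_upto 4 D u -> exists w, [/\ C_upto 2 D w,
  forall p, O p -> 'D_(st_dir R i) ('D_(st_dir R i) u) p = w p & exists2 K : R, 0 <= K &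
  forall p l, 0 <= l -> D p -> D (p + l *: st_dir R i) -> D (p - l *: st_dir R i) ->
  `|u (p + l *: st_dir R i) - 2 * u p + u (p - l *: st_dir R i) - l ^+ 2 * w p|
   <= K * l ^+ 4].
Proof.
move=> Cu; have [v [Cv uv]] := C_upto_derive i Cu; have [w [Cw vw]] := C_upto_derive i Cv.
have [z [Cz wz]] := C_upto_derive i Cw; have [y [Cy zy]] := C_upto_derive i Cz.
exists w; split=> //.
  move=> p Op; have [_ <-] := vw p Op; apply: near_eq_derive.
  have := open_cyl_nbhs Op => Onb; near=> q.
  have Oq : O q by near: q; exact: Onb.
  by have [_ ->] := uv q Oq.
have [K K0 HK] := C_upto_bounded Cy; have K2 : 0 <= 2 * K by rewrite mulr_ge0.
exists (2 * K) => //.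
move=> p l l0 Dp Dq Dr; have cu := C_upto_cont Cu; have cw := C_upto_cont Cw.
have := closed_stencil (b := -2) (g := 1) (c := 1) (j := 2) (k := 4) K2 cu cw.
move=> /(_ (st_dir R i)) H; have := H _ p l l0 Dp Dq Dr.
rewrite !mulNr !mul1r; apply.
move=> {p l l0 Dp Dq Dr} p l l0 Op Oq Or; rewrite !mulNr !mul1r.
apply: (taylor4 (@seg _) uv vw wz zy) => //.
by move=> q Oq'; apply: HK; exact: open_cyl_sub.
Unshelve. all: by end_near. Qed.

End ClosedCylinder.

(** * Consistency of the exact solution *)
Lemma le_enlarge (R : realType) (K K' X y : R) : 0 <= y -> K <= K' ->
  X <= K * y -> X <= K' * y.
Proof. by move=> y0 KK H; apply: le_trans H _; rewrite ler_wpM2r. Qed.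

Section Regularity.
Variables (R : realType) (d : nat) (len T : R).
Hypotheses (len_gt0 : 0 < len) (T_gt0 : 0 < T).
Local Notation V := ('rV[R]_d * R)%type.
Local Notation D := (@Omega_T R d len T).
Local Notation O := (@open_cyl R d len T).
Local Notation et := (@st_dir R d None).
Local Notation ex k := (@st_dir R d (Some k)).
Implicit Types (p : V) (u : V -> R) (l K : R) (k : 'I_d).

(** Everything the error analysis uses about one entry of the exact solution,
    with ut and w k its time and second space derivatives. *)
Record regular u (ut : V -> R) (w : 'I_d -> V -> R) K : Prop := Regular {
  reg_K : 0 <= K;
  reg_bound : forall p, D p -> `|u p| <= K;
  reg_t_lip : forall p l, 0 <= l -> D p -> D (p + l *: et) ->
    `|u (p + l *: et) - u p| <= K * l;
  reg_t_diff2 : forall p l, 0 <= l -> D p -> D (p + l *: et) -> D (p - l *: et) ->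
    `|u (p + l *: et) - 2 * u p + u (p - l *: et)| <= K * l ^+ 2;
  reg_t_central : forall p l, 0 <= l -> D p -> D (p + l *: et) -> D (p - l *: et) ->
    `|u (p + l *: et) - u (p - l *: et) - 2 * l * ut p| <= K * l ^+ 3;
  reg_x_lip : forall k p l, 0 <= l -> D p -> D (p + l *: ex k) ->
    `|u (p + l *: ex k) - u p| <= K * l;
  reg_x_diff2 : forall k p l, 0 <= l -> D p -> D (p + l *: ex k) -> D (p - l *: ex k) ->
    `|u (p + l *: ex k) - 2 * u p + u (p - l *: ex k)| <= K * l ^+ 2;
  reg_x_second : forall k p l, 0 <= l -> D p -> D (p + l *: ex k) -> D (p - l *: ex k) ->
    `|u (p + l *: ex k) - 2 * u p + u (p - l *: ex k) - l ^+ 2 * w k p| <= K * l ^+ 4;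
  reg_w_lip : forall k p l, 0 <= l -> D p -> D (p + l *: et) ->
    `|w k (p + l *: et) - w k p| <= K * l;
  reg_w_diff2 : forall k p l, 0 <= l -> D p -> D (p + l *: et) -> D (p - l *: et) ->
    `|w k (p + l *: et) - 2 * w k p + w k (p - l *: et)| <= K * l ^+ 2;
  reg_ut : forall p, O p -> 'D_et u p = ut p;
  reg_w : forall k p, O p -> 'D_(ex k) ('D_(ex k) u) p = w k p }.

Lemma regular_le u ut w K K' : K <= K' -> regular u ut w K -> regular u ut w K'.
Proof.
move=> KK [K0 h1 h2 h3 h4 h5 h6 h7 h8 h9 h10 h11].
by split => //; first exact: le_trans KK; intros;
  first [apply: le_trans KK; auto; fail | apply: (le_enlarge _ KK); [rewrite ?exprn_ge0//|auto]].
Qed.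

Lemma C_upto_pred r (A : set V) u : C_upto r.+1 A u -> C_upto r A u.
Proof.
elim: r u => [|r IH] u [cu Hu]; first by split.
split=> // e; have [v [Cv uv]] := Hu e; exists v; split=> //.
exact: IH.
Qed.

Lemma C4_regular u : C_upto 4 D u -> exists ut w K, regular u ut w K.
Proof.
move=> C4; have C3 := C_upto_pred C4; have C2 := C_upto_pred C3; have C1 := C_upto_pred C2.
have [K1 K10 H1] := C_upto_bounded C1.
have [K2 K20 H2] := C1_lipschitz len_gt0 T_gt0 None C1.
have [K3 K30 H3] := C2_second_difference len_gt0 T_gt0 None C2.
have [ut [_ H4' [K4 K40 H4]]] := C3_central_difference len_gt0 T_gt0 None C3.
have /choice[xK HxK] : forall k, exists wK : (V -> R) * R, [/\ 0 <= wK.2,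
   forall p, O p -> 'D_(ex k) ('D_(ex k) u) p = wK.1 p,
   forall p l, 0 <= l -> D p -> D (p + l *: ex k) -> `|u (p + l *: ex k) - u p| <= wK.2 * l,
   forall p l, 0 <= l -> D p -> D (p + l *: ex k) -> D (p - l *: ex k) ->
    `|u (p + l *: ex k) - 2 * u p + u (p - l *: ex k)| <= wK.2 * l ^+ 2 &
   [/\ forall p l, 0 <= l -> D p -> D (p + l *: ex k) -> D (p - l *: ex k) ->
    `|u (p + l *: ex k) - 2 * u p + u (p - l *: ex k) - l ^+ 2 * wK.1 p| <= wK.2 * l ^+ 4,
   forall p l, 0 <= l -> D p -> D (p + l *: et) ->
    `|wK.1 (p + l *: et) - wK.1 p| <= wK.2 * l &
   forall p l, 0 <= l -> D p -> D (p + l *: et) -> D (p - l *: et) ->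
    `|wK.1 (p + l *: et) - 2 * wK.1 p + wK.1 (p - l *: et)| <= wK.2 * l ^+ 2]].
  move=> k; have [a a0 Ha] := C1_lipschitz len_gt0 T_gt0 (Some k) C1.
  have [b b0 Hb] := C2_second_difference len_gt0 T_gt0 (Some k) C2.
  have [w [Cw Hw [c c0 Hc]]] := C4_second_derivative len_gt0 T_gt0 (Some k) C4.
  have [e e0 He] := C1_lipschitz len_gt0 T_gt0 None (C_upto_pred Cw).
  have [f f0 Hf] := C2_second_difference len_gt0 T_gt0 None Cw.
  exists (w, a + b + c + e + f) => /=.
  split; [lra| exact: Hw | | |split] => p l l0 *.
  - apply: (le_enlarge (K := a)) => //; [lra|exact: Ha].
  - apply: (le_enlarge (K := b)); [exact: exprn_ge0|lra|exact: Hb].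
  - apply: (le_enlarge (K := c)); [exact: exprn_ge0|lra|exact: Hc].
  - apply: (le_enlarge (K := e)) => //; [lra|exact: He].
  - apply: (le_enlarge (K := f)); [exact: exprn_ge0|lra|exact: Hf].
pose S := \sum_k (xK k).2.
have S0 : 0 <= S by rewrite sumr_ge0// => k _; case: (HxK k).
have SK k : (xK k).2 <= S.
  by rewrite /S (bigD1 k)//= lerDl sumr_ge0// => j _; case: (HxK j).
pose K := K1 + K2 + K3 + K4 + S.
have SK' k : (xK k).2 <= K by apply: le_trans (SK k) _; rewrite /K lerDr !addr_ge0.
exists ut, (fun k => (xK k).1), K; split.
- by rewrite !addr_ge0.
- by move=> p Dp; apply: le_trans (H1 p Dp) _; rewrite /K; lra.
- by move=> p l l0 *; apply: (le_enlarge (K := K2)) => //; [rewrite /K; lra|exact: H2].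
- by move=> p l l0 *; apply: (le_enlarge (K := K3)); [exact: exprn_ge0|rewrite /K; lra|exact: H3].
- by move=> p l l0 *; apply: (le_enlarge (K := K4)); [exact: exprn_ge0|rewrite /K; lra|exact: H4].
- by move=> k p l l0 *; case: (HxK k) => _ _ H _ _; apply: le_enlarge (SK' k) _ => //; exact: H.
- move=> k p l l0 *; case: (HxK k) => _ _ _ H _; apply: le_enlarge (SK' k) _ => //.
    exact: exprn_ge0.
  exact: H.
- move=> k p l l0 *; case: (HxK k) => _ _ _ _ [H _ _]; apply: le_enlarge (SK' k) _ => //.
    exact: exprn_ge0.
  exact: H.
- by move=> k p l l0 *; case: (HxK k) => _ _ _ _ [_ H _];
  apply: le_enlarge (SK' k) _ => //; exact: H.
- move=> k p l l0 *; case: (HxK k) => _ _ _ _ [_ _ H]; apply: le_enlarge (SK' k) _ => //.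
    exact: exprn_ge0.
  exact: H.
- by move=> p Op; have [_ ->] := H4' p Op.
- by move=> k p Op; case: (HxK k) => _ H _ _ _; exact: H.
Qed.

End Regularity.

Section GridGeometry.
Variables (R : realType) (d : nat) (len T : R) (M : nat).
Hypotheses (len_gt0 : 0 < len) (M_gt0 : (0 < M)%N).
Local Notation h := (mesh_h len M).
Local Notation D := (@Omega_T R d len T).
Implicit Types (k : grid_node d M) (x : 'rV[R]_d) (t s : R).

Lemma shift_t x t s : (x, t) + s *: st_dir R None = (x, t + s).
Proof. by congr (_, _); rewrite /= ?scaler0 ?addr0// [s *: _]mulr1. Qed.

Lemma shift_tN x t s : (x, t) - s *: st_dir R None = (x, t - s).
Proof. by rewrite -scaleNr shift_t. Qed.

Lemma shift_x i x t s : (x, t) + s *: st_dir R (Some i) = (x + s *: delta_mx 0 i, t).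
Proof. by congr (_, _); rewrite /= scaler0 addr0. Qed.

Lemma shift_xN i x t s : (x, t) - s *: st_dir R (Some i) = (x - s *: delta_mx 0 i, t).
Proof. by rewrite -scaleNr shift_x scaleNr. Qed.

Lemma mesh_hM : M%:R * h = len.
Proof. by rewrite mulrC divfK// pnatr_eq0 -lt0n. Qed.

Lemma grid_point_box k : Omega_box len (grid_point len k).
Proof.
have h0 := mesh_h_gt0 len_gt0 M_gt0.
move=> i; rewrite mxE mulr_ge0 ?(ltW h0)//= -[leRHS]mesh_hM.
by rewrite ler_pM2r// ler_nat -ltnS ltn_ord.
Qed.

Lemma grid_point_bdry k : ~~ interior_node k -> box_boundary len (grid_point len k).
Proof.
move=> /forallPn[i]; rewrite negb_and -!leqNgt => ki; split; first exact: grid_point_box.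
exists i; rewrite mxE; case/orP: ki => [|Mk].
  by rewrite leqn0 => /eqP ->; left; rewrite mul0r.
right; have -> : nat_of_ord (k i) = M; last exact: mesh_hM.
by apply/eqP; rewrite eqn_leq Mk -ltnS ltn_ord.
Qed.

Lemma grid_point_interior k i : interior_node k -> 0 < grid_point len k 0 i < len.
Proof.
have h0 := mesh_h_gt0 len_gt0 M_gt0.
move=> /forallP/(_ i)/andP[k0 kM]; rewrite mxE mulr_gt0 ?ltr0n//= -[ltRHS]mesh_hM.
by rewrite ltr_pM2r// ltr_nat.
Qed.

Lemma grid_point_up k i : interior_node k ->
  grid_point len (node_up k i) = grid_point len k + h *: delta_mx 0 i.
Proof.
move=> /forallP ki; apply/rowP => j; rewrite !mxE eqxx /= ffunE.
have [->|/negPf ji] := eqVneq j i; last by rewrite mulr0 addr0.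
rewrite inordK; last by case/andP: (ki i).
by rewrite mulr1 -natr1 mulrDl mul1r.
Qed.

Lemma grid_point_down k i : interior_node k ->
  grid_point len (node_down k i) = grid_point len k - h *: delta_mx 0 i.
Proof.
move=> /forallP ki; apply/rowP => j; rewrite !mxE eqxx /= ffunE.
have [->|/negPf ji] := eqVneq j i; last by rewrite mulr0 subr0.
have /andP[k0 kM] := ki i.
rewrite inordK; last by rewrite (leq_ltn_trans (leq_pred _))// ltn_ord.
rewrite mulr1 -{2}(prednK k0) -natr1 mulrDl mul1r; ring.
Qed.

End GridGeometry.

Lemma norm_sum_le (R : realType) n (F : 'I_n -> R) (K : R) :
  (forall i, `|F i| <= K) -> `|\sum_i F i| <= n%:R * K.
Proof.
move=> H; rewrite mulr_natl -[X in _ *+ X]card_ord -sumr_const.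
by apply: le_trans (ler_norm_sum _ _ _) _; exact: ler_sum.
Qed.
Section Consistency.
Variables (R : realType) (d : nat) (m : model R) (len T : R)
  (Q0 : 'rV[R]_d -> 'M[R]_d) (Qe : 'rV[R]_d * R -> 'M[R]_d).
Hypotheses (len_gt0 : 0 < len) (T_gt0 : 0 < T) (L_gt0 : 0 < elL m)
  (flow : Qtensor_flow m len T Q0 Qe) (smooth : smooth_solution len T 4 Qe).
Local Notation D := (@Omega_T R d len T).
Local Notation O := (@open_cyl R d len T).
Local Notation L := (elL m).

Definition Qgrid M (t : R) : gtensor R d M := restrict_h len (fun x => Qe (x, t)).
Arguments Qgrid : clear implicits.

Lemma Qgrid_in_S_h M t : (0 < M)%N -> 0 <= t <= T -> in_S_h (Qgrid M t).
Proof.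
move=> M0 tT; have [H1 _ H3 _] := flow; split => k.
  by apply: H1; split=> //; exact: grid_point_box.
by move=> kb; apply: H3 => //; exact: grid_point_bdry.
Qed.

Lemma regular_tensor : exists ut w (K : R), 0 <= K /\
  forall i j, regular len T (fun p => Qe p i j) (ut i j) (w i j) K.
Proof.
have /choice[c Hc] : forall ij : 'I_d * 'I_d, exists c : (_ * _) * R,
    regular len T (fun p => Qe p ij.1 ij.2) c.1.1 c.1.2 c.2.
  move=> [i j]; have [ut [w [K H]]] := C4_regular len_gt0 T_gt0 (smooth i j).
  by exists (ut, w, K).
exists (fun i j => (c (i, j)).1.1), (fun i j => (c (i, j)).1.2), (\sum_ij (c ij).2).
have c0 ij : 0 <= (c ij).2 by case: (Hc ij).
split; first by rewrite sumr_ge0.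
move=> i j; apply: regular_le (Hc (i, j)).
by rewrite (bigD1 (i, j))//= lerDl sumr_ge0.
Qed.

(** The consistency estimates used by the error analysis; the constant does not
    depend on the mesh. *)
Record consistent (K : R) : Prop := Consistent {
  cons_K : 0 <= K;
  cons_bound : forall p, D p -> frob (Qe p) <= K;
  cons_t_lip : forall M (k : grid_node d M) t th, (0 < M)%N -> 0 <= t -> 0 <= th ->
    t + th <= T -> frob (Qgrid M (t + th) k - Qgrid M t k) <= K * th;
  cons_t_diff2 : forall M (k : grid_node d M) t th, (0 < M)%N -> 0 <= t -> 0 <= th ->
    t + th <= T -> frob (Qgrid M (t + th) k - 2 *: Qgrid M (t + th / 2) k
      + Qgrid M t k) <= K * th ^+ 2;
  cons_x_lip : forall p i l, 0 <= l -> D p -> D (p + l *: st_dir R (Some i)) ->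
    frob (Qe (p + l *: st_dir R (Some i)) - Qe p) <= K * l;
  cons_x_diff2 : forall p i l, 0 <= l -> D p -> D (p + l *: st_dir R (Some i)) ->
    D (p - l *: st_dir R (Some i)) ->
    frob (Qe (p + l *: st_dir R (Some i)) - 2 *: Qe p + Qe (p - l *: st_dir R (Some i)))
    <= K * l ^+ 2;
  cons_euler : forall M (k : grid_node d M) t th, (0 < M)%N -> 0 <= t -> 0 < th ->
    t + th <= T -> interior_node k ->
    frob (th^-1 *: (Qgrid M (t + th) k - Qgrid M t k) - L *: tlap len (Qgrid M (t + th)) k
          - f_bulk m (Qgrid M t k)) <= K * (th + mesh_h len M ^+ 2);
  cons_midpoint : forall M (k : grid_node d M) t th, (0 < M)%N -> 0 <= t -> 0 < th ->
    t + th <= T -> interior_node k ->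
    frob (th^-1 *: (Qgrid M (t + th) k - Qgrid M t k)
          - (L / 2) *: tlap len (Qgrid M (t + th) + Qgrid M t) k
          - f_bulk m (Qgrid M (t + th / 2) k)) <= K * (th ^+ 2 + mesh_h len M ^+ 2) }.

Section ScalarTruncation.
Variables (i j : 'I_d) (ut : 'rV[R]_d * R -> R) (w : 'I_d -> 'rV[R]_d * R -> R) (K : R).
Let u p := Qe p i j.
Hypothesis Hu : regular len T u ut w K.
Variables (M : nat) (k : grid_node d M).
Hypotheses (M_gt0 : (0 < M)%N) (ki : interior_node k).
Local Notation x := (grid_point len k).
Local Notation h := (mesh_h len M).
Let K0 : 0 <= K := reg_K Hu.
Let h_gt0 : 0 < h := mesh_h_gt0 len_gt0 M_gt0.

Lemma Dgrid (k' : grid_node d M) t : 0 <= t <= T -> D (grid_point len k', t).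
Proof. by split=> //; exact: grid_point_box. Qed.

Lemma lap_truncation t : 0 <= t <= T ->
  `|lap_h len (entry_h (Qgrid M t) i j) k - \sum_l w l (x, t)| <= d%:R * K * h ^+ 2.
Proof.
move=> tT; rewrite /lap_h ki mulr_suml -sumrB.
rewrite -[leRHS]mulrA; apply: norm_sum_le => l.
have h2 : 0 < h ^+ 2 by rewrite exprn_gt0.
have := reg_x_second Hu (k := l) (ltW h_gt0) (Dgrid k tT).
rewrite shift_x shift_xN -grid_point_up// -grid_point_down// => /(_ (Dgrid _ tT) (Dgrid _ tT)).
rewrite /entry_h /Qgrid /restrict_h -/(u _) => H.
rewrite -[Qe (_, t) i j]/(u _).
set X := u _ - _ + _ in H *.
have -> : X / h ^+ 2 - w l (x, t) = (X - h ^+ 2 * w l (x, t)) / h ^+ 2.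
  by rewrite mulrBl mulrAC mulfV ?mul1r// gt_eqF.
rewrite normrM [ `|_^-1|]gtr0_norm ?invr_gt0// ler_pdivrMr//.
by apply: le_trans H _; rewrite -mulrA -exprD.
Qed.

(** The equation is only assumed in the open cylinder; the centre of a time step
    always lies there, even for steps that touch t = 0 or t = T. *)
Lemma pde_mid t : 0 < t < T -> ut (x, t) = L * \sum_l w l (x, t) + f_bulk m (Qe (x, t)) i j.
Proof.
move=> tT; have Ox : O (x, t).
  by split=> [l|] //; exact: grid_point_interior.
have [_ pde _ _] := flow.
rewrite -(reg_ut Hu Ox) (pde _ (open_cyl_interior Ox)) /Laplacian.
by congr (_ * _ + _); apply: eq_bigr => l _; rewrite -(reg_w Hu l Ox).
Qed.

Lemma dt_truncation t th : 0 <= t -> 0 < th -> t + th <= T ->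
  `|th^-1 * (u (x, t + th) - u (x, t)) - L * \sum_l w l (x, t + th / 2)
    - f_bulk m (Qe (x, t + th / 2)) i j| <= K * th ^+ 2.
Proof.
move=> t0 th0 tT; set tm := t + th / 2.
have tmT : 0 < tm < T by rewrite /tm; apply/andP; split; lra.
have /andP[tm0 tm1] := tmT.
have -> : th^-1 * (u (x, t + th) - u (x, t)) - L * \sum_l w l (x, tm)
   - f_bulk m (Qe (x, tm)) i j = th^-1 * (u (x, t + th) - u (x, t) - th * ut (x, tm)).
  by rewrite pde_mid//; field; rewrite gt_eqF.
have th2 : 0 <= th / 2 by rewrite divr_ge0// ltW.
have := reg_t_central Hu th2 (p := (x, tm)); rewrite shift_t shift_tN.
have -> : tm + th / 2 = t + th by rewrite /tm; field.
have -> : tm - th / 2 = t by rewrite /tm; field.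
have -> : 2 * (th / 2) = th by field.
move=> H; rewrite normrM gtr0_norm ?invr_gt0// mulrC ler_pdivrMr//.
apply: le_trans (H _ _ _) _.
- by apply: Dgrid; rewrite !ltW.
- by apply: Dgrid; apply/andP; split; lra.
- by apply: Dgrid; apply/andP; split; lra.
rewrite -mulrA ler_wpM2l// -exprSr.
by rewrite lerXn2r ?nnegrE ?(ltW th0)// ler_pdivrMr// ler_peMr ?(ltW th0)// ler1n.
Qed.

Lemma w_mid_mean t th : 0 <= t -> 0 < th -> t + th <= T ->
  `|\sum_l w l (x, t + th / 2) - (\sum_l w l (x, t + th) + \sum_l w l (x, t)) / 2|
  <= d%:R * K * th ^+ 2.
Proof.
move=> t0 th0 tT; rewrite -big_split mulr_suml -sumrB /=.
rewrite -[leRHS]mulrA; apply: norm_sum_le => l.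
have th2 : 0 <= th / 2 by rewrite divr_ge0// ltW.
have := reg_w_diff2 Hu l th2 (p := (x, t + th / 2)); rewrite shift_t shift_tN.
have -> : t + th / 2 + th / 2 = t + th by field.
have -> : t + th / 2 - th / 2 = t by field.
move=> H; have {H} := H _ _ _.
set a := w l (x, t + th); set b := w l (x, t + th / 2); set c := w l (x, t) => H.
have -> : b - (a + c) / 2 = - ((a - 2 * b + c) / 2) by field.
rewrite normrN normrM [ `|2^-1|]gtr0_norm ?invr_gt0//.
have H' : `|a - 2 * b + c| <= K * (th / 2) ^+ 2.
  by apply: H; apply: Dgrid; apply/andP; split; lra.
have := mulr_ge0 K0 (sqr_ge0 th).
have : K * (th / 2) ^+ 2 = K * th ^+ 2 / 4 by field.
lra.
Qed.

Lemma w_mid_end t th : 0 <= t -> 0 < th -> t + th <= T ->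
  `|\sum_l w l (x, t + th / 2) - \sum_l w l (x, t + th)| <= d%:R * K * th.
Proof.
move=> t0 th0 tT; rewrite -sumrB /=.
rewrite -[leRHS]mulrA; apply: norm_sum_le => l; rewrite distrC.
have th2 : 0 <= th / 2 by rewrite divr_ge0// ltW.
have := reg_w_lip Hu l th2 (p := (x, t + th / 2)); rewrite shift_t.
have -> : t + th / 2 + th / 2 = t + th by field.
move=> H; apply: le_trans (H _ _) _.
- by apply: Dgrid; apply/andP; split; lra.
- by apply: Dgrid; apply/andP; split; lra.
rewrite ler_wpM2l//; lra.
Qed.

(** The equation is used at the midpoint of the step, where the reaction is taken;
    moving the Laplacian from there to t + th costs one order in time. *)
Lemma euler_truncation t th : 0 <= t -> 0 < th -> t + th <= T ->
  `|th^-1 * (u (x, t + th) - u (x, t)) - L * lap_h len (entry_h (Qgrid M (t + th)) i j) k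
    - f_bulk m (Qe (x, t + th / 2)) i j|
  <= (T + L * d%:R) * K * (th + h ^+ 2).
Proof.
move=> t0 th0 tT.
have H1 := dt_truncation t0 th0 tT; have H2 := w_mid_end t0 th0 tT.
have tT' : 0 <= t + th <= T by apply/andP; split; lra.
have H3 := lap_truncation tT'.
move: H1 H2 H3; set A := th^-1 * _; set W := \sum_l w l (x, t + th / 2).
set W1 := \sum_l w l (x, t + th); set Lp := lap_h _ _ _; set F := f_bulk m _ i j.
move=> H1 H2 H3.
have -> : A - L * Lp - F = (A - L * W - F) + L * (W - W1) - L * (Lp - W1) by ring.
apply: le_trans (ler_normB _ _) _; apply: le_trans (lerD (ler_normD _ _) (lexx _)) _.
rewrite !normrM (gtr0_norm L_gt0).
have := ler_wpM2l (ltW L_gt0) H2; have := ler_wpM2l (ltW L_gt0) H3.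
have h2 := sqr_ge0 h.
have a1 : K * th ^+ 2 <= K * (T * th).
  by rewrite ler_wpM2l// expr2 ler_wpM2r// ?(ltW th0)//; lra.
have a2 : 0 <= T * K * h ^+ 2 by rewrite !mulr_ge0// ltW.
lra.
Qed.

(** Averaging the Laplacian over the two ends agrees with its midpoint value to
    second order. *)
Lemma midpoint_truncation t th : 0 <= t -> 0 < th -> t + th <= T ->
  `|th^-1 * (u (x, t + th) - u (x, t))
    - L / 2 * (lap_h len (entry_h (Qgrid M (t + th)) i j) k
       + lap_h len (entry_h (Qgrid M t) i j) k)
    - f_bulk m (Qe (x, t + th / 2)) i j|
  <= (1 + L * d%:R) * K * (th ^+ 2 + h ^+ 2).
Proof.
move=> t0 th0 tT.
have H1 := dt_truncation t0 th0 tT; have H2 := w_mid_mean t0 th0 tT.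
have tT' : 0 <= t + th <= T by apply/andP; split; lra.
have tT'' : 0 <= t <= T by apply/andP; split; lra.
have H3 := lap_truncation tT'; have H4 := lap_truncation tT''.
move: H1 H2 H3 H4; set A := th^-1 * _; set W := \sum_l w l (x, t + th / 2).
set W1 := \sum_l w l (x, t + th); set Lp := lap_h _ _ _; set F := f_bulk m _ i j.
set W0 := \sum_l w l (x, t); set Lp0 := lap_h _ _ _.
move=> H1 H2 H3 H4.
have -> : A - L / 2 * (Lp + Lp0) - F = (A - L * W - F) + L * (W - (W1 + W0) / 2)
   - L / 2 * ((Lp - W1) + (Lp0 - W0)) by field.
apply: le_trans (ler_normB _ _) _; apply: le_trans (lerD (ler_normD _ _) (lexx _)) _.
rewrite !normrM (gtr0_norm L_gt0) [ `|2^-1|]gtr0_norm ?invr_gt0//.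
have := ler_wpM2l (ltW L_gt0) H2; have := ler_wpM2l (ltW L_gt0) H3.
have := ler_wpM2l (ltW L_gt0) H4.
have := ler_wpM2l (ltW L_gt0) (ler_normD (Lp - W1) (Lp0 - W0)).
have a2 := mulr_ge0 K0 (sqr_ge0 h).
lra.
Qed.

End ScalarTruncation.

Lemma exact_consistent : exists K, consistent K.
Proof.
have [ut [w [K [K0 Hu]]]] := regular_tensor.
have dK0 : 0 <= d%:R * K by rewrite mulr_ge0.
have bound p : D p -> frob (Qe p) <= d%:R * K.
  by move=> Dp; apply: frob_le_entries => i j; exact: (reg_bound (Hu i j) Dp).
have [Cf Cf0 HCf] := f_bulk_lip d m dK0.
have tlip M (k : grid_node d M) t th : (0 < M)%N -> 0 <= t -> 0 <= th -> t + th <= T ->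
    frob (Qgrid M (t + th) k - Qgrid M t k) <= d%:R * (K * th).
  move=> M0 t0 th0 tT; apply: frob_le_entries => i j; rewrite !mxE.
  have := reg_t_lip (Hu i j) th0 (p := (grid_point len k, t)); rewrite shift_t; apply.
  - by apply: Dgrid => //; apply/andP; split; lra.
  - by apply: Dgrid => //; apply/andP; split; lra.
have [T0 L0] := (ltW T_gt0, ltW L_gt0).
have a0 : 0 <= d%:R * ((T + L * d%:R) * K) by rewrite !mulr_ge0// addr_ge0// mulr_ge0.
have b0 : 0 <= d%:R * ((1 + L * d%:R) * K) by rewrite !mulr_ge0// addr_ge0// mulr_ge0.
have c0 : 0 <= Cf * (d%:R * K) by rewrite mulr_ge0.
pose K' := d%:R * K + d%:R * ((T + L * d%:R) * K) + d%:R * ((1 + L * d%:R) * K)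
   + Cf * (d%:R * K).
have dKK' : d%:R * K <= K' by rewrite /K'; lra.
have bump (y X : R) : 0 <= y -> X <= d%:R * (K * y) -> X <= K' * y.
  by move=> y0 H; apply: le_trans H _; rewrite mulrA ler_wpM2r.
exists K'; split.
- exact: le_trans dKK'.
- by move=> p Dp; apply: le_trans (bound p Dp) _.
- by move=> M k t th M0 t0 th0 tT; apply: bump => //; exact: tlip.
- move=> M k t th M0 t0 th0 tT; apply: bump; first exact: sqr_ge0.
  apply: frob_le_entries => i j; rewrite !mxE.
  have th2 : 0 <= th / 2 by rewrite divr_ge0.
  have := reg_t_diff2 (Hu i j) th2 (p := (grid_point len k, t + th / 2)).
  rewrite shift_t shift_tN.
  have -> : t + th / 2 + th / 2 = t + th by field.
  have -> : t + th / 2 - th / 2 = t by field.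
  move=> H; apply: le_trans (H _ _ _) _.
  + by apply: Dgrid => //; apply/andP; split; lra.
  + by apply: Dgrid => //; apply/andP; split; lra.
  + by apply: Dgrid => //; apply/andP; split; lra.
  rewrite ler_wpM2l// lerXn2r ?nnegrE//; lra.
- move=> p i l l0 Dp Dq; apply: bump => //; apply: frob_le_entries => a b.
  by rewrite !mxE; exact: (reg_x_lip (Hu a b)).
- move=> p i l l0 Dp Dq Dr; apply: bump; first exact: sqr_ge0.
  apply: frob_le_entries => a b.
  by rewrite !mxE; exact: (reg_x_diff2 (Hu a b)).
- move=> M k t th M0 t0 th0 tT ki.
  have h2 : 0 <= mesh_h len M ^+ 2 by exact: sqr_ge0.
  set X := _ *: _ - _.
  have tm : t + th / 2 <= T by lra.
  have H1 : frob (X - f_bulk m (Qgrid M (t + th / 2) k)) <=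
     d%:R * ((T + L * d%:R) * K * (th + mesh_h len M ^+ 2)).
    apply: frob_le_entries => i j.
    have := euler_truncation (Hu i j) M0 ki t0 th0 tT.
    by rewrite /X !mxE.
  have H2 : frob (f_bulk m (Qgrid M (t + th / 2) k) - f_bulk m (Qgrid M t k))
     <= Cf * (d%:R * (K * (th / 2))).
    have g1 : frob (Qgrid M (t + th / 2) k) <= d%:R * K.
      by apply: bound; apply: Dgrid => //; apply/andP; split; lra.
    have g2 : frob (Qgrid M t k) <= d%:R * K.
      by apply: bound; apply: Dgrid => //; apply/andP; split; lra.
    apply: le_trans (HCf _ _ g1 g2).2 _; rewrite ler_wpM2l//.
    by apply: tlip => //; rewrite ?divr_ge0// ltW.
  have -> : X - f_bulk m (Qgrid M t k) = (X - f_bulk m (Qgrid M (t + th / 2) k))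
    + (f_bulk m (Qgrid M (t + th / 2) k) - f_bulk m (Qgrid M t k)).
    by rewrite addrA subrK.
  apply: le_trans (frobD _ _) _; apply: le_trans (lerD H1 H2) _.
  have e1 : 0 <= th + mesh_h len M ^+ 2 by rewrite addr_ge0// ltW.
  have e2 := mulr_ge0 dK0 e1; have e3 := mulr_ge0 b0 e1.
  have e4 := mulr_ge0 c0 h2; have e5 := mulr_ge0 c0 (ltW th0).
  rewrite /K'; lra.
- move=> M k t th M0 t0 th0 tT ki.
  have h2 : 0 <= mesh_h len M ^+ 2 by exact: sqr_ge0.
  have -> : tlap len (Qgrid M (t + th) + Qgrid M t) k =
    tlap len (Qgrid M (t + th)) k + tlap len (Qgrid M t) k by rewrite tlapD.
  apply: (@le_trans _ _ (d%:R * ((1 + L * d%:R) * K * (th ^+ 2 + mesh_h len M ^+ 2)))).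
    apply: frob_le_entries => i j.
    have := midpoint_truncation (Hu i j) M0 ki t0 th0 tT.
    by rewrite !mxE.
  have e1 : 0 <= th ^+ 2 + mesh_h len M ^+ 2 by rewrite addr_ge0// sqr_ge0.
  have e2 := mulr_ge0 dK0 e1; have e3 := mulr_ge0 a0 e1; have e4 := mulr_ge0 c0 e1.
  rewrite /K'; lra.
Qed.

End Consistency.

(** * Quadrature on the box *)
Section Trapezoid.
Variables (R : realType) (len : R).
Hypothesis len_gt0 : 0 < len.
Implicit Types (phi : R -> R) (A K : R).

(** Freezing a function outside the interval makes a function that is Lipschitz on
    the interval continuous on the whole line. *)
Definition clamp (y : R) : R := Num.max 0 (Num.min y len).

Lemma clamp_in y : 0 <= clamp y <= len.
Proof. by rewrite /clamp le_max lexx /= ge_max ge_min lexx orbT andbT ltW. Qed.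

Lemma clamp_id y : 0 <= y <= len -> clamp y = y.
Proof. by move=> /andP[y0 yl]; rewrite /clamp min_l// max_r. Qed.

Lemma clamp_dist x y : `|clamp x - clamp y| <= `|x - y|.
Proof.
have h := ltW len_gt0; rewrite ler_norml /clamp.
have a1 := ler_norm (x - y); have a2 := ler_norm (- (x - y)); rewrite normrN in a2.
by case: (leP x len) => ?; case: (leP y len) => ?; rewrite ?(max_r h);
  (try case: (leP 0 x) => ?); (try case: (leP 0 y) => ?); apply/andP; split; lra.
Qed.

Definition lip_interval phi A :=
  forall x y, 0 <= x <= len -> 0 <= y <= len -> `|phi x - phi y| <= A * `|x - y|.

Lemma lip_clamp_continuous phi A : lip_interval phi A -> continuous (phi \o clamp).
Proof.
move=> H x; apply/cvgrPdist_le => e e0.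
have A1 : 0 < `|A| + 1 by rewrite ltr_wpDl.
near=> y.
have d : `|x - y| <= e / (`|A| + 1).
  by near: y; apply: cvgr_dist_le; [exact: cvg_id|rewrite divr_gt0].
apply: le_trans (H _ _ (clamp_in x) (clamp_in y)) _.
move: d; rewrite ler_pdivlMr// => d.
apply: le_trans d; apply: le_trans (ler_wpM2r (normr_ge0 _) (ler_norm A)) _.
rewrite mulrC ler_pM ?clamp_dist//; lra.
Unshelve. all: by end_near. Qed.

Lemma lip_integrable phi A : lip_interval phi A ->
  lebesgue_measure.-integrable `[0, len] (EFin \o phi).
Proof.
move=> H.
have H1 : lebesgue_measure.-integrable `[0, len] (EFin \o (phi \o clamp)).
  apply: continuous_compact_integrable; first exact: segment_compact.
  by apply: continuous_subspaceT => x; exact: (lip_clamp_continuous H).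
apply: eq_integrable H1 => //.
by move=> x; rewrite inE /= in_itv /= => /clamp_id ->.
Qed.

(** The composite trapezoidal rule, for integrands that need not be
    differentiable: a bound on symmetric second differences is enough, because
    integration symmetrizes each cell around its midpoint. *)
Lemma trapezoid_rule phi A K M : (0 < M)%N -> lip_interval phi A ->
  (forall x s, 0 <= s -> 0 <= x - s -> x + s <= len ->
     `|phi (x + s) - 2 * phi x + phi (x - s)| <= K * s ^+ 2) ->
  phi 0 = 0 -> phi len = 0 ->
  `|\int[lebesgue_measure]_(y in `[0, len]) phi y
    - mesh_h len M * \sum_(j < M.+1) phi (j%:R * mesh_h len M)|
  <= K * len * mesh_h len M ^+ 2.
Proof.
move=> M0 Hl H2 p0 pl; set h := mesh_h len M.
have h0 : 0 < h by exact: mesh_h_gt0.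
have hM : M%:R * h = len by exact: mesh_hM.
pose psi := phi \o clamp.
have cpsi : continuous psi := lip_clamp_continuous Hl.
have ipsi (a b : R) : lebesgue_measure.-integrable `[a, b] (EFin \o psi).
  apply: continuous_compact_integrable; first exact: segment_compact.
  by apply: continuous_subspaceT => x; exact: cpsi.
(* Starting at -1 makes the end point 0 an interior point for the primitive. *)
pose P x := \int[lebesgue_measure]_(t in `[-1, x]) psi t.
have dP x : 0 <= x <= len -> is_derive x 1 P (phi x).
  move=> xl; have /andP[x0 x1] := xl.
  have [|||| dx ex] := @continuous_FTC1_closed R psi (-1) x (len + 1).
  - lra.
  - exact: ipsi.
  - lra.
  - exact: cpsi.
  by apply: DeriveDef => //; rewrite -derive1E ex /psi /= clamp_id.
have PE : \int[lebesgue_measure]_(y in `[0, len]) phi y = P len - P 0.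
  rewrite /P Rintegral_itvB//; last 2 first.
  - by rewrite bnd_simp; lra.
  - by rewrite bnd_simp ltW.
  rewrite Rintegral_itv_obnd_cbnd; last first.
    by apply: integrableS (ipsi 0 len) => //; exact: subset_itv_oc_cc.
  apply: eq_Rintegral => x; rewrite inE /= in_itv /= => xl.
  by rewrite /psi /= clamp_id.
have node (j : nat) : (j <= M)%N -> 0 <= j%:R * h <= len.
  by move=> jM; rewrite mulr_ge0 ?(ltW h0)//= -hM ler_pM2r// ler_nat.
have cell (j : nat) : (j < M)%N ->
  `|P (j.+1%:R * h) - P (j%:R * h) - h * ((phi (j%:R * h) + phi (j.+1%:R * h)) / 2)|
    <= K * h ^+ 3 / 4.
  move=> jM; have /andP[n0 _] := node j (ltnW jM); have /andP[_ n1] := node _ jM.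
  pose c := j%:R * h + h / 2; pose dl := h / 2.
  have d0 : 0 <= dl by rewrite divr_ge0// ltW.
  have e1 : j.+1%:R * h = c + dl by rewrite -natr1 /c /dl; field.
  have e0 : j%:R * h = c - dl by rewrite /c /dl; ring.
  rewrite e1 in n1; rewrite e0 in n0; rewrite e1 e0.
  have Ph : `|P (c + dl) - P (c - dl) - 2 * dl * phi c| <= K * dl ^+ 3.
    apply: (@mvt_power _ (fun s => P (c + s) - P (c - s) - 2 * s * phi c)
      (fun s => phi (c + s) - 2 * phi c + phi (c - s)) dl K 2) => //.
    - by rewrite subr0 addr0; ring.
    - move=> s /andP[s0 s1].
      have q1 : is_derive (c + s) 1 P (phi (c + s)) by apply: dP; apply/andP; split; lra.
      have q2 : is_derive (c - s) 1 P (phi (c - s)) by apply: dP; apply/andP; split; lra.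
      have q3 : is_derive s 1 (fun x => c + x) 1 by apply: is_derive_eq; ring.
      have q4 : is_derive s 1 (fun x => c - x) (-1) by apply: is_derive_eq; ring.
      have q5 := @is_derive1_comp _ P (fun x => c + x) s _ _ q1 q3.
      have q6 := @is_derive1_comp _ P (fun x => c - x) s _ _ q2 q4.
      rewrite /comp in q5 q6.
      by apply: is_derive_eq; rewrite /GRing.scale /=; ring.
    - by move=> s /andP[s0 s1]; apply: H2 => //; lra.
  have tr : `|phi (c + dl) - 2 * phi c + phi (c - dl)| <= K * dl ^+ 2 by apply: H2.
  have hd : h = 2 * dl by rewrite /dl; field.
  have -> : P (c + dl) - P (c - dl) - h * ((phi (c - dl) + phi (c + dl)) / 2) =
    (P (c + dl) - P (c - dl) - 2 * dl * phi c)
    - dl * (phi (c + dl) - 2 * phi c + phi (c - dl)) by rewrite hd; field.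
  apply: le_trans (ler_normB _ _) _; rewrite [ `|dl * _|]normrM (ger0_norm d0).
  have := ler_wpM2l d0 tr.
  have -> : K * h ^+ 3 / 4 = 2 * (K * dl ^+ 3) by rewrite hd; field.
  have -> : dl * (K * dl ^+ 2) = K * dl ^+ 3 by ring.
  lra.
have sumE : h * \sum_(j < M.+1) phi (j%:R * h) =
   \sum_(j < M) h * ((phi (j%:R * h) + phi (j.+1%:R * h)) / 2).
  rewrite -mulr_sumr; congr (_ * _); rewrite -mulr_suml big_split /=.
  have s1 : \sum_(j < M.+1) phi (j%:R * h) = \sum_(j < M) phi (j%:R * h).
    by rewrite big_ord_recr /= hM pl addr0.
  have s2 : \sum_(j < M.+1) phi (j%:R * h) = \sum_(j < M) phi (j.+1%:R * h).
    by rewrite big_ord_recl /= mul0r p0 add0r.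
  by rewrite -s1 -s2; field.
have telE : P len - P 0 = \sum_(j < M) (P (j.+1%:R * h) - P (j%:R * h)).
  rewrite -(big_mkord xpredT (fun j => P (j.+1%:R * h) - P (j%:R * h))).
  by rewrite (telescope_sumr (fun j => P (j%:R * h)))// hM mul0r.
rewrite PE sumE telE -sumrB; apply: le_trans (ler_norm_sum _ _ _) _.
apply: (@le_trans _ _ (\sum_(j < M) K * h ^+ 3 / 4)).
  by apply: ler_sum => j _; exact: cell.
rewrite sumr_const card_ord -(mulr_natl (K * _ / _)).
have K0 : 0 <= K * h ^+ 3 / 4 by apply: le_trans (normr_ge0 _) (cell 0%N M0).
have -> : M%:R * (K * h ^+ 3 / 4) = K * (M%:R * h) * h ^+ 2 / 4 by ring.
rewrite hM; have : 0 <= K * len * h ^+ 2.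
  have := mulr_ge0 (ler0n _ M) K0; rewrite -hM; lra.
lra.
Qed.

End Trapezoid.

Section BoxQuadrature.
Variables (R : realType) (len : R).
Hypothesis len_gt0 : 0 < len.
Let len_ge0 : 0 <= len := ltW len_gt0.

Definition slice n (y : R) (F : 'rV[R]_n.+1 -> R) : 'rV[R]_n -> R :=
  fun v => F (row_mx (y%:M : 'rV[R]_1) v).

(** Only shifts along a coordinate are compared, so that a slice of a function
    inherits the property. *)
Definition coord_lip n (F : 'rV[R]_n -> R) (K : R) := forall x i l, 0 <= l -> Omega_box len x ->
  Omega_box len (x + l *: delta_mx 0 i) -> `|F (x + l *: delta_mx 0 i) - F x| <= K * l.

Lemma row_mxE0 n y (v : 'rV[R]_n) : (row_mx (y%:M : 'rV[R]_1) v : 'rV[R]_n.+1) 0 ord0 = y.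
Proof.
have -> : ord0 = lshift n (ord0 : 'I_1) by exact: val_inj.
by apply: (etrans (@row_mxEl R 1 1 n _ _ _ _)); rewrite mxE eqxx.
Qed.

Lemma row_mxE_lift n y (v : 'rV[R]_n) i :
  (row_mx (y%:M : 'rV[R]_1) v : 'rV[R]_n.+1) 0 (lift ord0 i) = v 0 i.
Proof.
have -> : lift ord0 i = rshift 1 i by exact: val_inj.
exact: (@row_mxEr R 1 1 n).
Qed.

Lemma row_mx_shift0 n y l (v : 'rV[R]_n) :
  row_mx ((y + l)%:M : 'rV[R]_1) v = row_mx (y%:M : 'rV[R]_1) v + l *: delta_mx 0 ord0
  :> 'rV[R]_n.+1.
Proof.
apply/rowP => j; case: (unliftP ord0 j) => [i ->|->].
  by rewrite row_mxE_lift [RHS]mxE row_mxE_lift !mxE /= mulr0 addr0.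
by rewrite row_mxE0 [RHS]mxE row_mxE0 !mxE eqxx mulr1.
Qed.

Lemma row_mx_shift_lift n y l (v : 'rV[R]_n) i :
  row_mx (y%:M : 'rV[R]_1) (v + l *: delta_mx 0 i) =
  row_mx (y%:M : 'rV[R]_1) v + l *: delta_mx 0 (lift ord0 i) :> 'rV[R]_n.+1.
Proof.
apply/rowP => j; case: (unliftP ord0 j) => [k ->|->].
  by rewrite row_mxE_lift [RHS]mxE row_mxE_lift !mxE (inj_eq lift_inj).
by rewrite row_mxE0 [RHS]mxE row_mxE0 !mxE /= mulr0 addr0.
Qed.

Lemma row_mx_box n y (v : 'rV[R]_n) : 0 <= y <= len -> Omega_box len v ->
  Omega_box len (row_mx (y%:M : 'rV[R]_1) v : 'rV[R]_n.+1).
Proof.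
move=> yl vb j; case: (unliftP ord0 j) => [i ->|->]; first by rewrite row_mxE_lift.
by rewrite row_mxE0.
Qed.

Lemma slice_lip n y (F : 'rV[R]_n.+1 -> R) (K : R) : 0 <= y <= len -> coord_lip F K ->
  coord_lip (slice y F) K.
Proof.
move=> yl H x i l l0 xb xlb; rewrite /slice row_mx_shift_lift.
by apply: H => //; [exact: row_mx_box|rewrite -row_mx_shift_lift; exact: row_mx_box].
Qed.

Lemma coord_lip_lin n (F G : 'rV[R]_n -> R) (K K' a b : R) : coord_lip F K -> coord_lip G K' ->
  coord_lip (fun x => a * F x + b * G x) (`|a| * K + `|b| * K').
Proof.
move=> HF HG x i l l0 xb xlb; set x' := x + _.
have -> : a * F x' + b * G x' - (a * F x + b * G x) = a * (F x' - F x) + b * (G x' - G x).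
  by ring.
apply: le_trans (ler_normD _ _) _; rewrite !normrM mulrDl -!mulrA.
by rewrite lerD// ler_wpM2l//; [exact: HF|exact: HG].
Qed.

(** For Lipschitz integrands, linearity and the sup bound of the iterated integral
    have to be proved together: in dimension n they make the integrals of slices
    Lipschitz, hence integrable, which dimension n + 1 requires. *)
Definition linear_bounded n :=
  (forall (F G : 'rV[R]_n -> R) (K K' a b : R), coord_lip F K -> coord_lip G K' ->
    box_integral len (fun x => a * F x + b * G x)
    = a * box_integral len F + b * box_integral len G) /\
  (forall (F : 'rV[R]_n -> R) (K B : R), coord_lip F K ->
    (forall x, Omega_box len x -> `|F x| <= B) -> `|box_integral len F| <= B * len ^+ n).

Lemma slice_integral_lip n (F : 'rV[R]_n.+1 -> R) (K : R) : linear_bounded n ->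
  coord_lip F K -> lip_interval len (fun y => box_integral len (slice y F)) (K * len ^+ n).
Proof.
move=> [IHl IHb] HF.
have wlog_le x y : 0 <= x <= len -> 0 <= y <= len -> x <= y ->
   `|box_integral len (slice y F) - box_integral len (slice x F)| <= K * len ^+ n * (y - x).
  move=> xl yl xy.
  have -> : box_integral len (slice y F) - box_integral len (slice x F) =
    box_integral len (fun v => 1 * slice y F v + -1 * slice x F v).
    by rewrite (IHl _ _ K K) ?mul1r ?mulN1r//; exact: slice_lip.
  rewrite mulrAC.
  apply: (IHb _ (`|1| * K + `|-1| * K)).
    by apply: coord_lip_lin; exact: slice_lip.
  move=> v vb; rewrite mul1r mulN1r /slice.
  have -> : y = x + (y - x) by ring.
  rewrite row_mx_shift0 [x + _]addrC addrK.
  apply: HF; [by rewrite subr_ge0|exact: row_mx_box|].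
  by rewrite -row_mx_shift0 addrC subrK; exact: row_mx_box.
move=> x y xl yl; have [xy|/ltW yx] := leP x y.
  by rewrite distrC [ `|x - y|]distrC (ger0_norm (_ : 0 <= y - x)) ?subr_ge0// wlog_le.
by rewrite (ger0_norm (_ : 0 <= x - y)) ?subr_ge0// wlog_le.
Qed.

Lemma box_integral_linear_bounded n : linear_bounded n.
Proof.
elim: n => [|n IH].
  split=> // F K B _ H /=; rewrite expr0 mulr1; apply: H => -[].
  by move=> i; case.
have [IHl IHb] := IH.
split=> [F G K K' a b HF HG|F K B HF HB].
- have iF := lip_integrable len_gt0 (slice_integral_lip IH HF).
  have iG := lip_integrable len_gt0 (slice_integral_lip IH HG).
  rewrite /= -/(slice _).
  transitivity (\int[lebesgue_measure]_(y in `[0, len])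
     (a * box_integral len (slice y F) + b * box_integral len (slice y G))).
    apply: eq_Rintegral => y; rewrite inE /= in_itv /= => yl.
    by rewrite -(IHl _ _ K K')//; exact: slice_lip.
  rewrite RintegralD//; last 2 first.
  + exact: (integrableZl _ a iF).
  + exact: (integrableZl _ b iG).
  by rewrite !RintegralZl.
- have iF := lip_integrable len_gt0 (slice_integral_lip IH HF).
  rewrite /=; apply: le_trans (le_normr_Rintegral _ iF) _ => //.
  have sl y : 0 <= y <= len -> `|box_integral len (slice y F)| <= B * len ^+ n.
    move=> yl; apply: IHb (slice_lip yl HF) _ => v vb.
    by apply: HB; exact: row_mx_box.
  apply: (@le_trans _ _ (\int[lebesgue_measure]_(y in `[0, len]) (B * len ^+ n))).
    apply: le_Rintegral => //.
    + exact: (integrable_norm iF).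
    + apply: continuous_compact_integrable; first exact: segment_compact.
      by apply: continuous_subspaceT => x; exact: cvg_cst.
  have -> : \int[lebesgue_measure]_(y in `[0, len]) (B * len ^+ n) =
     B * len ^+ n * fine (lebesgue_measure `[0, len]) by exact: Rintegral_cst.
  by rewrite lebesgue_measure_itv /= lte_fin len_gt0 -EFinD /= subr0 -mulrA -exprSr.
Qed.

Lemma grid_sum_succ n M (F : 'rV[R]_n.+1 -> R) :
  \sum_(k : grid_node n.+1 M) F (grid_point len k) =
  \sum_(j < M.+1) \sum_(k : grid_node n M) slice (j%:R * mesh_h len M) F (grid_point len k).
Proof.
rewrite pair_big /=.
pose f (p : 'I_M.+1 * grid_node n M) : grid_node n.+1 M :=
  [ffun i => if unlift ord0 i is Some i' then p.2 i' else p.1].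
pose g (k : grid_node n.+1 M) : 'I_M.+1 * grid_node n M :=
  (k ord0, [ffun i => k (lift ord0 i)]).
have fK : cancel f g.
  move=> [j k]; rewrite /g /f ffunE unlift_none; congr (_, _).
  by apply/ffunP => i; rewrite !ffunE liftK.
have gK : cancel g f.
  move=> k; apply/ffunP => i; rewrite ffunE /=.
  by case: (unliftP ord0 i) => [i' ->|->]; rewrite ?ffunE.
rewrite (reindex f); last by exists g => ? _; [exact: fK|exact: gK].
apply: eq_bigr => -[j k] _; congr F; apply/rowP => i.
case: (unliftP ord0 i) => [i' ->|->].
  by rewrite row_mxE_lift !mxE ffunE liftK.
by rewrite row_mxE0 !mxE ffunE unlift_none.
Qed.

Definition coord_diff2 n (F : 'rV[R]_n -> R) K := forall x i l, 0 <= l -> Omega_box len x ->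
  Omega_box len (x + l *: delta_mx 0 i) -> Omega_box len (x - l *: delta_mx 0 i) ->
  `|F (x + l *: delta_mx 0 i) - 2 * F x + F (x - l *: delta_mx 0 i)| <= K * l ^+ 2.

Lemma row_mx_shift0N n y l (v : 'rV[R]_n) :
  row_mx ((y - l)%:M : 'rV[R]_1) v = row_mx (y%:M : 'rV[R]_1) v - l *: delta_mx 0 ord0
  :> 'rV[R]_n.+1.
Proof. by rewrite row_mx_shift0 scaleNr. Qed.

Lemma row_mx_shift_liftN n y l (v : 'rV[R]_n) i :
  row_mx (y%:M : 'rV[R]_1) (v - l *: delta_mx 0 i) =
  row_mx (y%:M : 'rV[R]_1) v - l *: delta_mx 0 (lift ord0 i) :> 'rV[R]_n.+1.
Proof. by rewrite -scaleNr row_mx_shift_lift scaleNr. Qed.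

Lemma slice_diff2 n y (F : 'rV[R]_n.+1 -> R) (K : R) : 0 <= y <= len -> coord_diff2 F K ->
  coord_diff2 (slice y F) K.
Proof.
move=> yl H x i l l0 xb xlb xlb'; rewrite /slice row_mx_shift_lift row_mx_shift_liftN.
apply: H => //; first exact: row_mx_box.
  by rewrite -row_mx_shift_lift; exact: row_mx_box.
by rewrite -row_mx_shift_liftN; exact: row_mx_box.
Qed.

Lemma slice_boundary n y (F : 'rV[R]_n.+1 -> R) : 0 <= y <= len ->
  (forall x, box_boundary len x -> F x = 0) ->
  forall x, box_boundary len x -> slice y F x = 0.
Proof.
move=> yl F0 x [xb [i xi]]; apply: F0; split; first exact: row_mx_box.
by exists (lift ord0 i); rewrite row_mxE_lift.
Qed.

Lemma slice_ends n y (F : 'rV[R]_n.+1 -> R) (K : R) : y = 0 \/ y = len ->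
  coord_lip F K -> (forall x, box_boundary len x -> F x = 0) ->
  box_integral len (slice y F) = 0.
Proof.
move=> y0 HF F0.
have yl : 0 <= y <= len by case: y0 => ->; rewrite lexx ?len_ge0.
apply/eqP; rewrite -normr_le0 -(mul0r (len ^+ n)).
apply: (box_integral_linear_bounded n).2 (slice_lip yl HF) _ => v vb.
rewrite /slice F0 ?normr0//; split; first exact: row_mx_box.
by exists ord0; rewrite row_mxE0.
Qed.

Lemma slice_integral_diff2 n (F : 'rV[R]_n.+1 -> R) (K A : R) y s : coord_lip F A ->
  coord_diff2 F K -> 0 <= s -> 0 <= y - s -> y + s <= len ->
  `|box_integral len (slice (y + s) F) - 2 * box_integral len (slice y F)
    + box_integral len (slice (y - s) F)| <= K * len ^+ n * s ^+ 2.
Proof.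
move=> HF H2 s0 y0 y1; have [IHl IHb] := box_integral_linear_bounded n.
have i1 : 0 <= y + s <= len by apply/andP; split; lra.
have i2 : 0 <= y <= len by apply/andP; split; lra.
have i3 : 0 <= y - s <= len by apply/andP; split; lra.
have l1 := slice_lip i1 HF; have l2 := slice_lip i2 HF; have l3 := slice_lip i3 HF.
have l12 := coord_lip_lin 1 (-2) l1 l2.
have E : box_integral len (slice (y + s) F) - 2 * box_integral len (slice y F)
    + box_integral len (slice (y - s) F) = box_integral len (fun v =>
     1 * (1 * slice (y + s) F v + -2 * slice y F v) + 1 * slice (y - s) F v).
  by rewrite (IHl _ _ _ _ _ _ l12 l3) (IHl _ _ _ _ _ _ l1 l2) !mul1r mulNr.
rewrite E mulrAC; apply: IHb (coord_lip_lin 1 1 l12 l3) _ => v vb.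
rewrite !mul1r mulNr /slice row_mx_shift0 row_mx_shift0N; apply: H2 => //.
- exact: row_mx_box.
- by rewrite -row_mx_shift0; exact: row_mx_box.
- by rewrite -row_mx_shift0N; exact: row_mx_box.
Qed.

(** The composite trapezoidal rule on the box, for a function vanishing on the
    boundary, where it is the plain sum over all nodes; one dimension at a time. *)
Lemma box_quadrature n (F : 'rV[R]_n -> R) (A K : R) M : (0 < M)%N -> 0 <= K ->
  coord_lip F A -> coord_diff2 F K -> (forall x, box_boundary len x -> F x = 0) ->
  `|box_integral len F - mesh_h len M ^+ n * \sum_(k : grid_node n M) F (grid_point len k)|
  <= n%:R * (K * (2 * len) ^+ n) * mesh_h len M ^+ 2.
Proof.
move=> M0 K0; have h0 := mesh_h_gt0 len_gt0 M0; set h := mesh_h len M in h0 *.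
elim: n F => [|n IH] F Fl F2 F0.
  have node1 (k : grid_node 0 M) : k = [ffun=> ord0] by apply/ffunP => -[].
  rewrite (eq_bigr (fun=> F 0)); last first.
    by move=> k _; congr F; apply/rowP => -[].
  rewrite sumr_const card_ffun !card_ord expn0 mulr1n expr0 mul1r subrr normr0.
  by rewrite !mul0r.
have P0 : 0 <= K * len ^+ n by rewrite mulr_ge0// exprn_ge0.
have T : `|box_integral len F - h * \sum_(j < M.+1) box_integral len (slice (j%:R * h) F)|
    <= K * len ^+ n * len * h ^+ 2.
  apply: (trapezoid_rule len_gt0 M0 (slice_integral_lip (box_integral_linear_bounded n) Fl)).
  - by move=> y s s0 y0 y1; exact: slice_integral_diff2 Fl F2 s0 y0 y1.
  - by apply: slice_ends Fl F0; left.
  - by apply: slice_ends Fl F0; right.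
rewrite grid_sum_succ -/h exprS -mulrA mulr_sumr.
set S := h * \sum_(j < M.+1) _ in T *; set S' := h * \sum_(j < M.+1) _.
have D : `|S - S'| <= 2 * len * (n%:R * (K * (2 * len) ^+ n) * h ^+ 2).
  rewrite /S /S' -mulrBr -sumrB normrM (gtr0_norm h0).
  apply: (@le_trans _ _ (h * \sum_(j < M.+1) (n%:R * (K * (2 * len) ^+ n) * h ^+ 2))).
    rewrite ler_pM2l//; apply: le_trans (ler_norm_sum _ _ _) _; apply: ler_sum => j _.
    have jl : 0 <= j%:R * h <= len.
      by rewrite mulr_ge0 ?(ltW h0)//= -(mesh_hM len M0) ler_pM2r// ler_nat -ltnS ltn_ord.
    apply: IH; [exact: slice_lip Fl|exact: slice_diff2 F2|exact: slice_boundary F0].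
  rewrite sumr_const card_ord -(mulr_natl (_ * h ^+ 2)) mulrA.
  rewrite ler_wpM2r ?mulr_ge0 ?exprn_ge0 ?(ltW h0) ?mulr_ge0//.
  rewrite -(mesh_hM len M0) -/h mulrA mulrC ler_pM2r// -natrM ler_nat.
  by rewrite mul2n -addnn -addn1 leq_add2l.
have -> : box_integral len F - S' = (box_integral len F - S) + (S - S') by ring.
apply: le_trans (ler_normD _ _) _; apply: le_trans (lerD T D) _.
have l2 : len <= 2 * len by rewrite ler_peMl// ler1n.
have e1 : len ^+ n <= (2 * len) ^+ n by apply: lerXn2r; rewrite ?nnegrE ?mulr_ge0.
have e2 : K * len ^+ n * len * h ^+ 2 <= (2 * len) * (K * (2 * len) ^+ n) * h ^+ 2.
  by rewrite ler_wpM2r ?sqr_ge0// [leLHS]mulrC ler_pM// ler_wpM2l.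
rewrite -natr1 (exprS (2 * len)); lra.
Qed.

End BoxQuadrature.

(** * Error growth and the discrete Gronwall inequality *)

(* Nonnegativity of polynomial expressions in nonnegative quantities. *)
Ltac nonneg := by repeat first [done | apply: mulr_ge0 | apply: addr_ge0 | apply: exprn_ge0].
Section Gronwall.
Variable R : realType.
Implicit Types (x y z w r tau : R).

Lemma sqrD_le x y : (x + y) ^+ 2 <= 2 * x ^+ 2 + 2 * y ^+ 2.
Proof. have := sqr_ge0 (x - y); rewrite sqrrB sqrrD !mulr2n; lra. Qed.

Lemma sqr_le_sqr x y : 0 <= x -> x <= y -> x ^+ 2 <= y ^+ 2.
Proof. by move=> x0 xy; rewrite ler_sqr ?nnegrE// (le_trans x0). Qed.

(** Young's inequality absorbs half of the discrete time derivative. *)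
Lemma absorb_increment w tau r L Y Y' : 0 < tau ->
  w ^+ 2 / tau + L / 2 * (Y' - Y) <= r * w ->
  w ^+ 2 / tau + L * Y' <= L * Y + tau * r ^+ 2.
Proof.
move=> t0 H.
have : 2 * (r * w) <= w ^+ 2 / tau + tau * r ^+ 2.
  have -> : 2 * (r * w) = (2 * tau * r * w) / tau by field; rewrite gt_eqF.
  have -> : w ^+ 2 / tau + tau * r ^+ 2 = (w ^+ 2 + (tau * r) ^+ 2) / tau.
    by field; rewrite gt_eqF.
  rewrite ler_pM2r ?invr_gt0//; have := sqr_ge0 (w - tau * r); rewrite sqrrB mulr2n; lra.
lra.
Qed.

(** Young's inequality with weight tau on the cross term 2 a b. *)
Lemma sqr_growth a' a b tau T : 0 <= a' -> 0 < tau -> tau <= T -> a' <= a + b ->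
  a' ^+ 2 <= (1 + tau) * a ^+ 2 + (1 + T) * (b ^+ 2 / tau).
Proof.
move=> a0 t0 tT H; apply: le_trans (sqr_le_sqr a0 H) _.
have e : (1 + tau) * a ^+ 2 + (1 + tau) * (b ^+ 2 / tau) - (a + b) ^+ 2 =
  (tau * a - b) ^+ 2 / tau by field; rewrite gt_eqF.
have : 0 <= (tau * a - b) ^+ 2 / tau by rewrite divr_ge0 ?sqr_ge0// ltW.
have : (1 + tau) * (b ^+ 2 / tau) <= (1 + T) * (b ^+ 2 / tau).
  by rewrite ler_wpM2r ?lerD2l// divr_ge0 ?sqr_ge0// ltW.
lra.
Qed.

(** The weight of the gradient term is chosen so that the dissipation pays for
    the increments of the other two errors. *)
Definition grad_weight (C2 T : R) := (1 + T) * (1 + 2 * C2 ^+ 2).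
Definition growth_rate (C2 C3 L T : R) :=
  1 + 2 * grad_weight C2 T * C3 * (1 + (grad_weight C2 T * L)^-1).

Lemma grad_weight_gt0 C2 T : 0 < T -> 0 < grad_weight C2 T.
Proof.
move=> T0; apply: mulr_gt0; first exact: addr_gt0.
by rewrite ltr_pwDl// mulr_ge0 ?sqr_ge0.
Qed.

Lemma energy_growth (C2 C3 L T tau w r x x' z z' Y Y' eps2 : R) :
  0 < L -> 0 <= C2 -> 0 <= C3 -> 0 < tau -> tau <= T -> 0 <= x' -> 0 <= z' ->
  0 <= w -> 0 <= r -> 0 <= Y -> 0 <= eps2 ->
  w ^+ 2 / tau + L / 2 * (Y' - Y) <= r * w -> x' <= x + w ->
  z' <= z + C2 * (w + tau * r) -> r ^+ 2 <= C3 * (x ^+ 2 + z ^+ 2 + Y + eps2) ->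
  x' ^+ 2 + z' ^+ 2 + grad_weight C2 T * L * Y' <=
  (1 + growth_rate C2 C3 L T * tau) * (x ^+ 2 + z ^+ 2 + grad_weight C2 T * L * Y)
  + growth_rate C2 C3 L T * tau * eps2.
Proof.
move=> L0 C20 C30 t0 tT x0 z0 w0 r0 Y0 e0 H1 H2 H3 H4.
rewrite /growth_rate; set mu := grad_weight C2 T.
have T0 : 0 < T := lt_le_trans t0 tT.
have mu0 : 0 < mu := grad_weight_gt0 C2 T0.
have h1 := absorb_increment t0 H1.
have h2 := sqr_growth x0 t0 tT H2.
have h3 := sqr_growth z0 t0 tT H3.
set D := w ^+ 2 / tau in h1 h2.
have h4 : (C2 * (w + tau * r)) ^+ 2 / tau <= 2 * C2 ^+ 2 * (D + tau * r ^+ 2).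
  have -> : 2 * C2 ^+ 2 * (D + tau * r ^+ 2) =
    C2 ^+ 2 * (2 * w ^+ 2 + 2 * (tau * r) ^+ 2) / tau by rewrite /D; field; rewrite gt_eqF.
  by rewrite ler_pM2r ?invr_gt0// exprMn ler_wpM2l ?sqr_ge0// sqrD_le.
have T1 : 0 <= 1 + T by rewrite addr_ge0// ltW.
have h5 := ler_wpM2l T1 h4.
have h6 := ler_wpM2l (ltW mu0) h1.
have h7 := ler_wpM2l (mulr_ge0 (ler0n R 2) (mulr_ge0 (ltW mu0) (ltW t0))) H4.
have tr0 : 0 <= (1 + T) * (tau * r ^+ 2).
  by rewrite mulr_ge0// mulr_ge0 ?sqr_ge0// ltW.
set S := x ^+ 2 + z ^+ 2 in h7 *.
have S0 : 0 <= S by rewrite addr_ge0 ?sqr_ge0.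
have muE : mu * (D + L * Y') = (1 + T) * D + (1 + T) * (2 * C2 ^+ 2 * D) + mu * L * Y'.
  by rewrite /mu /grad_weight; ring.
have muE' : mu * (tau * r ^+ 2) = (1 + T) * (tau * r ^+ 2)
    + (1 + T) * (2 * C2 ^+ 2 * (tau * r ^+ 2)) by rewrite /mu /grad_weight; ring.
(* The bound before the constants are collected. *)
have h8 : x' ^+ 2 + z' ^+ 2 + mu * L * Y' <=
   (1 + tau) * S + mu * L * Y + 2 * mu * tau * (C3 * (S + Y + eps2)).
  rewrite /S in h7 *; lra.
apply: le_trans h8 _.
set iv := (mu * L)^-1.
have muL : 0 < mu * L by rewrite mulr_gt0.
have iv0 : 0 <= iv by rewrite invr_ge0 ltW.
have ivY : iv * (mu * L * Y) = Y by rewrite mulrA mulVf ?mul1r// gt_eqF.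
have -> : (1 + (1 + 2 * mu * C3 * (1 + iv)) * tau) * (S + mu * L * Y)
   + (1 + 2 * mu * C3 * (1 + iv)) * tau * eps2 =
   (1 + tau) * S + mu * L * Y + 2 * mu * tau * (C3 * (S + iv * (mu * L * Y) + eps2))
   + (tau * (mu * L * Y) + tau * eps2
      + 2 * mu * tau * C3 * (mu * L * Y + iv * S + iv * eps2)) by ring.
rewrite ivY lerDl.
have [[m0 tt0] mL] := (ltW mu0, ltW t0, ltW muL).
nonneg.
Qed.

Lemma discrete_gronwall (Phi : nat -> R) A tau eps2 N : 0 <= A -> 0 <= tau -> 0 <= eps2 ->
  Phi 0%N <= 0 ->
  (forall n, (n < N)%N -> Phi n.+1 <= (1 + A * tau) * Phi n + A * tau * eps2) ->
  forall n, (n <= N)%N -> Phi n <= expR (A * (n%:R * tau)) * eps2.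
Proof.
move=> A0 t0 e0 P0 step.
suff H n : (n <= N)%N -> Phi n <= (expR (A * (n%:R * tau)) - 1) * eps2.
  by move=> n nN; apply: le_trans (H n nN) _; rewrite ler_wpM2r// gerBl.
elim: n => [_|n IH nN]; first by rewrite mul0r mulr0 expR0 subrr mul0r.
have At0 : 0 <= A * tau by rewrite mulr_ge0.
apply: le_trans (step n nN) _.
have p1 : 0 <= 1 + A * tau by rewrite addr_ge0.
have := ler_wpM2l p1 (IH (ltnW nN)).
set E := expR (A * (n%:R * tau)).
have -> : A * (n.+1%:R * tau) = A * (n%:R * tau) + A * tau by rewrite -natr1; ring.
rewrite expRD -/E.
have E0 : 0 <= E * eps2 by rewrite mulr_ge0// expR_ge0.
have := ler_wpM2l E0 (expR_ge1Dx (A * tau)); lra.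
Qed.

End Gronwall.

Section StepConstants.
Variable R : realType.

Lemma sqr_sum3 (x y z : R) : (x + y + z) ^+ 2 <= 3 * (x ^+ 2 + y ^+ 2 + z ^+ 2).
Proof.
have := sqr_ge0 (x - y); have := sqr_ge0 (x - z); have := sqr_ge0 (y - z).
have -> : (x + y + z) ^+ 2 = x ^+ 2 + y ^+ 2 + z ^+ 2 + 2 * (x * y + x * z + y * z) by ring.
rewrite !sqrrB !mulr2n; lra.
Qed.

(** The data of the second-order step in terms of the errors at the beginning of
    the step: the local error of the predictor gains a power of tau. *)
Lemma predictor_residual (Ce Ces L T tau x z Y ws Ys xs zs h2 : R) :
  0 <= Ce -> 0 <= Ces -> 0 < L -> 0 < tau -> tau <= T ->
  0 <= x -> 0 <= z -> 0 <= Y -> 0 <= ws -> 0 <= Ys -> 0 <= xs -> 0 <= zs -> 0 <= h2 ->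
  let r0 := x + z + (tau / 2 + h2) in let eps := tau ^+ 2 + h2 in
  ws ^+ 2 / (tau / 2) + L / 2 * (Ys - Y) <= Ce * r0 * ws ->
  xs <= x + ws -> zs <= z + Ces * (ws + tau / 2 * r0) ->
  (x + xs + zs + eps) ^+ 2 <=
    (6 * (2 + Ces * (T + 1)) ^+ 2 + 2 * (1 + Ces) ^+ 2 * (3 * (Ce * (T + 1)) ^+ 2 + T * L))
    * (x ^+ 2 + z ^+ 2 + Y + eps ^+ 2).
Proof.
move=> Ce0 Ces0 L0 t0 tT x0 z0 Y0 ws0 Ys0 xs0 zs0 h20 r0 eps H1 H2 H3.
have T0 : 0 < T := lt_le_trans t0 tT.
have th0 : 0 < tau / 2 by rewrite divr_gt0.
set q := x + z + eps.
have eps0 : 0 <= eps by rewrite addr_ge0 ?sqr_ge0.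
have q0 : 0 <= q by apply: addr_ge0 => //; exact: addr_ge0.
have r00 : 0 <= r0 by rewrite /r0 !addr_ge0// ltW.
have tr : tau / 2 * r0 <= (T + 1) * q.
  have a1 : tau * x <= T * x by rewrite ler_wpM2r.
  have a2 : tau * z <= T * z by rewrite ler_wpM2r.
  have a3 : tau * h2 <= T * h2 by rewrite ler_wpM2r.
  have a4 : 0 <= T * x by rewrite mulr_ge0// ltW.
  have a5 : 0 <= T * z by rewrite mulr_ge0// ltW.
  have a6 : 0 <= T * h2 by rewrite mulr_ge0// ltW.
  have a7 : 0 <= T * tau ^+ 2 by rewrite mulr_ge0 ?sqr_ge0// ltW.
  have a8 := sqr_ge0 tau.
  rewrite /q /r0 /eps; lra.
have W : ws ^+ 2 <= T * L * Y + (Ce * (T + 1) * q) ^+ 2.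
  have := absorb_increment th0 H1; rewrite -(ler_pM2r th0) mulrDl mulfVK ?gt_eqF//.
  have a1 : 0 <= L * Ys * (tau / 2) by rewrite !mulr_ge0// ltW.
  have a2 : L * Y * (tau / 2) <= T * L * Y.
    have : L * Y * (tau / 2) <= L * Y * T by rewrite ler_wpM2l ?mulr_ge0 ?(ltW L0)//; lra.
    lra.
  have a3 : (Ce * (tau / 2 * r0)) ^+ 2 <= (Ce * ((T + 1) * q)) ^+ 2.
    by apply: sqr_le_sqr; [rewrite !mulr_ge0// ltW|rewrite ler_wpM2l].
  have -> : (L * Y + tau / 2 * (Ce * r0) ^+ 2) * (tau / 2)
     = L * Y * (tau / 2) + (Ce * (tau / 2 * r0)) ^+ 2 by ring.
  have -> : Ce * (T + 1) * q = Ce * ((T + 1) * q) by ring.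
  lra.
have S : x + xs + zs + eps <= (2 + Ces * (T + 1)) * q + (1 + Ces) * ws.
  have := ler_wpM2l Ces0 tr; rewrite /q; lra.
have q2 : q ^+ 2 <= 3 * (x ^+ 2 + z ^+ 2 + eps ^+ 2) := sqr_sum3 x z eps.
apply: le_trans (sqr_le_sqr _ S) _; first by rewrite addr_ge0// !addr_ge0.
apply: le_trans (sqrD_le _ _) _; rewrite (exprMn _ (2 + _)) (exprMn _ (1 + Ces)).
rewrite (exprMn _ (Ce * (T + 1)) q) in W.
set a := (2 + Ces * (T + 1)) ^+ 2; set b := (1 + Ces) ^+ 2; set c := (Ce * (T + 1)) ^+ 2.
have [a0 b0 c0] : [/\ 0 <= a, 0 <= b & 0 <= c] by rewrite !sqr_ge0.
rewrite -/c in W.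
have u1 := ler_wpM2l a0 q2; have u2 := ler_wpM2l b0 W.
have u3 := ler_wpM2l (mulr_ge0 b0 c0) q2.
have [T00 L00] := (ltW T0, ltW L0).
have s0 : 0 <= x ^+ 2 + z ^+ 2 + eps ^+ 2 by rewrite !addr_ge0 ?sqr_ge0.
have v1 : 0 <= a * Y by nonneg.
have v2 : 0 <= b * c * Y by nonneg.
have v3 : 0 <= b * (T * L) * (x ^+ 2 + z ^+ 2 + eps ^+ 2) by nonneg.
lra.
Qed.

End StepConstants.

(** * The error of one step *)
Lemma expR_sub1_le (R : realType) (x G : R) : expR x <= G -> `|expR x - 1| <= (1 + G) * `|x|.
Proof.
move=> HG; have e0 := expR_gt0 x; have h1 := expR_ge1Dx x; have h2 := expR_ge1Dx (- x).
have G0 : 0 < G := lt_le_trans e0 HG.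
have h3 : 1 - x <= expR (- x) by [].
have h4 : expR x * (1 - x) <= 1.
  by rewrite -[leRHS](expRxMexpNx_1 x) ler_wpM2l// ltW.
have [x0|x0] := leP 0 x.
  rewrite ger0_norm; last lra.
  have : expR x * x <= G * x by rewrite ler_wpM2r.
  rewrite (ger0_norm x0); lra.
have e1 : expR x < 1 by rewrite expR_lt1.
rewrite (ltr0_norm x0) ltr0_norm; last lra.
have : 0 <= G * - x by rewrite mulr_ge0 ?ltW// oppr_gt0.
lra.
Qed.

(** The cut-off of the auxiliary variable only moves it towards any value above
    the lower bound of the energy. *)
Lemma cutoff_dist (R : realType) (x b e : R) : b <= e ->
  `|Num.max x b - e| <= `|x - e|.
Proof.
move=> be; case: (leP x b) => // xb.
by rewrite !ler0_norm ?subr_le0// ?(le_trans xb)// lerN2 lerD2r.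
Qed.

Section Convergence.
Variables (R : realType) (d : nat) (m : model R) (len T kappa Cstar : R)
  (Q0 : 'rV[R]_d -> 'M[R]_d) (Qe : 'rV[R]_d * R -> 'M[R]_d).
Hypotheses (len_gt0 : 0 < len) (T_gt0 : 0 < T) (L_gt0 : 0 < elL m)
  (kappa_ge0 : 0 <= kappa) (Cstar_ge0 : 0 <= Cstar)
  (F_lower : forall A : 'M[R]_d, sym_tracefree A -> - Cstar <= len ^+ d * F_bulk m A)
  (flow : Qtensor_flow m len T Q0 Qe).
Variables (K B G Cf CF CI : R).
Hypotheses (cons : consistent m len T Qe K) (KB : K <= B)
  (G_ge0 : 0 <= G) (Cf_ge0 : 0 <= Cf) (CF_ge0 : 0 <= CF) (CI_ge0 : 0 <= CI)
  (f_lip : forall A A' : 'M[R]_d, frob A <= B -> frob A' <= B ->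
    frob (f_bulk m A) <= Cf /\ frob (f_bulk m A - f_bulk m A') <= Cf * frob (A - A'))
  (F_lip : forall A A' : 'M[R]_d, frob A <= B -> frob A' <= B ->
    `|F_bulk m A - F_bulk m A'| <= CF * frob (A - A'))
  (F_incr : forall A u v : 'M[R]_d, sym_tracefree u -> sym_tracefree v ->
    frob A <= 2 * B -> frob u <= 2 * B -> frob v <= 2 * B ->
    `|F_bulk m (A + u) - F_bulk m (A - v) + mdot (f_bulk m A) (u + v)|
     <= CI * (frob (u - v) * frob (u + v) + frob u ^+ 3 + frob v ^+ 3)).
Local Notation L := (elL m).
Local Notation nu := (vol_root d len).
Let K_ge0 : 0 <= K := cons_K cons.
Let B_ge0 : 0 <= B := le_trans K_ge0 KB.
Let nu_ge0 : 0 <= nu := vol_root_ge0 d len.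

Section OneStepError.
Variable (M : nat).
Hypothesis M_gt0 : (0 < M)%N.
Implicit Types (P Q : gtensor R d M) (s sigma t th tau : R) (k : grid_node d M).

Local Notation h := (mesh_h len M).
Local Notation tip := (tip_h len).
Local Notation nrm := (norm_h len).
Local Notation Qg := (@Qgrid R d len Qe M).
Let h2_ge0 : 0 <= h ^+ 2 := sqr_ge0 h.

Definition good_state P sigma :=
  [/\ in_S_h P, forall k, frob (P k) <= B & g_h m len P sigma <= G].

Lemma Qg_S t : 0 <= t <= T -> in_S_h (Qg t).
Proof. exact: (Qgrid_in_S_h len_gt0 flow M_gt0). Qed.

Lemma Qg_bound t k : 0 <= t <= T -> frob (Qg t k) <= K.
Proof.
by move=> tT; apply: (cons_bound cons); split=> //; exact: grid_point_box.
Qed.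

Lemma Qg_boundB t k : 0 <= t <= T -> frob (Qg t k) <= B.
Proof. by move=> tT; rewrite (le_trans (Qg_bound k tT)). Qed.

Definition Cg := (1 + G) * (1 + CF * nu).

Lemma Cg_ge0 : 0 <= Cg.
Proof. by rewrite /Cg mulr_ge0// addr_ge0// mulr_ge0. Qed.

(** The scheme's factor g is 1 on the exact solution; its deviation is first
    order in the two errors. *)
Lemma g_error P sigma t : 0 <= t <= T -> good_state P sigma ->
  `|g_h m len P sigma - 1| <= Cg * (nrm (P - Qg t) + `|sigma - E1_h m len (Qg t)|).
Proof.
move=> tT [SP HP HG]; rewrite g_hE in HG *.
apply: le_trans (expR_sub1_le HG) _; rewrite /Cg -mulrA ler_wpM2l ?addr_ge0//.
have -> : sigma - E1_h m len P = (sigma - E1_h m len (Qg t))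
   - (E1_h m len P - E1_h m len (Qg t)) by ring.
apply: le_trans (ler_normB _ _) _.
have H := E1_h_lip len_gt0 M_gt0 (m := m) (P := P) (Q := Qg t) CF_ge0
  (fun k => F_lip (HP k) (Qg_boundB k tT)).
have n0 := nrm_ge0 len (P - Qg t); have n1 := normr_ge0 (sigma - E1_h m len (Qg t)).
have : 0 <= CF * nu * `|sigma - E1_h m len (Qg t)| by rewrite !mulr_ge0.
move: H; lra.
Qed.

Lemma f_h_bound P : (forall k, frob (P k) <= B) -> nrm (f_h m P) <= nu * Cf.
Proof.
move=> HP; apply: nrm_le_sup => // k; exact: (f_lip (HP k) (HP k)).1.
Qed.

Lemma f_h_lip P t : 0 <= t <= T -> (forall k, frob (P k) <= B) ->
  nrm (f_h m P - f_h m (Qg t)) <= Cf * nrm (P - Qg t).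
Proof.
move=> tT HP; apply: nrm_le_pointwise => // k.
exact: (f_lip (HP k) (Qg_boundB k tT)).2.
Qed.

(** The discrete energy of the exact solution changes by minus the reaction at A
    paired with the increment, which is how the scheme updates the auxiliary
    variable. The error is second order for A = Q, third order at a midpoint. *)
Lemma E1_h_increment (A Q Q' : gtensor R d M) X : 0 <= X ->
  (forall k, sym_tracefree (Q' k - A k)) -> (forall k, sym_tracefree (A k - Q k)) ->
  (forall k, frob (A k) <= B) -> (forall k, frob (Q k) <= B) -> (forall k, frob (Q' k) <= B) ->
  (forall k, frob (Q' k - A k - (A k - Q k)) * frob (Q' k - Q k)
     + frob (Q' k - A k) ^+ 3 + frob (A k - Q k) ^+ 3 <= X) ->
  `|E1_h m len Q' - E1_h m len Q + tip (f_h m A) (Q' - Q)| <= nu ^+ 2 * (CI * X).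
Proof.
move=> X0 su sv HA HQ HQ' HX.
have hd0 : 0 <= h ^+ d by rewrite exprn_ge0// ltW// mesh_h_gt0.
rewrite /E1_h /ip_h tipE -mulrBr -mulrDr -sumrB -big_split /= normrM ger0_norm//.
apply: (@le_trans _ _ (h ^+ d * \sum_(k : grid_node d M) CI * X)).
  rewrite ler_wpM2l//; apply: le_trans (ler_norm_sum _ _ _) _; apply: ler_sum => k _.
  have bB (X' Y : 'M[R]_d) : frob X' <= B -> frob Y <= B -> frob (X' - Y) <= 2 * B.
    by move=> a b; apply: le_trans (frobB _ _) _; lra.
  have AB : frob (A k) <= 2 * B by have := B_ge0; have := HA k; lra.
  have := F_incr (su k) (sv k) AB (bB _ _ (HQ' k) (HA k)) (bB _ _ (HA k) (HQ k)).
  have -> : A k + (Q' k - A k) = Q' k by rewrite addrC subrK.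
  have -> : A k - (A k - Q k) = Q k by rewrite opprB addrC subrK.
  have -> : Q' k - A k + (A k - Q k) = Q' k - Q k by rewrite addrA subrK.
  rewrite !mulr1 => H; apply: le_trans H _.
  by rewrite ler_wpM2l.
rewrite sumr_const -(mulr_natl (CI * X)) mulrA ler_wpM2r ?mulr_ge0//.
exact: grid_mass.
Qed.

(** ** The first-order step *)

Definition C_euler := Cf * nu * Cg + Cf + nu * (G * kappa * K + K).
Definition C_euler_s := G * (nu * Cf) + nu * K * (nu * Cf * Cg + Cf)
  + nu ^+ 2 * (CI * (K ^+ 2 + K ^+ 3 * T)).

(** The error equation is tested with the increment of the error, not with the
    error itself: the scheme updates the auxiliary variable by a pairing with the
    increment of Q, so its error grows with w, which only this test controls. *)
Lemma sESAV1_error P sigma th P' sigma' t : 0 <= t -> 0 < th -> t + th <= T ->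
  good_state P sigma -> (forall k, frob (P' k) <= B) ->
  sESAV1 m len kappa Cstar P sigma th P' sigma' ->
  let e := P - Qg t in let e' := P' - Qg (t + th) in
  let w := nrm (e' - e) in let z := `|sigma - E1_h m len (Qg t)| in
  let r := nrm e + z + (th + h ^+ 2) in
  w ^+ 2 / th + L / 2 * (sqgrad_h len e' - sqgrad_h len e) <= C_euler * r * w /\
  `|sigma' - E1_h m len (Qg (t + th))| <= z + C_euler_s * (w + th * r).
Proof.
move=> t0 th0 tT gP HP' H e e' w z r.
have [SP HP HG] := gP.
have eq1 := sESAV1_eq H; case: H => SP' _ sE.
have tT0 : 0 <= t <= T by apply/andP; split; lra.
have tT1 : 0 <= t + th <= T by apply/andP; split; lra.
have gE := g_error tT0 gP; rewrite -/e -/z in gE.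
set g := g_h m len P sigma in HG eq1 sE gE *.
have g0 : 0 < g by exact: g_h_gt0.
have e_b : zero_bdry e by apply: zero_bdryB; [case: SP|case: (Qg_S tT0)].
have e'_b : zero_bdry e' by apply: zero_bdryB; [case: SP'|case: (Qg_S tT1)].
have de_b : zero_bdry (e' - e) by exact: zero_bdryB.
pose dQ : gtensor R d M := Qg (t + th) - Qg t.
have dQb : nrm dQ <= nu * (K * th).
  apply: nrm_le_sup => //; first by rewrite mulr_ge0// ltW.
  by move=> k; exact: (cons_t_lip cons k M_gt0 t0 (ltW th0) tT).
pose rho : gtensor R d M := fun k => if interior_node k then
  th^-1 *: (Qg (t + th) k - Qg t k) - L *: tlap len (Qg (t + th)) k
   - f_bulk m (Qg t k) else 0.
have rhob : nrm rho <= nu * (K * (th + h ^+ 2)).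
  have q0 : 0 <= K * (th + h ^+ 2) by rewrite mulr_ge0// addr_ge0// ltW.
  apply: nrm_le_sup => // k; rewrite /rho; case: ifPn => ki; last by rewrite frob0.
  exact: (cons_euler cons M_gt0 t0 th0 tT ki).
have w0 : 0 <= w := nrm_ge0 len (e' - e).
have z0 : 0 <= z := normr_ge0 _.
have x0 : 0 <= nrm e := nrm_ge0 len e.
have fb := f_h_bound HP; have fl := f_h_lip tT0 HP; rewrite -/e in fl.
have Cg0 := Cg_ge0.
have h0 : 0 <= h := ltW (mesh_h_gt0 len_gt0 M_gt0).
have th00 := ltW th0.
split.
  have T1 : th^-1 * tip (e' - e) (e' - e) = L * tip (tlap len e') (e' - e)
    + ((g - 1) * tip (f_h m P) (e' - e) + tip (f_h m P - f_h m (Qg t)) (e' - e)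
       - g * kappa * tip (e' - e) (e' - e) - (g * kappa) * tip dQ (e' - e)
       - tip rho (e' - e)).
    rewrite -!tipZl -tipDl -!tipBl -tipDl; apply: tip_interior => // k ki.
    have E := eq1 k ki.
    have rk : rho k = th^-1 *: (Qg (t + th) k - Qg t k) - L *: tlap len (Qg (t + th)) k
       - f_bulk m (Qg t k) by rewrite /rho ki.
    rewrite !fctE /e' tlapB !fctE rk.
    apply/matrixP => i j; have /matrixP/(_ i j) := E; rewrite /f_h /dQ /e !fctE.
    move: (tlap len P' k) (tlap len (Qg (t + th)) k) (f_bulk m (P k)) (f_bulk m (Qg t k)).
    move=> t1 t2 f1 f2; rewrite !mxE; lra.
  have w2 : w ^+ 2 = tip (e' - e) (e' - e) by exact: nrm_sqr.
  rewrite (tip_tlap_increment len M_gt0 e'_b e_b) -w2 in T1.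
  have sg := sqgrad_ge0 len_gt0 M_gt0 de_b.
  have b1 : (g - 1) * tip (f_h m P) (e' - e) <= Cg * (nrm e + z) * (nu * Cf * w).
    apply: le_trans (ler_norm _) _; rewrite normrM ler_pM//.
    by apply: le_trans (tip_CS len_gt0 M_gt0 _ _) _; rewrite ler_wpM2r.
  have b2 : tip (f_h m P - f_h m (Qg t)) (e' - e) <= Cf * nrm e * w.
    by apply: le_trans (tip_le len_gt0 M_gt0 _ _) _; rewrite ler_wpM2r.
  have b3 : - (g * kappa * tip dQ (e' - e)) <= G * kappa * (nu * (K * th) * w).
    apply: le_trans (ler_norm _) _; rewrite normrN (normrM (g * kappa)).
    rewrite (normrM g) (gtr0_norm g0) (ger0_norm kappa_ge0).
    rewrite ler_pM ?mulr_ge0 ?(ltW g0)//; first by rewrite ler_wpM2r.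
    by apply: le_trans (tip_CS len_gt0 M_gt0 _ _) _; rewrite ler_wpM2r.
  have b4 : - tip rho (e' - e) <= nu * (K * (th + h ^+ 2)) * w.
    apply: le_trans (ler_norm _) _; rewrite normrN.
    by apply: le_trans (tip_CS len_gt0 M_gt0 _ _) _; rewrite ler_wpM2r.
  have b5 : 0 <= g * kappa * w ^+ 2 by rewrite !mulr_ge0 ?(ltW g0)// sqr_ge0.
  have b6 : 0 <= L * sqgrad_h len (e' - e) by rewrite mulr_ge0// ltW.
  have b7 : Cg * (nrm e + z) * (nu * Cf * w) + Cf * nrm e * w
     + G * kappa * (nu * (K * th) * w) + nu * (K * (th + h ^+ 2)) * w <= C_euler * r * w.
    rewrite /C_euler /r.
    have c1 : 0 <= Cf * nu * Cg * (th + h ^+ 2) * w by nonneg.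
    have c2 : 0 <= Cf * (z + (th + h ^+ 2)) * w by nonneg.
    have c3 : 0 <= nu * (G * kappa * K + K) * (nrm e + z) * w by nonneg.
    have c4 : 0 <= nu * (G * kappa * K) * h ^+ 2 * w by nonneg.
    lra.
  have -> : w ^+ 2 / th = th^-1 * w ^+ 2 by rewrite mulrC.
  lra.
rewrite sE.
have Ee0 : 0 <= E_el m len P' by apply: E_el_ge0 => //; exact: in_S_h_zero_bdry.
have E1C := E1_h_ge len_gt0 M_gt0 Cstar_ge0 F_lower (Qg_S tT1).
have cut : - Cstar - E_el m len P' <= E1_h m len (Qg (t + th)) by lra.
apply: le_trans (cutoff_dist _ cut) _.
have inc : `|E1_h m len (Qg (t + th)) - E1_h m len (Qg t) + tip (f_h m (Qg t)) dQ|
    <= nu ^+ 2 * (CI * (K ^+ 2 * th ^+ 2 + K ^+ 3 * th ^+ 3)).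
  apply: E1_h_increment.
  - by rewrite addr_ge0// mulr_ge0 ?exprn_ge0// ltW.
  - by move=> k; apply: sym_tracefreeB; [exact: (Qg_S tT1).1|exact: (Qg_S tT0).1].
  - by move=> k; rewrite subrr; exact: sym_tracefree0.
  - by move=> k; exact: Qg_boundB.
  - by move=> k; exact: Qg_boundB.
  - by move=> k; exact: Qg_boundB.
  - move=> k; rewrite subrr subr0 frob0 expr0n addr0 -expr2.
    have b := cons_t_lip cons k M_gt0 t0 (ltW th0) tT.
    have q0 : 0 <= K * th by rewrite mulr_ge0// ltW.
    rewrite -!exprMn lerD// lerXn2r ?nnegrE ?frob_ge0//.
have -> : sigma - g * tip (f_h m P) (fun k => P' k - P k) - E1_h m len (Qg (t + th)) =
  (sigma - E1_h m len (Qg t)) - g * tip (f_h m P) (e' - e)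
  - ((g - 1) * tip (f_h m P) dQ + tip (f_h m P - f_h m (Qg t)) dQ)
  - (E1_h m len (Qg (t + th)) - E1_h m len (Qg t) + tip (f_h m (Qg t)) dQ).
  have -> : (fun k => P' k - P k) = (e' - e) + dQ.
    apply/funext => k; rewrite /e' /e /dQ !fctE.
    by apply/matrixP => i j; rewrite !mxE; ring.
  by rewrite tipDr tipBl; ring.
have d1 : `|g * tip (f_h m P) (e' - e)| <= G * (nu * Cf) * w.
  rewrite normrM (gtr0_norm g0) -mulrA ler_pM ?(ltW g0)//.
  by apply: le_trans (tip_CS len_gt0 M_gt0 _ _) _; rewrite ler_wpM2r.
have d2 : `|(g - 1) * tip (f_h m P) dQ| <= Cg * (nrm e + z) * (nu * Cf * (nu * (K * th))).
  rewrite normrM ler_pM//.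
  by apply: le_trans (tip_CS len_gt0 M_gt0 _ _) _; rewrite ler_pM ?nrm_ge0.
have d3 : `|tip (f_h m P - f_h m (Qg t)) dQ| <= Cf * nrm e * (nu * (K * th)).
  by apply: le_trans (tip_CS len_gt0 M_gt0 _ _) _; rewrite ler_pM ?nrm_ge0.
have thT : th <= T by lra.
have d4 : nu ^+ 2 * (CI * (K ^+ 2 * th ^+ 2 + K ^+ 3 * th ^+ 3)) <=
   nu ^+ 2 * (CI * (K ^+ 2 + K ^+ 3 * T)) * (th * th).
  have p3 : 0 <= nu ^+ 2 * CI * K ^+ 3 * (th * th) by nonneg.
  have := ler_wpM2l p3 thT; lra.
apply: le_trans (ler_normB _ _) _; apply: le_trans (lerD (ler_normB _ _) inc) _.
apply: le_trans (lerD (lerD (ler_normB _ _) (ler_normD _ _)) d4) _.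
rewrite -/z /C_euler_s /r.
have c1 : 0 <= nu * K * (nu * Cf * Cg + Cf) * w by nonneg.
set c5 := nu ^+ 2 * (CI * (K ^+ 2 + K ^+ 3 * T)).
have c50 : 0 <= c5 by have T0 := ltW T_gt0; rewrite /c5; nonneg.
have c2 : 0 <= c5 * w by nonneg.
have c3 : 0 <= G * (nu * Cf) * (th * (nrm e + z + (th + h ^+ 2))) by nonneg.
have c4 : 0 <= nu * K * (nu * Cf * Cg) * (th * (th + h ^+ 2)) by nonneg.
have c6 : 0 <= nu * K * Cf * (th * (z + (th + h ^+ 2))) by nonneg.
have c7 : 0 <= c5 * (th * (nrm e + z + h ^+ 2)) by nonneg.
lra.
Qed.

(** ** The second-order corrector *)

Definition C_mid := Cf * nu * Cg + Cf + G * kappa + nu * (G * kappa * K + K).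
Definition C_mid_s := G * (nu * Cf) + nu * K * (nu * Cf * Cg + Cf)
  + 2 * (kappa * G * nu * B) + kappa * G * nu * K * (1 + T + nu * K)
  + nu ^+ 2 * CI * (K ^+ 2 + 2 * K ^+ 3).

(** Every term is a multiple of w or of tau times the residual, after a spare power
    of tau has been traded for T. *)
Lemma corrector_s_arith (x xs zs w tau h2 : R) : 0 <= x -> 0 <= xs -> 0 <= zs ->
  0 <= w -> 0 <= tau -> 0 <= h2 -> tau <= T ->
  G * (nu * Cf) * w + (Cg * (xs + zs) * (nu * Cf * (nu * (K * tau)))
    + Cf * xs * (nu * (K * tau))) + (kappa * G * (nu * (2 * B) * w)
    + kappa * G * ((x + w / 2 + xs + nu * (K * tau ^+ 2)) * (nu * (K * tau))))
    + nu ^+ 2 * (CI * ((K ^+ 2 + 2 * K ^+ 3) * tau ^+ 3))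
  <= C_mid_s * (w + tau * (x + xs + zs + (tau ^+ 2 + h2))).
Proof.
move=> x0 xs0 zs0 w0 tau0 h20 tauT; rewrite /C_mid_s; have Cg0 := Cg_ge0.
have T0 := ltW T_gt0.
have c1 : 0 <= nu * K * (nu * Cf * Cg + Cf) * w by nonneg.
have c2 : 0 <= nu ^+ 2 * CI * (K ^+ 2 + 2 * K ^+ 3) * w by nonneg.
have c3 : 0 <= G * (nu * Cf) * (tau * (x + xs + zs + (tau ^+ 2 + h2))) by nonneg.
have c4 : 0 <= nu * K * (nu * Cf * Cg) * (tau * (x + (tau ^+ 2 + h2))) by nonneg.
have c5 : 0 <= nu * K * Cf * (tau * (x + zs + (tau ^+ 2 + h2))) by nonneg.
have c6 : 0 <= nu ^+ 2 * CI * (K ^+ 2 + 2 * K ^+ 3) * (tau * (x + xs + zs + h2)) by nonneg.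
have c7 : 0 <= 2 * (kappa * G * nu * B) * (tau * (x + xs + zs + (tau ^+ 2 + h2))) by nonneg.
have kK : 0 <= kappa * G * nu * K by nonneg.
have c8 : 0 <= kappa * G * nu * K * (w + nu * K * w) by nonneg.
have c9 : 0 <= kappa * G * nu * K * (tau * (zs + (tau ^+ 2 + h2))) by nonneg.
have c10 : 0 <= kappa * G * nu * K * (T * (tau * (x + xs + zs + (tau ^+ 2 + h2)))) by nonneg.
have c11 : 0 <= kappa * G * nu * K * (nu * K * (tau * (x + xs + zs + h2))) by nonneg.
have c12 : kappa * G * nu * K * (tau * w) <= kappa * G * nu * K * (T * w).
  by rewrite ler_wpM2l// ler_wpM2r.
have c13 : 0 <= kappa * G * nu * K * (T * w) by nonneg.
lra.
Qed.

(** As for the first-order step. The predictor errors enter through the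
    residual, and the deviation of the mean state from the predicted one
    through the stabilization term. *)
Lemma corrector_error Q s tau Qs ss Q' s' t : 0 <= t -> 0 < tau -> t + tau <= T ->
  in_S_h Q -> (forall k, frob (Q k) <= B) -> good_state Qs ss ->
  (forall k, frob (Q' k) <= B) ->
  sESAV2_corrector m len kappa Cstar Q s tau Qs ss Q' s' ->
  let e := Q - Qg t in let e' := Q' - Qg (t + tau) in let es := Qs - Qg (t + tau / 2) in
  let w := nrm (e' - e) in let z := `|s - E1_h m len (Qg t)| in
  let zs := `|ss - E1_h m len (Qg (t + tau / 2))| in
  let r := nrm e + nrm es + zs + (tau ^+ 2 + h ^+ 2) in
  w ^+ 2 / tau + L / 2 * (sqgrad_h len e' - sqgrad_h len e) <= C_mid * r * w /\
  `|s' - E1_h m len (Qg (t + tau))| <= z + C_mid_s * (w + tau * r).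
Proof.
move=> t0 tau0 tT SQ HQ gQs HQ' H e e' es w z zs r.
have [SQs HQs HG] := gQs.
have eq1 := corrector_eq H; case: H => SQ' _ sE.
have tT0 : 0 <= t <= T by apply/andP; split; lra.
have tT1 : 0 <= t + tau <= T by apply/andP; split; lra.
have tTm : 0 <= t + tau / 2 <= T by apply/andP; split; lra.
have gE := g_error tTm gQs; rewrite -/es -/zs in gE.
set g := g_h m len Qs ss in HG eq1 sE gE *.
have g0 : 0 < g by exact: g_h_gt0.
have e_b : zero_bdry e by apply: zero_bdryB; [case: SQ|case: (Qg_S tT0)].
have e'_b : zero_bdry e' by apply: zero_bdryB; [case: SQ'|case: (Qg_S tT1)].
have de_b : zero_bdry (e' - e) by exact: zero_bdryB.
have tau00 := ltW tau0.
have tau2 : 0 <= tau / 2 by rewrite divr_ge0.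
pose dQ : gtensor R d M := Qg (t + tau) - Qg t.
pose AV : gtensor R d M := 2^-1 *: (Qg (t + tau) + Qg t) - Qg (t + tau / 2).
have dQb : nrm dQ <= nu * (K * tau).
  apply: nrm_le_sup => //; first by rewrite mulr_ge0.
  by move=> k; exact: (cons_t_lip cons k M_gt0 t0 tau00 tT).
have AVk k : frob (AV k) <= K * tau ^+ 2.
  have H := cons_t_diff2 cons k M_gt0 t0 tau00 tT.
  have -> : AV k = 2^-1 *: (Qg (t + tau) k - 2 *: Qg (t + tau / 2) k + Qg t k).
    by rewrite /AV !fctE; apply/matrixP => i j; rewrite !mxE; field.
  rewrite frobZ gtr0_norm ?invr_gt0//.
  have : 0 <= frob (Qg (t + tau) k - 2 *: Qg (t + tau / 2) k + Qg t k) := frob_ge0 _.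
  lra.
have AVb : nrm AV <= nu * (K * tau ^+ 2).
  by apply: nrm_le_sup => //; rewrite mulr_ge0 ?sqr_ge0.
pose rho : gtensor R d M := fun k => if interior_node k then
  tau^-1 *: (Qg (t + tau) k - Qg t k) - (L / 2) *: tlap len (Qg (t + tau) + Qg t) k
   - f_bulk m (Qg (t + tau / 2) k) else 0.
have rhob : nrm rho <= nu * (K * (tau ^+ 2 + h ^+ 2)).
  have q0 : 0 <= K * (tau ^+ 2 + h ^+ 2) by rewrite mulr_ge0// addr_ge0// sqr_ge0.
  apply: nrm_le_sup => // k; rewrite /rho; case: ifPn => ki; last by rewrite frob0.
  exact: (cons_midpoint cons M_gt0 t0 tau0 tT ki).
have w0 : 0 <= w := nrm_ge0 len (e' - e).
have z0 : 0 <= z := normr_ge0 _.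
have zs0 : 0 <= zs := normr_ge0 _.
have x0 : 0 <= nrm e := nrm_ge0 len e.
have xs0 : 0 <= nrm es := nrm_ge0 len es.
have fb := f_h_bound HQs; have fl := f_h_lip tTm HQs; rewrite -/es in fl.
have Cg0 := Cg_ge0.
have h0 : 0 <= h := ltW (mesh_h_gt0 len_gt0 M_gt0).
have T0 := ltW T_gt0.
pose W : gtensor R d M := fun k => 2^-1 *: (Q' k + Q k) - Qs k.
have WE : W = e + 2^-1 *: (e' - e) - es + AV.
  apply/funext => k; rewrite /W /e /e' /es /AV !fctE.
  by apply/matrixP => i j; rewrite !mxE; field.
split.
  have T1 : tau^-1 * tip (e' - e) (e' - e) = L / 2 * tip (tlap len (e' + e)) (e' - e)
    + ((g - 1) * tip (f_h m Qs) (e' - e) + tip (f_h m Qs - f_h m (Qg (t + tau / 2))) (e' - e)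
       - (g * kappa) * tip W (e' - e) - tip rho (e' - e)).
    rewrite -!tipZl -tipDl -!tipBl -tipDl; apply: tip_interior => // k ki.
    have E := eq1 k ki.
    have rk : rho k = tau^-1 *: (Qg (t + tau) k - Qg t k)
       - (L / 2) *: tlap len (Qg (t + tau) + Qg t) k
       - f_bulk m (Qg (t + tau / 2) k) by rewrite /rho ki.
    have e2 : e' + e = (Q' + Q) - (Qg (t + tau) + Qg t) by rewrite /e' /e opprD addrACA.
    rewrite e2 tlapB !fctE rk.
    apply/matrixP => i j; have /matrixP/(_ i j) := E; rewrite /f_h /W /e' /e !fctE.
    move: (tlap len (Q' + Q) k) (tlap len (Qg (t + tau) + Qg t) k).
    move: (f_bulk m (Qs k)) (f_bulk m (Qg (t + tau / 2) k)).
    move=> f1 f2 t1 t2; rewrite !mxE; lra.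
  have w2 : w ^+ 2 = tip (e' - e) (e' - e) by exact: nrm_sqr.
  have WT : tip W (e' - e) = tip e (e' - e) + 2^-1 * tip (e' - e) (e' - e)
      - tip es (e' - e) + tip AV (e' - e) by rewrite WE tipDl tipBl tipDl tipZl.
  rewrite (tip_tlap_sum_increment len M_gt0 e'_b e_b) WT -w2 in T1.
  have b1 : (g - 1) * tip (f_h m Qs) (e' - e) <= Cg * (nrm es + zs) * (nu * Cf * w).
    apply: le_trans (ler_norm _) _; rewrite normrM ler_pM//.
    by apply: le_trans (tip_CS len_gt0 M_gt0 _ _) _; rewrite ler_wpM2r.
  have b2 : tip (f_h m Qs - f_h m (Qg (t + tau / 2))) (e' - e) <= Cf * nrm es * w.
    by apply: le_trans (tip_le len_gt0 M_gt0 _ _) _; rewrite ler_wpM2r.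
  have gk (X : gtensor R d M) c : nrm X <= c ->
      `|g * kappa * tip X (e' - e)| <= G * kappa * (c * w).
    move=> Xc; rewrite (normrM (g * kappa)) (normrM g) (gtr0_norm g0) (ger0_norm kappa_ge0).
    rewrite ler_pM ?mulr_ge0 ?(ltW g0)//; first by rewrite ler_wpM2r.
    by apply: le_trans (tip_CS len_gt0 M_gt0 _ _) _; rewrite ler_wpM2r.
  have b3 := le_trans (ler_norm _) (gk _ _ AVb).
  have b3' := gk _ _ AVb; rewrite ler_norml in b3'; case/andP: b3' => b3' _.
  have b4' := gk _ _ (lexx (nrm e)); rewrite ler_norml in b4'; case/andP: b4' => b4' _.
  have b5 := le_trans (ler_norm _) (gk _ _ (lexx (nrm es))).
  have b6 : - tip rho (e' - e) <= nu * (K * (tau ^+ 2 + h ^+ 2)) * w.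
    apply: le_trans (ler_norm _) _; rewrite normrN.
    by apply: le_trans (tip_CS len_gt0 M_gt0 _ _) _; rewrite ler_wpM2r.
  have b7 : 0 <= g * kappa * w ^+ 2 by rewrite !mulr_ge0 ?(ltW g0)// sqr_ge0.
  have b8 : Cg * (nrm es + zs) * (nu * Cf * w) + Cf * nrm es * w
     + G * kappa * (nu * (K * tau ^+ 2) * w) + G * kappa * (nrm e * w)
     + G * kappa * (nrm es * w) + nu * (K * (tau ^+ 2 + h ^+ 2)) * w <= C_mid * r * w.
    rewrite /C_mid /r.
    have c1 : 0 <= Cf * nu * Cg * (nrm e + (tau ^+ 2 + h ^+ 2)) * w by nonneg.
    have c2 : 0 <= Cf * (nrm e + zs + (tau ^+ 2 + h ^+ 2)) * w by nonneg.
    have c3 : 0 <= nu * (G * kappa * K + K) * (nrm e + nrm es + zs) * w by nonneg.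
    have c4 : 0 <= nu * (G * kappa * K) * h ^+ 2 * w by nonneg.
    have c5 : 0 <= G * kappa * (zs + (tau ^+ 2 + h ^+ 2)) * w by nonneg.
    lra.
  have -> : w ^+ 2 / tau = tau^-1 * w ^+ 2 by rewrite mulrC.
  lra.
rewrite sE.
have Ee0 : 0 <= E_el m len Q' by apply: E_el_ge0 => //; exact: in_S_h_zero_bdry.
have E1C := E1_h_ge len_gt0 M_gt0 Cstar_ge0 F_lower (Qg_S tT1).
have cut : - Cstar - E_el m len Q' <= E1_h m len (Qg (t + tau)) by lra.
apply: le_trans (cutoff_dist _ cut) _.
pose Qm := Qg (t + tau / 2).
have inc : `|E1_h m len (Qg (t + tau)) - E1_h m len (Qg t) + tip (f_h m Qm) dQ|
    <= nu ^+ 2 * (CI * ((K ^+ 2 + 2 * K ^+ 3) * tau ^+ 3)).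
  apply: E1_h_increment.
  - by nonneg.
  - by move=> k; apply: sym_tracefreeB; [exact: (Qg_S tT1).1|exact: (Qg_S tTm).1].
  - by move=> k; apply: sym_tracefreeB; [exact: (Qg_S tTm).1|exact: (Qg_S tT0).1].
  - by move=> k; exact: Qg_boundB.
  - by move=> k; exact: Qg_boundB.
  - by move=> k; exact: Qg_boundB.
  - move=> k.
    have b := cons_t_lip cons k M_gt0 t0 tau00 tT.
    have tm0 : 0 <= t + tau / 2 by rewrite addr_ge0.
    have tmT : t + tau / 2 <= T by lra.
    have tm1 : t + tau / 2 + tau / 2 <= T by lra.
    have bu := cons_t_lip cons k M_gt0 tm0 tau2 tm1.
    have tmE : t + tau / 2 + tau / 2 = t + tau by field.
    rewrite tmE in bu.
    have bv := cons_t_lip cons k M_gt0 t0 tau2 tmT.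
    have Kt : 0 <= K * tau by rewrite mulr_ge0.
    have hb : K * (tau / 2) <= K * tau by rewrite ler_wpM2l//; lra.
    have buv : frob (Qg (t + tau) k - Qm k - (Qm k - Qg t k)) <= K * tau ^+ 2.
      have := cons_t_diff2 cons k M_gt0 t0 tau00 tT; congr (frob _ <= _).
      by rewrite /Qm; apply/matrixP => i j; rewrite !mxE; ring.
    have n3 (X : 'M[R]_d) : frob X <= K * tau -> frob X ^+ 3 <= (K * tau) ^+ 3.
      by move=> HX; rewrite lerXn2r ?nnegrE ?frob_ge0.
    have p1 := ler_pM (frob_ge0 _) (frob_ge0 _) buv b.
    have p2 := n3 _ (le_trans bu hb); have p3 := n3 _ (le_trans bv hb).
    rewrite -/Qm in p2 p3; lra.
have -> : s - g * tip (f_h m Qs) (fun k => Q' k - Q k)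
    + kappa * g * tip (fun k => 2^-1 *: (Q' k + Q k) - Qs k) (fun k => Q' k - Q k)
    - E1_h m len (Qg (t + tau)) =
  (s - E1_h m len (Qg t)) - g * tip (f_h m Qs) (e' - e)
  - ((g - 1) * tip (f_h m Qs) dQ + tip (f_h m Qs - f_h m Qm) dQ)
  + (kappa * g * tip W (e' - e) + kappa * g * tip W dQ)
  - (E1_h m len (Qg (t + tau)) - E1_h m len (Qg t) + tip (f_h m Qm) dQ).
  have -> : (fun k => Q' k - Q k) = (e' - e) + dQ.
    apply/funext => k; rewrite /e' /e /dQ !fctE.
    by apply/matrixP => i j; rewrite !mxE; ring.
  rewrite -[(fun k => 2^-1 *: (Q' k + Q k) - Qs k)]/W.
  rewrite ![tip _ (e' - e + dQ)]tipDr tipBl; ring.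
have d1 : `|g * tip (f_h m Qs) (e' - e)| <= G * (nu * Cf) * w.
  rewrite normrM (gtr0_norm g0) -mulrA ler_pM ?(ltW g0)//.
  by apply: le_trans (tip_CS len_gt0 M_gt0 _ _) _; rewrite ler_wpM2r.
have d2 : `|(g - 1) * tip (f_h m Qs) dQ| <= Cg * (nrm es + zs) * (nu * Cf * (nu * (K * tau))).
  rewrite normrM ler_pM//.
  by apply: le_trans (tip_CS len_gt0 M_gt0 _ _) _; rewrite ler_pM ?nrm_ge0.
have d3 : `|tip (f_h m Qs - f_h m Qm) dQ| <= Cf * nrm es * (nu * (K * tau)).
  by apply: le_trans (tip_CS len_gt0 M_gt0 _ _) _; rewrite ler_pM ?nrm_ge0.
have Wb : nrm W <= nu * (2 * B).
  apply: nrm_le_sup => // [|k]; first by rewrite mulr_ge0.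
  apply: le_trans (frobB _ _) _; rewrite frobZ gtr0_norm ?invr_gt0//.
  have := frobD (Q' k) (Q k); have := HQ k; have := HQ' k; have := HQs k; lra.
have Wb' : nrm W <= nrm e + w / 2 + nrm es + nu * (K * tau ^+ 2).
  rewrite WE; apply: le_trans (nrmD len_gt0 M_gt0 _ _) _; apply: lerD => //.
  apply: le_trans (nrmB len_gt0 M_gt0 _ _) _; apply: lerD => //.
  apply: le_trans (nrmD len_gt0 M_gt0 _ _) _; apply: lerD => //.
  by rewrite nrmZ gtr0_norm ?invr_gt0// mulrC.
have kg : kappa * g <= kappa * G by rewrite ler_wpM2l.
have kg0 : 0 <= kappa * g by rewrite mulr_ge0// ltW.
have d4 : `|kappa * g * tip W (e' - e)| <= kappa * G * (nu * (2 * B) * w).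
  rewrite normrM (ger0_norm kg0) ler_pM//.
  by apply: le_trans (tip_CS len_gt0 M_gt0 _ _) _; rewrite ler_wpM2r.
have d5 : `|kappa * g * tip W dQ| <= kappa * G *
    ((nrm e + w / 2 + nrm es + nu * (K * tau ^+ 2)) * (nu * (K * tau))).
  rewrite normrM (ger0_norm kg0) ler_pM//.
  by apply: le_trans (tip_CS len_gt0 M_gt0 _ _) _; rewrite ler_pM ?nrm_ge0.
apply: le_trans (ler_normB _ _) _; apply: le_trans (lerD (ler_normD _ _) inc) _.
apply: le_trans (lerD (lerD (ler_normB _ _) (ler_normD _ _)) (lexx _)) _.
apply: le_trans (lerD (lerD (lerD (ler_normB _ _) (ler_normD _ _)) (lexx _)) (lexx _)) _.
rewrite -/z /r; have thT : tau <= T by lra.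
have := @corrector_s_arith (nrm e) (nrm es) zs w tau (h ^+ 2) x0 xs0 zs0 w0 tau00 h2_ge0 thT.
lra.
Qed.

End OneStepError.

Local Notation Qg := (Qgrid len Qe).
Let Cg0 := Cg_ge0.
Let C_euler_ge0 : 0 <= C_euler.
Proof. by rewrite /C_euler; nonneg. Qed.
Let C_euler_s_ge0 : 0 <= C_euler_s.
Proof. by have T0 := ltW T_gt0; rewrite /C_euler_s; nonneg. Qed.
Let C_mid_ge0 : 0 <= C_mid.
Proof. by rewrite /C_mid; nonneg. Qed.
Let C_mid_s_ge0 : 0 <= C_mid_s.
Proof. by have T0 := ltW T_gt0; rewrite /C_mid_s; nonneg. Qed.

(** The auxiliary variable is compared with the discrete bulk energy of the exact
    solution, not with its integral: the factor g is then exactly 1 on the exact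
    solution, and no quadrature error enters the recursion. *)
Definition sq_error mu M (Q : gtensor R d M) s t :=
  norm_h len (Q - Qg t) ^+ 2 + `|s - E1_h m len (Qg t : gtensor R d M)| ^+ 2
  + mu * L * sqgrad_h len (Q - Qg t).

Lemma error_zero_bdry M (Q : gtensor R d M) t : (0 < M)%N -> 0 <= t <= T -> in_S_h Q ->
  zero_bdry (Q - Qg t).
Proof.
move=> M0 tT [_ Q0b]; apply: zero_bdryB => //.
by case: (Qgrid_in_S_h len_gt0 flow M0 tT).
Qed.

Lemma error_increment M (Q Q' : gtensor R d M) t t' : (0 < M)%N ->
  norm_h len (Q' - Qg t') <= norm_h len (Q - Qg t)
   + norm_h len (Q' - Qg t' - (Q - Qg t)).
Proof.
move=> M0; set e := Q - _; set e' := Q' - _.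
by have := nrmD len_gt0 M0 e (e' - e); rewrite [e + _]addrC subrK.
Qed.

(** One step multiplies the squared error by 1 + O(tau) and adds tau times the
    square of the expected accuracy; the constants are chosen before the mesh. *)
Lemma step_growth p : p = 1%N \/ p = 2%N -> exists mu A, [/\ 0 < mu, 0 <= A &
  forall M (Q : gtensor R d M) s tau Q' s' t, (0 < M)%N -> 0 <= t -> 0 < tau ->
  t + tau <= T -> good_state Q s -> in_S_h Q' -> (forall k, frob (Q' k) <= B) ->
  (forall th (P : gtensor R d M) sigma, 0 < th ->
     sESAV1 m len kappa Cstar Q s th P sigma -> good_state P sigma) ->
  sESAV_step m len kappa Cstar p Q s tau Q' s' ->
  sq_error mu Q' s' (t + tau) <= (1 + A * tau) * sq_error mu Q s t
    + A * tau * (tau ^+ p + mesh_h len M ^+ 2) ^+ 2].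
Proof.
have gw_gt0 c : 0 < grad_weight c T := grad_weight_gt0 c T_gt0.
have gr_ge0 c c3 : 0 <= c3 -> 0 <= growth_rate c c3 L T.
  move=> c30; have g0 := ltW (gw_gt0 c).
  have gi : 0 <= (grad_weight c T * L)^-1 by rewrite invr_ge0 mulr_ge0// ltW.
  by rewrite /growth_rate; nonneg.
have T00 := ltW T_gt0; have L00 := ltW L_gt0.
case=> ->.
  pose C3 := 3 * (C_euler + 1) ^+ 2.
  have C30 : 0 <= C3 by rewrite /C3; nonneg.
  exists (grad_weight C_euler_s T), (growth_rate C_euler_s C3 L T); split=> //.
  - exact: gr_ge0.
  move=> M Q s tau Q' s' t M0 t0 tau0 tT gQ SQ' HQ' _ /= H.
  have [e1 e2] := sESAV1_error M0 t0 tau0 tT gQ HQ' H.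
  have tT0 : 0 <= t <= T by apply/andP; split; lra.
  have tT1 : 0 <= t + tau <= T by apply/andP; split; lra.
  have h20 : 0 <= mesh_h len M ^+ 2 := sqr_ge0 _.
  have tauT : tau <= T by lra.
  have Y0 := sqgrad_ge0 len_gt0 M0 (error_zero_bdry M0 tT0 (let: And3 a _ _ := gQ in a)).
  have xx := @error_increment M Q Q' t (t + tau) M0.
  set x := norm_h len (Q - Qg t) in e1 e2 xx *.
  set z := `|s - _| in e1 e2 *.
  set w := norm_h len (_ - (Q - Qg t)) in e1 e2 xx *.
  have x0 : 0 <= x := nrm_ge0 len _.
  have z0 : 0 <= z := normr_ge0 _.
  have w0 : 0 <= w := nrm_ge0 len _.
  set r0 := x + z + _ in e1 e2.
  have tau00 := ltW tau0.
  have r00 : 0 <= r0 by rewrite /r0; nonneg.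
  have eps0 : 0 <= (tau ^+ 1 + mesh_h len M ^+ 2) ^+ 2 by exact: sqr_ge0.
  rewrite /sq_error -/x -/z.
  apply: (@energy_growth R C_euler_s C3 L T tau w ((C_euler + 1) * r0)) => //.
  - exact: nrm_ge0.
  - by rewrite mulr_ge0// addr_ge0.
  - apply: le_trans e1 _; rewrite ler_wpM2r// ler_wpM2r// lerDl//.
  - apply: le_trans e2 _; rewrite lerD2l ler_wpM2l// lerD2l ler_wpM2l//.
    by rewrite mulrDl mul1r lerDr mulr_ge0.
  - rewrite exprMn /C3 -[leRHS]mulrA [leRHS]mulrCA ler_wpM2l ?sqr_ge0//.
    apply: le_trans (sqr_sum3 _ _ _) _; rewrite expr1; lra.
pose C3 := (C_mid + 1) ^+ 2 * (6 * (2 + C_euler_s * (T + 1)) ^+ 2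
   + 2 * (1 + C_euler_s) ^+ 2 * (3 * (C_euler * (T + 1)) ^+ 2 + T * L)).
have C30 : 0 <= C3 by rewrite /C3; nonneg.
exists (grad_weight C_mid_s T), (growth_rate C_mid_s C3 L T); split=> //.
- exact: gr_ge0.
move=> M Q s tau Q' s' t M0 t0 tau0 tT gQ SQ' HQ' gP /= [Qs [ss [Hp Hc]]].
have [SQ HQ _] := gQ.
have tT0 : 0 <= t <= T by apply/andP; split; lra.
have tau2 : 0 < tau / 2 by rewrite divr_gt0.
have tTh : t + tau / 2 <= T by lra.
have tTm : 0 <= t + tau / 2 <= T by apply/andP; split; lra.
have gQs := gP _ _ _ tau2 Hp; have [SQs HQs _] := gQs.
have [p1 p2] := sESAV1_error M0 t0 tau2 tTh gQ HQs Hp.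
have [e1 e2] := corrector_error M0 t0 tau0 tT SQ HQ gQs HQ' Hc.
have h20 : 0 <= mesh_h len M ^+ 2 := sqr_ge0 _.
have tauT : tau <= T by lra.
have Y0 := sqgrad_ge0 len_gt0 M0 (error_zero_bdry M0 tT0 SQ).
have Ys0 := sqgrad_ge0 len_gt0 M0 (error_zero_bdry M0 tTm SQs).
have xx := @error_increment M Q Q' t (t + tau) M0.
have xxs := @error_increment M Q Qs t (t + tau / 2) M0.
set x := norm_h len (Q - Qg t) in p1 p2 e1 e2 xx xxs *.
set z := `|s - _| in p1 p2 e2 *.
set w := norm_h len (_ - (Q - Qg t)) in e1 e2 xx *.
set ws := norm_h len (_ - (Q - Qg t)) in p1 p2 xxs *.
set xs := norm_h len (Qs - Qg (t + tau / 2)) in e1 e2 xxs *.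
set zs := `|ss - _| in p2 e1 e2 *.
have x0 : 0 <= x := nrm_ge0 len _.
have z0 : 0 <= z := normr_ge0 _.
have w0 : 0 <= w := nrm_ge0 len _.
have ws0 : 0 <= ws := nrm_ge0 len _.
have xs0 : 0 <= xs := nrm_ge0 len _.
have zs0 : 0 <= zs := normr_ge0 _.
have PR := predictor_residual C_euler_ge0 C_euler_s_ge0 L_gt0 tau0 tauT x0 z0 Y0 ws0 Ys0 xs0 zs0 h20
   p1 xxs p2.
set r := x + xs + zs + _ in e1 e2 PR.
have tau00 := ltW tau0.
have r00 : 0 <= r by rewrite /r; nonneg.
have eps0 : 0 <= (tau ^+ 2 + mesh_h len M ^+ 2) ^+ 2 by exact: sqr_ge0.
rewrite /sq_error -/x -/z.
apply: (@energy_growth R C_mid_s C3 L T tau w ((C_mid + 1) * r)) => //.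
- exact: nrm_ge0.
- by rewrite mulr_ge0// addr_ge0.
- apply: le_trans e1 _; rewrite ler_wpM2r// ler_wpM2r// lerDl//.
- apply: le_trans e2 _; rewrite lerD2l ler_wpM2l// lerD2l ler_wpM2l//.
  by rewrite mulrDl mul1r lerDr mulr_ge0.
- by rewrite exprMn /C3 -[leRHS]mulrA ler_wpM2l ?sqr_ge0.
Qed.

(** ** Quadrature of the bulk energy *)

(** The potential of the exact solution vanishes on the boundary of the box, and
    its second differences are bounded through those of the solution. *)
Lemma exact_energy_quadrature : exists2 C : R, 0 <= C & forall M t, (0 < M)%N ->
  0 <= t <= T -> `|E1_h m len (Qg t : gtensor R d M) - s_exact m len Qe t|
    <= C * mesh_h len M ^+ 2.
Proof.
have [Hst _ Hbd _] := flow.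
pose C2 := CI * (2 * K ^+ 2 + 2 * (2 * B * K ^+ 2)) + Cf * K.
have C20 : 0 <= C2 by rewrite /C2; nonneg.
have len0 := ltW len_gt0.
exists (d%:R * (C2 * (2 * len) ^+ d)); first by nonneg.
move=> M t M0 tT; rewrite distrC /s_exact /E1_h /ip_h.
under [X in _ - _ * X]eq_bigr do rewrite mulr1.
have D (x : 'rV[R]_d) : Omega_box len x -> Omega_T len T (x, t) by move=> xb; split.
have bB x : Omega_box len x -> frob (Qe (x, t)) <= B.
  by move=> /D/(cons_bound cons) H; exact: le_trans H KB.
apply: (box_quadrature len_gt0 (A := CF * K) M0 C20).
- move=> x i l l0 xb xlb.
  apply: le_trans (F_lip (bB _ xlb) (bB _ xb)) _; rewrite -mulrA ler_wpM2l//.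
  have := cons_x_lip cons (i := i) l0 (D _ xb); rewrite shift_x; apply; exact: D.
- move=> x i l l0 xb xlb xmb.
  pose A := Qe (x, t); pose u := Qe (x + l *: delta_mx 0 i, t) - A.
  pose v := A - Qe (x - l *: delta_mx 0 i, t).
  have HA : frob A <= 2 * B by have := bB _ xb; have := B_ge0; rewrite /A; lra.
  have dB (X Y : 'M[R]_d) : frob X <= B -> frob Y <= B -> frob (X - Y) <= 2 * B.
    by move=> a b; apply: le_trans (frobB _ _) _; lra.
  have Hu : frob u <= 2 * B := dB _ _ (bB _ xlb) (bB _ xb).
  have Hv : frob v <= 2 * B := dB _ _ (bB _ xb) (bB _ xmb).
  have su : sym_tracefree u by apply: sym_tracefreeB; apply: Hst; exact: D.
  have sv : sym_tracefree v by apply: sym_tracefreeB; apply: Hst; exact: D.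
  have s0 := @sym_tracefree0 R d.
  have z0 : frob (0 : 'M[R]_d) <= 2 * B by rewrite frob0 mulr_ge0.
  have I1 := F_incr su s0 HA Hu z0; have I2 := F_incr s0 sv HA z0 Hv.
  rewrite !(subr0, addr0, add0r, sub0r, frobN, frob0) expr0n /= ?addr0 ?add0r in I1 I2.
  have -> : Qe (x + l *: delta_mx 0 i, t) = A + u by rewrite /u [RHS]addrC subrK.
  have -> : Qe (x - l *: delta_mx 0 i, t) = A - v by rewrite /v opprB [RHS]addrC subrK.
  have ul : frob u <= K * l.
    have := cons_x_lip cons (i := i) l0 (D _ xb); rewrite shift_x; apply; exact: D.
  have vl : frob v <= K * l.
    have := cons_x_lip cons (i := i) l0 (D _ xmb); rewrite shift_x subrK; apply; exact: D.
  have uvl : frob (u - v) <= K * l ^+ 2.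
    have := cons_x_diff2 cons (i := i) l0 (D _ xb); rewrite shift_x shift_xN.
    move=> /(_ (D _ xlb) (D _ xmb)); congr (frob _ <= _).
    by rewrite /u /v /A; apply/matrixP => a b; rewrite !mxE; ring.
  have Kl0 : 0 <= K * l by rewrite mulr_ge0.
  have cub (X : 'M[R]_d) : frob X <= K * l -> frob X <= 2 * B ->
      frob X * frob X + frob X ^+ 3 <= (1 + 2 * B) * (K * l) ^+ 2.
    move=> h1 h2; have X0 := frob_ge0 X.
    have q : frob X * frob X <= (K * l) ^+ 2 by rewrite expr2 ler_pM.
    have q3 : frob X ^+ 3 <= 2 * B * (K * l) ^+ 2.
      by rewrite exprS expr2; apply: ler_pM => //; rewrite mulr_ge0.
    by rewrite mulrDl mul1r lerD.
  have fuv : `|mdot (f_bulk m A) (u - v)| <= Cf * (K * l ^+ 2).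
    apply: le_trans (mdot_CS _ _) _; rewrite ler_pM ?frob_ge0//.
    exact: (f_lip (bB _ xb) (bB _ xb)).1.
  have -> : F_bulk m (A + u) - 2 * F_bulk m A + F_bulk m (A - v) =
    (F_bulk m (A + u) - F_bulk m A + mdot (f_bulk m A) u)
    - (F_bulk m A - F_bulk m (A - v) + mdot (f_bulk m A) v)
    - mdot (f_bulk m A) (u - v) by rewrite mdotBr; ring.
  apply: le_trans (ler_normB _ _) _; apply: le_trans (lerD (ler_normB _ _) fuv) _.
  apply: le_trans (lerD (lerD I1 I2) (lexx _)) _.
  have cu := ler_wpM2l CI_ge0 (cub _ ul Hu); have cv := ler_wpM2l CI_ge0 (cub _ vl Hv).
  rewrite /C2; lra.
- by move=> x xb; rewrite Hbd// F_bulk0.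
Qed.

(** The bound on g must not depend on the mesh: second differences of the initial
    datum bound its discrete gradient energy. *)
Lemma initial_energy_bounded : exists E0 : R, forall M, (0 < M)%N ->
  E_h m len (Qg 0 : gtensor R d M) (E1_h m len (Qg 0 : gtensor R d M)) <= E0.
Proof.
exists (L / 2 * (nu * (d%:R * K) * (nu * K)) + CF * (nu * (nu * K))) => M M0.
have T00 : 0 <= (0 : R) <= T by rewrite lexx ltW.
have SQ := Qgrid_in_S_h len_gt0 flow M0 T00.
have Qb (k : grid_node d M) : frob (Qg 0 k : 'M[R]_d) <= K.
  by apply: (cons_bound cons); split=> //; exact: grid_point_box.
have nQ : norm_h len (Qg 0 : gtensor R d M) <= nu * K by exact: nrm_le_sup.
have h0 := mesh_h_gt0 len_gt0 M0.
have dK0 : 0 <= d%:R * K by rewrite mulr_ge0.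
have nL : norm_h len (tlap len (Qg 0 : gtensor R d M)) <= nu * (d%:R * K).
  apply: nrm_le_sup => // k; rewrite tlapE; case: ifPn => ki; last by rewrite frob0.
  rewrite frobZ ger0_norm ?invr_ge0 ?sqr_ge0// mulrC ler_pdivrMr ?exprn_gt0//.
  apply: (@le_trans _ _ (\sum_(i < d) K * mesh_h len M ^+ 2)); last first.
    by rewrite sumr_const card_ord -(mulr_natl (K * _)) mulrA.
  apply: le_trans (frob_sum _) _; apply: ler_sum => i _.
  have Db (k' : grid_node d M) : Omega_T len T (grid_point len k', 0).
    by split=> //; exact: grid_point_box.
  have := cons_x_diff2 cons (i := i) (ltW h0) (Db k).
  rewrite shift_x shift_xN -grid_point_up// -grid_point_down//; apply; exact: Db.
rewrite /E_h; apply: lerD.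
  rewrite /E_el ler_wpM2l ?divr_ge0 ?(ltW L_gt0)// sqgradE.
  apply: le_trans (ler_norm _) _; rewrite normrN.
  by apply: le_trans (tip_CS len_gt0 M0 _ _) _; rewrite ler_pM ?nrm_ge0.
have E10 : E1_h m len (0 : gtensor R d M) = 0.
  by rewrite /E1_h /ip_h big1 ?mulr0// => k _; rewrite F_bulk0 mul0r.
have H := E1_h_lip len_gt0 M0 (m := m) (P := (Qg 0 : gtensor R d M))
  (Q := (0 : gtensor R d M)) CF_ge0.
rewrite E10 !subr0 in H.
apply: le_trans (ler_norm _) _; apply: le_trans (H _) _.
  move=> k; apply: F_lip; first exact: le_trans (Qb k) KB.
  by rewrite frob0.
by rewrite ler_wpM2l// ler_wpM2l.
Qed.

End Convergence.



(** * Convergence *)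
Section Invariants.
Variables (R : realType) (d : nat) (m : model R) (len kappa Cstar eta : R) (M : nat).
Hypotheses (len_gt0 : 0 < len) (M_gt0 : (0 < M)%N) (L_gt0 : 0 < elL m)
  (kappa_ge0 : 0 <= kappa) (Cstar_ge0 : 0 <= Cstar) (eta_ge0 : 0 <= eta)
  (F_lower : forall A : 'M[R]_d, sym_tracefree A -> - Cstar <= len ^+ d * F_bulk m A)
  (f_max : forall A : 'M[R]_d, sym_tracefree A -> frob A <= eta ->
     frob (f_bulk m A + kappa *: A) <= kappa * eta).

(** The step restriction keeps the weights of the explicit half of the
    Crank-Nicolson corrector nonnegative, since 2 d <= 2 ^ d in the dimensions at
    hand. *)
Lemma step_restriction tau (gs : R) : (d = 2 \/ d = 3)%N -> 0 <= gs -> 0 < tau ->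
  tau <= (kappa * gs / 2 + 2 ^+ d.-1 * elL m / mesh_h len M ^+ 2)^-1 ->
  2 * d%:R * elL m / mesh_h len M ^+ 2 <= 2 / tau - kappa * gs.
Proof.
move=> d23 gs0 tau0; set X := _ + _ => Ht.
have h2 : 0 < mesh_h len M ^+ 2 by rewrite exprn_gt0// mesh_h_gt0.
have q0 : 0 < elL m / mesh_h len M ^+ 2 by rewrite divr_gt0.
have X0 : 0 < X.
  by rewrite ltr_wpDl ?divr_ge0 ?mulr_ge0// -mulrA mulr_gt0// exprn_gt0.
have XT : X <= tau^-1.
  by rewrite -[X]invrK lef_pV2 ?posrE ?invr_gt0.
have d2 : 2 * d%:R <= 2 * 2 ^+ d.-1 :> R.
  by case: d23 => -> /=; rewrite -natrX -!natrM ler_nat.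
have := ler_wpM2r (ltW q0) d2; move: XT; rewrite /X.
have -> : 2 ^+ d.-1 * elL m / mesh_h len M ^+ 2 = 2 ^+ d.-1 * (elL m / mesh_h len M ^+ 2).
  by rewrite mulrA.
have -> : 2 * d%:R * elL m / mesh_h len M ^+ 2 = 2 * d%:R * (elL m / mesh_h len M ^+ 2).
  by rewrite mulrA.
lra.
Qed.

Lemma scheme_invariants p E0 tau (Q : nat -> gtensor R d M) (s : nat -> R) :
  p = 1%N \/ p = 2%N -> 0 < tau ->
  2 * d%:R * elL m / mesh_h len M ^+ 2 <= 2 / tau - kappa * expR (E0 + Cstar) ->
  scheme_inv m len Cstar E0 eta (Q 0%N) (s 0%N) ->
  (forall n, sESAV_step m len kappa Cstar p (Q n) (s n) tau (Q n.+1) (s n.+1)) ->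
  forall n, scheme_inv m len Cstar E0 eta (Q n) (s n).
Proof.
move=> p12 tau0 Ht I0 step; elim=> [//|n IH]; have := step n.
case: p12 => -> /=.
  exact: (sESAV1_inv len_gt0 M_gt0 L_gt0 kappa_ge0 tau0 eta_ge0 f_max IH).
move=> [Qs [ss [Hp Hc]]].
have tau2 : 0 < tau / 2 by rewrite divr_gt0.
have Is := sESAV1_inv len_gt0 M_gt0 L_gt0 kappa_ge0 tau2 eta_ge0 f_max IH Hp.
exact: (sESAV2_inv len_gt0 M_gt0 L_gt0 kappa_ge0 Cstar_ge0 F_lower tau0 eta_ge0 f_max Ht
  IH Is Hc).
Qed.

End Invariants.

Lemma supnorm_ge (R : realType) d (len K : R) (Q0 : 'rV[R]_d -> 'M[R]_d) x :
  (forall y, Omega_box len y -> frob (Q0 y) <= K) -> Omega_box len x ->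
  frob (Q0 x) <= supnorm len Q0.
Proof.
move=> HK xb; apply: ub_le_sup; last by exists x.
by exists K => _ [y yb <-]; exact: HK.
Qed.

Lemma le_of_sqr_le (R : realType) (x E ep : R) : 0 <= E -> 0 <= ep ->
  x ^+ 2 <= E * ep ^+ 2 -> x <= Num.sqrt E * ep.
Proof.
move=> E0 e0 H; apply: le_trans (ler_norm _) _.
rewrite -ler_sqr ?nnegrE ?mulr_ge0 ?sqrtr_ge0// real_normK ?num_real// exprMn.
by rewrite sqr_sqrtr.
Qed.

Theorem theorem4p1 (R : realType) :
  exists r : nat,
  forall (d : nat) (m : model R) (len T kappa Cstar Glow : R) (p : nat)
    (Q0 : 'rV[R]_d -> 'M[R]_d) (Qe : 'rV[R]_d * R -> 'M[R]_d),
  0 <= cb m -> 0 < cc m -> 0 < elL m -> admissible_case m d ->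
  0 < len -> 0 < T ->
  0 < Cstar ->
  (forall A : 'M[R]_d, sym_tracefree A -> - Cstar <= len ^+ d * F_bulk m A) ->
  0 < Glow ->
  p = 1%N \/ p = 2%N ->
  Qtensor_flow m len T Q0 Qe ->
  smooth_solution len T r Qe ->
  kappa_min m (eta_bound m d (supnorm len Q0)) <= kappa ->
  exists C : R,
  forall (M : nat) (tau : R) (Q : nat -> gtensor R d M) (s : nat -> R),
  (0 < M)%N -> 0 < tau ->
  tau <= (kappa * Gstar m len Cstar (restrict_h len Q0 : gtensor R d M) / 2
          + 2 ^+ d.-1 * elL m / mesh_h len M ^+ 2)^-1 ->
  sESAV_generated m len kappa Cstar p Q0 tau Q s ->
  g_lower_bound m len kappa Cstar p tau (Num.truncn (T / tau)) Q s Glow ->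
  forall n : nat, (n <= Num.truncn (T / tau))%N ->
  let t := n%:R * tau in
  let eQ : gtensor R d M :=
    fun k => Q n k - restrict_h len (fun x => Qe (x, t)) k in
  norm_h len eQ + gradnorm_h len eQ + `|s n - s_exact m len Qe t|
    <= C * (tau ^+ p + mesh_h len M ^+ 2).
Proof.
(* Four derivatives in space give the second-order truncation error of the
   Laplacian. *)
exists 4%N => d m len T kappa Cstar Glow p Q0 Qe b0 c0 L0 Hd len0 T0 Cs0 F_lower _ p12
  flow smooth Hk.
have Cs00 := ltW Cs0; have [Hst _ _ Q0E] := flow.
have [K cons] := exact_consistent len0 T0 L0 flow smooth.
have K0 := cons_K cons.
have T00 : 0 <= (0 : R) <= T by rewrite lexx ltW.
have Q0b y : Omega_box len y -> frob (Q0 y) <= K.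
  by move=> yb; rewrite -Q0E//; apply: (cons_bound cons); split.
have N00 : 0 <= supnorm len Q0.
  have box0 : Omega_box len (0 : 'rV[R]_d) by move=> i; rewrite mxE lexx ltW.
  exact: le_trans (frob_ge0 _) (supnorm_ge Q0b box0).
set eta := eta_bound m d (supnorm len Q0) in Hk.
have N0eta : supnorm len Q0 <= eta := eta_bound_ge m d _.
have eta0 : 0 <= eta := le_trans N00 N0eta.
have kappa0 := kappa_min_ge0 eta0 Hk.
have f_max A := @f_bulk_maxbound R m d kappa _ A N00 b0 c0 Hd Hk.
(* B bounds both the numerical and the exact solution, G the factor g. *)
pose B := Num.max eta K.
have KB : K <= B by rewrite le_max lexx orbT.
have etaB : eta <= B by rewrite le_max lexx.
have B0 : 0 <= B := le_trans K0 KB.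
have [Cf Cf0 f_lip] := f_bulk_lip d m B0.
have [CF CF0 F_lip'] := lip_F_bulk d m B0.
have F_lip (A A' : 'M[R]_d) (HA : frob A <= B) (HA' : frob A' <= B) := (F_lip' A A' HA HA').2.
have B20 : 0 <= 2 * B by rewrite mulr_ge0.
have [CI CI0 F_incr] := F_bulk_increment d m B20.
have [E0 HE0] := initial_energy_bounded len0 T0 L0 flow cons KB CF0 F_lip.
pose G := expR (E0 + Cstar); have G0 : 0 <= G := expR_ge0 _.
have [mu [A [mu0 A0 growth]]] := step_growth len0 T0 L0 kappa0 Cs00 F_lower flow cons KB
  G0 Cf0 CF0 CI0 f_lip F_lip F_incr p12.
have [Cq Cq0 quad] := exact_energy_quadrature len0 flow cons KB Cf0 CF0 CI0 f_lip F_lip F_incr.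
have muL : 0 < mu * elL m by rewrite mulr_gt0.
pose E := expR (A * T); have E_ge0 : 0 <= E := expR_ge0 _.
pose C := Num.sqrt E + Num.sqrt (E / (mu * elL m)) + (Num.sqrt E + Cq).
exists C => M tau Q s M0 tau0 Htau [QE sE step] _ n nN.
pose t := n%:R * tau; pose eQ : gtensor R d M := fun k => Q n k - Qgrid len Qe t k.
suff: norm_h len eQ + gradnorm_h len eQ + `|s n - s_exact m len Qe t|
    <= C * (tau ^+ p + mesh_h len M ^+ 2) by [].
have Qg0 : restrict_h len Q0 = Qgrid len Qe 0 :> gtensor R d M.
  by apply/funext => k; rewrite /Qgrid /restrict_h Q0E//; exact: grid_point_box.
pose E0h := E_h m len (Qgrid len Qe 0 : gtensor R d M)
  (E1_h m len (Qgrid len Qe 0 : gtensor R d M)).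
have E0hE : E0h <= E0 by exact: HE0.
have tr : 2 * d%:R * elL m / mesh_h len M ^+ 2 <= 2 / tau - kappa * expR (E0h + Cstar).
  apply: (step_restriction len0 M0 L0 kappa0) => //.
  - by case: Hd => -[dE _]; [left|right].
  - by move: Htau; rewrite Qg0.
have SQ0 := Qgrid_in_S_h len0 flow M0 T00.
have I0 : scheme_inv m len Cstar E0h eta (Q 0%N) (s 0%N).
  rewrite QE sE Qg0; split=> //.
  - move=> k; have xb := grid_point_box len0 M0 k.
    rewrite /Qgrid /restrict_h Q0E//.
    exact: le_trans (supnorm_ge Q0b xb) N0eta.
  - rewrite /E_h; have := E1_h_ge len0 M0 Cs00 F_lower SQ0.
    have := E_el_ge0 len0 M0 L0 (in_S_h_zero_bdry SQ0); lra.
have Inv := scheme_invariants len0 M0 L0 kappa0 Cs00 eta0 F_lower f_max p12 tau0 tr I0 step.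
have good (P : gtensor R d M) (sigma : R) :
    scheme_inv m len Cstar E0h eta P sigma -> good_state m len B G P sigma.
  move=> [SP HP _ up]; split=> //; first by move=> k; exact: le_trans (HP k) etaB.
  have gE := g_h_le len0 M0 L0 Cs00 F_lower SP up.
  by apply: le_trans gE _; rewrite ler_expR lerD2r.
have tN k : (k <= Num.truncn (T / tau))%N -> 0 <= k%:R * tau <= T.
  rewrite truncn_ge_nat ?divr_ge0 ?(ltW T0) ?(ltW tau0)// ler_pdivlMr// => ->.
  by rewrite mulr_ge0 ?(ltW tau0).
have eps0 : 0 <= tau ^+ p + mesh_h len M ^+ 2.
  by rewrite addr_ge0 ?sqr_ge0// exprn_ge0// ltW.
set eps := _ + _ in eps0 *.
pose Phi k := sq_error m len Qe mu (Q k) (s k) (k%:R * tau).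
have PhiE : Phi n <= E * eps ^+ 2.
  apply: (@le_trans _ _ (expR (A * (n%:R * tau)) * eps ^+ 2)).
    apply: (@discrete_gronwall R Phi A tau (eps ^+ 2) (Num.truncn (T / tau))) => //.
    - exact: ltW.
    - exact: sqr_ge0.
    - rewrite /Phi /sq_error mul0r QE sE Qg0 !subrr normr0 expr0n /= addr0.
      rewrite /norm_h sqgradE -(scale0r (0 : gtensor R d M)) tipZl tlapZ scale0r.
      by rewrite tipC tipZl !mul0r sqrtr0 expr0n /= oppr0 mulr0 addr0.
    - move=> k kN; have /andP[k0 _] := tN k (ltnW kN); have /andP[_ k1] := tN _ kN.
      have kE : k.+1%:R * tau = k%:R * tau + tau by rewrite -natr1 mulrDl mul1r.
      rewrite /Phi kE; rewrite kE in k1.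
      have [SQ' HQ' _ _] := Inv k.+1.
      apply: growth => //; first exact: good.
      + by move=> k'; exact: le_trans (HQ' k') etaB.
      + move=> th P sigma th0 H; apply: good.
        exact: (sESAV1_inv len0 M0 L0 kappa0 th0 eta0 f_max (Inv k) H).
  rewrite ler_wpM2r ?sqr_ge0// ler_expR ler_wpM2l//.
  by have /andP[] := tN n nN.
have tT := tN n nN; have /andP[t0 tT'] := tT.
have [SQn _ _ _] := Inv n.
have Y0 : 0 <= sqgrad_h len eQ.
  by apply: sqgrad_ge0 => //; exact: (error_zero_bdry len0 flow M0 tT SQn).
have muY : 0 <= mu * elL m * sqgrad_h len eQ by rewrite mulr_ge0// ltW.
set z := `|s n - E1_h m len (Qgrid len Qe t : gtensor R d M)|.
have PhiD : Phi n = norm_h len eQ ^+ 2 + z ^+ 2 + mu * elL m * sqgrad_h len eQ by [].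
have [x2 z2] := (sqr_ge0 (norm_h len eQ), sqr_ge0 z).
have bx : norm_h len eQ <= Num.sqrt E * eps by apply: le_of_sqr_le => //; lra.
have bz : z <= Num.sqrt E * eps by apply: le_of_sqr_le => //; lra.
have bY : gradnorm_h len eQ <= Num.sqrt (E / (mu * elL m)) * eps.
  apply: le_of_sqr_le => //; first by rewrite divr_ge0// ltW.
  rewrite /gradnorm_h sqr_sqrtr// mulrAC ler_pdivlMr// mulrC; lra.
have bq := quad M t M0 tT.
have be : `|s n - s_exact m len Qe t| <= z + Cq * mesh_h len M ^+ 2.
  have -> : s n - s_exact m len Qe t = (s n - E1_h m len (Qgrid len Qe t : gtensor R d M))
    + (E1_h m len (Qgrid len Qe t : gtensor R d M) - s_exact m len Qe t) by ring.
  by apply: le_trans (ler_normD _ _) _; rewrite lerD2l.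
have he : Cq * mesh_h len M ^+ 2 <= Cq * eps.
  by rewrite ler_wpM2l// lerDr exprn_ge0// ltW.
rewrite /C !mulrDl; lra.
Qed.
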